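(* Let $q\in\mathbb{C}$ with $0<|q|<1$, and let $f$ be a nonconstant meromorphic function on $\mathbb{C}$ of order zero. Then $f$ has at most countably many Jackson-Nevanlinna deficient values; that is, the set of $a\in\mathbb{C}\cup\{\infty\}$ with $\Theta_J(a,f)>0$ is at most countable.
   Context: The Jackson difference operator is $D_qf(z)=\frac{f(qz)-f(z)}{qz-z}$. Nevanlinna notation for a meromorphic function $f$ on $\mathbb{C}$: $m(r,f)=\frac1{2\pi}\int_0^{2\pi}\log^+|f(re^{i\theta})|\,d\theta$; $N(r,f)=\int_0^r\frac{n(t,f)-n(0,f)}{t}\,dt+n(0,f)\log r$, where $n(t,f)$ is the number of poles of $f$ in $\{|z|<t\}$ counted with multiplicity and $n(0,f)$ is the multiplicity of the pole at $0$ (zero if there is none); $T(r,f)=m(r,f)+N(r,f)$. The order is $\sigma(f)=\limsup_{r\to\infty}\frac{\log T(r,f)}{\log r}$. Jackson-type counting functions. For $a\in\mathbb{C}$, $\tilde n_J(r,f=a)$ is the sum of the integers $h-k$ over all points $z$ in $\{|z|<r\}$ at which $f(z)=a$, where $h$ is the multiplicity of the $a$-point $z$ and $k=\min\{h,k'\}$, with $k'$ the multiplicity of $z$ as a zero of $D_qf$ ($k'=0$ if $z$ is not a zero of $D_qf$). For $a=\infty$, $\tilde n_J(r,f=\infty)=\tilde n_J(r,\frac1f=0)$ is the sum of the integers $h-k$ over all poles $z$ of $f$ in $\{|z|<r\}$, where $h$ is the multiplicity of the pole and $k=\min\{h,k'\}$, with $k'$ the multiplicity of $z$ as a zero of $D_q(1/f)$.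 For $a\in\mathbb{C}\cup\{\infty\}$, $$\tilde N_J(r,f=a)=\int_0^r\frac{\tilde n_J(t,f=a)-\tilde n_J(0,f=a)}{t}\,dt+\tilde n_J(0,f=a)\log r,$$ where $\tilde n_J(0,f=a)$ is the contribution of the point $z=0$. The Jackson ramification index is $\Theta_J(a,f)=1-\limsup_{r\to\infty}\frac{\tilde N_J(r,f=a)}{T(r,f)}$, and $a\in\mathbb{C}\cup\{\infty\}$ is a Jackson-Nevanlinna deficient value of $f$ if $\Theta_J(a,f)>0$. *)

(* Defs.v *)
From HB Require Import structures.
From mathcomp Require Export all_boot all_order all_algebra.
From mathcomp Require Export all_classical all_reals all_analysis.
From mathcomp Require Export complex.
Set Implicit Arguments.
Unset Strict Implicit.
Unset Printing Implicit Defensive.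
Import Order.TTheory GRing.Theory Num.Theory.
Import numFieldNormedType.Exports.
Local Open Scope classical_set_scope.
Local Open Scope ring_scope.
Local Open Scope complex_scope.

(* C \cup {oo}: [Some z] is the finite value z, [None] is infinity. *)
Notation sphere R := (one_point_compactification R[i]).

Section Meromorphic.
Context {R : realType}.
Implicit Types (f : R[i] -> sphere R) (g : R[i] -> R[i]) (z : R[i]).

(* The norm `|z| of R[i] has values in R[i]; this is the R-valued modulus. *)
Definition modulus z : R := ComplexField.Normc.normc z.

Definition holomorphic_at g z :=
  \forall w \near (z : R[i]^o), derivable (g : R[i]^o -> R[i]^o) w 1.

Definition sphere_inv (w : sphere R) : sphere R :=
  match w with
  | Some c => if c == 0 then None else Some c^-1
  | None => Some 0
  end.

(* The arbitrary value 0 at infinity is harmless: below, [finite_part f] is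
   either integrated on circles, which contain finitely many poles, or
   expanded in a punctured neighbourhood. *)
Definition finite_part f z : R[i] := odflt 0 (f z).

Definition meromorphic f := forall z,
  (\forall w \near (z : R[i]^o)^', f w <> None) /\
  ((exists2 g, holomorphic_at g z & \forall w \near (z : R[i]^o), f w = Some (g w)) \/
   (exists2 g, holomorphic_at g z &
      \forall w \near (z : R[i]^o), sphere_inv (f w) = Some (g w))).

(* The germ of g in a punctured neighbourhood of z is meromorphic, with order
   m at z (m > 0: zero of multiplicity m; m < 0: pole of multiplicity -m).
   The value g z plays no role, so removable singularities are removed. *)
Definition has_order g z (m : int) :=
  exists h, [/\ holomorphic_at h z, h z != 0 &
    \forall w \near (z : R[i]^o)^', g w = (w - z) ^ m * h w].

(* A germ that vanishes identically has no order and gets the default 0. For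
   nonconstant f and 0 < |q| < 1 this does not occur among the functions
   f - c, 1 / f, D_q f and D_q (1 / f) to which this is applied. *)
Definition order_at g z : int := xget 0 [set m | has_order g z m].

Definition zero_mult g z : nat := absz (Num.max 0 (order_at g z)).
Definition pole_mult g z : nat := absz (Num.max 0 (- order_at g z)).

End Meromorphic.

Section Nevanlinna.
Context {R : realType}.
Implicit Types (f : R[i] -> sphere R) (r : R).

(* The library's [ln] is 0 at 0, so this is also right at x = 0. *)
Definition log_plus (x : R) : R := Num.max 0 (ln x).

Definition proximity f r : R :=
  (2 * pi)^-1 *
  \int[lebesgue_measure]_(t in `[0, 2 * pi])
    log_plus (modulus (finite_part f ((r * cos t) +i* (r * sin t)))).

Definition pole_count f r : R :=
  \sum_(z \in [set z : R[i] | modulus z < r /\ f z = None])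
    ((pole_mult (finite_part f) z)%:R : R).

Definition pole_count0 f : R := (pole_mult (finite_part f) 0)%:R.

Definition integrated_count (n : R -> R) (n0 r : R) : R :=
  \int[lebesgue_measure]_(t in `]0, r[) ((n t - n0) / t) + n0 * ln r.

Definition characteristic f r : R :=
  proximity f r + integrated_count (pole_count f) (pole_count0 f) r.

Definition growth_order f : \bar R :=
  limf_esup (fun r => (ln (characteristic f r) / ln r)%:E) (pinfty_nbhs R).

End Nevanlinna.

Section Jackson.
Context {R : realType}.
Implicit Types (q z : R[i]) (f : R[i] -> sphere R) (a : sphere R) (r : R).

(* Used only through its order at a point, hence only through its values at
   nearby w <> 0 where both f w and f (q * w) are finite. *)
Definition jackson q f z : R[i] :=
  (finite_part f (q * z) - finite_part f z) / (q * z - z).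

(* h - k for a c-point z *)
Definition jackson_mult_fin q f (c : R[i]) z : nat :=
  let h := zero_mult (fun w => finite_part f w - c) z in
  let k' := zero_mult (jackson q f) z in
  (h - minn h k')%N.

Definition jackson_mult q f a z : nat :=
  match a with
  | Some c => jackson_mult_fin q f c z
  | None => jackson_mult_fin q (fun w => sphere_inv (f w)) 0 z
  end.

Definition jackson_count q f a r : R :=
  \sum_(z \in [set z : R[i] | modulus z < r /\ f z = a])
    ((jackson_mult q f a z)%:R : R).

Definition jackson_count0 q f a : R :=
  if `[< f 0 = a >] then (jackson_mult q f a 0)%:R else 0.

Definition jackson_Ncount q f a r : R :=
  integrated_count (jackson_count q f a) (jackson_count0 q f a) r.

Definition jackson_ramification q f a : \bar R :=
  (1 - limf_esup (fun r => (jackson_Ncount q f a r / characteristic f r)%:E)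
         (pinfty_nbhs R))%E.

Definition jackson_deficient q f a : Prop :=
  (0 < jackson_ramification q f a)%E.

End Jackson.

(* Main.v *)
(* Along the radii r_n = rho |q|^-n the characteristic T of a function of order
   zero cannot grow exponentially, so there are arbitrarily large n such that
   T(r_(n-1)) <= T(r_n) and T(r_(n+i)) <= 2 T(r_n) for all i up to a prescribed
   bound. At such a radius the Poisson and Jensen formulas show that, for every
   finite c, ln |f - c| deviates from its mean over the circle by at most
   eta T + O(1) in L^1, with eta as small as desired. If 1/(f - c) and 1/(f - d)
   both had a proximity function at least delta T, both means would be very
   negative, contradicting |f - c| + |f - d| >= |c - d|. Hence, among finitely
   many values c, all but one satisfy N(r, f = c) >= (1 - delta) T.
   On the other hand a c-point of multiplicity h is counted less than h times by
   N_J only if it is a zero of f(q z) - f(z), and the c-points are disjoint for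
   different c. So N and N_J, summed over c, differ by at most the counting
   function of the zeros of f(q z) - f(z), which is at most
   T(r) + T(|q| r) + O(1) <= 2 T(r) + O(1). It follows that
   N_J(r, f = c) <= (1 - eps) T(r) for all r > r0 can hold for less than 8 / eps
   finite values c, and the set of deficient values is, up to infinity, a
   countable union of such finite sets. *)
Require Import Defs.
From mathcomp Require Import ring lra zify.
Import Order.TTheory GRing.Theory Num.Theory.
Import numFieldNormedType.Exports.
Local Open Scope classical_set_scope.
Local Open Scope ring_scope.
Local Open Scope complex_scope.
Set Implicit Arguments.
Unset Strict Implicit.
Unset Printing Implicit Defensive.

(** The deviation estimate plays the part that the lemma on the logarithmic derivative has in the
    classical second main theorem. On [|z| = r], [ln |f - c|] is a sum of terms [± ln |z - s|], each
    with mean deviation at most [2 ln 2], plus [ln |h|] with [h] free of zeros. The latter varies on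
    the circle by [O(1 / K)] times its mean deviation on [|z| = K r], and the number of terms is at
    most [N(K^2 r) / ln (K / 2)], where [N] counts both zeros and poles. Both errors are small
    against [T(r)] once [K] is large and [T(K^2 r) <= 2 T(r)]; so the range over which [T] must be
    slow depends on [eps], and order zero is what provides such radii for every range. The
    inequality [T(r_(n-1)) <= T(r_n)] comes from choosing [n] among the records of the sequence. The
    number [rho] is chosen outside a countable set, so that no circle in use meets a zero or pole
    and every logarithm that is integrated is continuous. *)

Local Notation Re := (@complex.Re _).
Local Notation Im := (@complex.Im _).

(** * Integration along circles *)

Section Cousin.
Context {R : realType}.

Definition half (b : bool) (I : R * R) : R * R :=
  if b then (I.1, (I.1 + I.2) / 2) else ((I.1 + I.2) / 2, I.2).

(** The left end points increase and every right end point bounds them, so their supremum lies in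
    all the intervals. *)
Lemma nested_halves (I0 : R * R) (s : nat -> bool) (I : nat -> R * R) :
  I0.1 < I0.2 -> I 0%N = I0 -> (forall n, I n.+1 = half (s n) (I n)) ->
  exists x, forall n, [/\ (I n).1 <= x <= (I n).2, I0.1 <= (I n).1, (I n).2 <= I0.2 &
    (I n).2 - (I n).1 = (I0.2 - I0.1) / 2 ^+ n].
Proof.
move=> lt0 I00 IS.
have lenI n : (I n).2 - (I n).1 = (I0.2 - I0.1) / 2 ^+ n.
  elim: n => [|m IH]; first by rewrite I00 expr0 divr1.
  by rewrite IS exprS invfM mulrCA -IH /half; case: (s m) => /=; field.
have lt n : (I n).1 < (I n).2.
  by rewrite -subr_gt0 lenI divr_gt0 ?subr_gt0// exprn_gt0.
have nested n k : (I n).1 <= (I (n + k)%N).1 /\ (I (n + k)%N).2 <= (I n).2.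
  elim: k => [|k [IH1 IH2]]; first by rewrite addn0.
  rewrite addnS IS /half; have := lt (n + k)%N.
  by case: (s _) => /= ?; split; lra.
pose A := range (fun n => (I n).1).
have ub m : ubound A (I m).2.
  move=> _ [n _ <-] /=; have [le|le] := leqP n m.
    have [h _] := nested n (m - n)%N; rewrite subnKC// in h.
    exact: le_trans h (ltW (lt _)).
  have [_ h] := nested m (n - m)%N; rewrite subnKC 1?ltnW// in h.
  exact: le_trans (ltW (lt _)) h.
exists (sup A) => n.
have hs : has_sup A by split; [exists (I 0%N).1, 0%N|exists (I 0%N).2; exact: ub].
have [h1 h2] := nested 0%N n; rewrite add0n I00 in h1 h2.
split => //; rewrite ge_sup// ?andbT; last by exists (I 0%N).1, 0%N.
by apply: sup_upper_bound => //; exists n.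
Qed.

Lemma half_sub b (I : R * R) : I.1 < I.2 -> I.1 <= (half b I).1 /\ (half b I).2 <= I.2.
Proof. by case: b => /= ?; split; lra. Qed.

(* Bisection only produces rectangles similar to [I0 x J0], so the local
   hypothesis can be restricted to these. *)
Lemma cousin (P : R * R -> R * R -> Prop) (I0 J0 : R * R) :
  I0.1 < I0.2 -> J0.1 < J0.2 ->
  (forall I J, I.1 < I.2 -> J.1 < J.2 ->
     (forall b c, P (half b I) (half c J)) -> P I J) ->
  (forall x y, I0.1 <= x <= I0.2 -> J0.1 <= y <= J0.2 ->
     exists2 e, 0 < e & forall I J,
       I.1 < I.2 -> J.1 < J.2 -> I0.1 <= I.1 -> I.2 <= I0.2 ->
       J0.1 <= J.1 -> J.2 <= J0.2 -> I.1 <= x <= I.2 -> J.1 <= y <= J.2 ->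
       I.2 - I.1 < e -> J.2 - J.1 < e ->
       (I.2 - I.1) * (J0.2 - J0.1) = (J.2 - J.1) * (I0.2 - I0.1) -> P I J) ->
  P I0 J0.
Proof.
move=> lI lJ split_P loc_P; apply: contrapT => nP.
(* A rectangle where [P] fails has a quarter where [P] fails. The hypotheses stand inside the
   existential, so that [choice] yields a total function. *)
have : forall Q : (R * R) * (R * R), exists bc : bool * bool,
    Q.1.1 < Q.1.2 -> Q.2.1 < Q.2.2 -> ~ P Q.1 Q.2 -> ~ P (half bc.1 Q.1) (half bc.2 Q.2).
  move=> [I J] /=; apply: contrapT => /forallNP h.
  have [hI hJ hP] : [/\ I.1 < I.2, J.1 < J.2 & ~ P I J].
    by have /not_implyP[? /not_implyP[? /not_implyP[? _]]] := h (true, true).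
  apply: hP; apply: split_P => // b c; have := h (b, c).
  by move=> /not_implyP[_ /not_implyP[_ /not_implyP[_ /contrapT]]].
case/choice => bc bcP.
pose Q := fix Q n := if n is m.+1 then
  (half (bc (Q m)).1 (Q m).1, half (bc (Q m)).2 (Q m).2) else (I0, J0).
have [x xP] := @nested_halves I0 (fun n => (bc (Q n)).1) (fun n => (Q n).1) lI erefl (fun=> erefl).
have [y yP] := @nested_halves J0 (fun n => (bc (Q n)).2) (fun n => (Q n).2) lJ erefl (fun=> erefl).
have ltQ n : (Q n).1.1 < (Q n).1.2 /\ (Q n).2.1 < (Q n).2.2.
  have [_ _ _ e1] := xP n; have [_ _ _ e2] := yP n.
  by split; rewrite -subr_gt0 ?e1 ?e2 divr_gt0 ?subr_gt0 ?exprn_gt0.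
have nPQ n : ~ P (Q n).1 (Q n).2.
  elim: n => // n IH; have [? ?] := ltQ n; exact: bcP.
have [|| e e0 eP] := loc_P x y.
- by have [] := xP 0%N.
- by have [] := yP 0%N.
pose L := Num.max (I0.2 - I0.1) (J0.2 - J0.1).
have L0 : 0 < L by rewrite lt_max subr_gt0 lI.
have [n nP'] : exists n, L / 2 ^+ n < e.
  exists (Num.bound (L / e)); rewrite ltr_pdivrMr ?exprn_gt0// -ltr_pdivrMl// mulrC.
  apply: lt_le_trans (archi_boundP (ltW (divr_gt0 L0 e0))) _.
  by rewrite -natrX ler_nat ltnW// ltn_expl.
have [? ?] := ltQ n; have [? ? ? e1] := xP n; have [? ? ? e2] := yP n.
apply: (nPQ n); apply: eP => //.
- rewrite e1; apply: le_lt_trans nP'; rewrite ler_pM2r ?invr_gt0 ?exprn_gt0//.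
  by rewrite /L le_max lexx.
- rewrite e2; apply: le_lt_trans nP'; rewrite ler_pM2r ?invr_gt0 ?exprn_gt0//.
  by rewrite /L le_max lexx orbT.
- by rewrite e1 e2; ring.
Qed.
End Cousin.

Section Modulus.
Context {R : realType}.
Local Notation C := (R[i]^o).
Implicit Types (z w : R[i]).

Lemma normE z : `|z| = (modulus z)%:C. Proof. by []. Qed.
Lemma modulus_ge0 z : 0 <= modulus z.
Proof. by rewrite -ler0c -normE normr_ge0. Qed.
Lemma modulusM z w : modulus (z * w) = modulus z * modulus w.
Proof. exact: ComplexField.Normc.normcM. Qed.
Lemma modulusV z : modulus z^-1 = (modulus z)^-1.
Proof. exact: ComplexField.Normc.normcV. Qed.
Lemma modulusX z n : modulus (z ^+ n) = modulus z ^+ n.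
Proof.
elim: n => [|n IH]; last by rewrite !exprS modulusM IH.
by rewrite !expr0 /modulus ComplexField.Normc.normc1.
Qed.
Lemma modulusD z w : modulus (z + w) <= modulus z + modulus w.
Proof. exact: le_normcD. Qed.
Lemma modulusN z : modulus (- z) = modulus z.
Proof. exact: normcN. Qed.
Lemma modulusB z w : modulus (z - w) <= modulus z + modulus w.
Proof. by rewrite -(modulusN w) modulusD. Qed.
Lemma modulusC z w : modulus (z - w) = modulus (w - z).
Proof. by rewrite -modulusN opprB. Qed.
Lemma modulus0 : modulus (0 : R[i]) = 0.
Proof. exact: ComplexField.Normc.normc0. Qed.
Lemma modulus1 : modulus (1 : R[i]) = 1.
Proof. exact: ComplexField.Normc.normc1. Qed.
Lemma modulus_eq0 z : (modulus z == 0) = (z == 0).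
Proof.
apply/eqP/eqP => [|->]; last exact: modulus0.
exact: ComplexField.Normc.eq0_normc.
Qed.
Lemma modulus_gt0 z : (0 < modulus z) = (z != 0).
Proof. by rewrite lt_def modulus_ge0 andbT modulus_eq0. Qed.
Lemma modulus_real (x : R) : modulus x%:C = `|x|.
Proof. by rewrite /modulus/= expr0n/= addr0 sqrtr_sqr. Qed.
Lemma modulus_i : modulus ('i : R[i]) = 1.
Proof. by rewrite /modulus/= expr0n/= add0r expr1n sqrtr1. Qed.
Lemma Re_le_modulus z : `|Re z| <= modulus z.
Proof. by rewrite -lecR -normE normc_ge_Re. Qed.
Lemma modulusJ z : modulus z^* = modulus z.
Proof. by apply: complexI; rewrite -!normE normcJ. Qed.
Lemma Im_le_modulus z : `|Im z| <= modulus z.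
Proof.
have := Re_le_modulus (- (z * 'i)).
by rewrite modulusN modulusM modulus_i mulr1 raddfN/= ReiNIm opprK.
Qed.
Lemma modulus_le_ReIm z : modulus z <= `|Re z| + `|Im z|.
Proof.
rewrite {1}[z]complexE; apply: (le_trans (modulusD _ _)).
by rewrite modulusM modulus_i mul1r !modulus_real.
Qed.
Lemma modulus_sub_le z w : modulus z - modulus w <= modulus (z - w).
Proof. by rewrite lerBlDr -{1}(subrK w z) modulusD. Qed.

Lemma modulus_dist_le z w : `|modulus z - modulus w| <= modulus (z - w).
Proof.
rewrite ler_norml modulus_sub_le andbT lerNl opprB modulusC.
exact: modulus_sub_le.
Qed.

Lemma Re_real_mul (x : R) z : Re (x%:C * z) = x * Re z.
Proof. by case: z => a b /=; rewrite mul0r subr0. Qed.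
Lemma Im_real_mul (x : R) z : Im (x%:C * z) = x * Im z.
Proof. by case: z => a b /=; rewrite mul0r addr0. Qed.

(** Neighbourhoods in [R[i]] are given by radii in [R[i]], whose positivity forces them to be real.
    This passes to radii in [R], which all later estimates use. *)
Lemma nearC z (P : R[i] -> Prop) : (\forall w \near (z : C), P w) <->
  exists2 e : R, 0 < e & forall w, modulus (w - z) < e -> P w.
Proof.
split.
  move=> /nbhs_normP[e /= e0 eP]; exists (Re e).
    by move: e0; rewrite ltcE/= => /andP[].
  move=> w we; apply: eP => /=; rewrite distrC normE ltcE/=.
  by rewrite we andbT; move: e0; rewrite ltcE/= => /andP[].
move=> [e e0 eP]; apply/nbhs_normP; exists e%:C => /=; first by rewrite ltcR.
by move=> w /=; rewrite distrC normE ltcR; exact: eP.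
Qed.

Lemma near_dnbhsC z (P : R[i] -> Prop) : (\forall w \near (z : C)^', P w) <->
  exists2 e : R, 0 < e & forall w, w != z -> modulus (w - z) < e -> P w.
Proof.
have -> : (\forall w \near (z : C)^', P w) <-> (\forall w \near (z : C), w != z -> P w) by [].
by split=> [/nearC[e e0 h]|[e e0 h]]; [|apply/nearC]; exists e => // w; auto.
Qed.

Lemma nearS2C z (P Q S : R[i] -> Prop) : (forall w, P w -> Q w -> S w) ->
  (\forall w \near (z : C), P w) -> (\forall w \near (z : C), Q w) -> \forall w \near (z : C), S w.
Proof.
move=> PQS /nearC[e e0 he] /nearC[d d0 hd]; apply/nearC.
exists (Num.min e d) => [|w]; first by rewrite lt_min e0.
by rewrite lt_min => /andP[we wd]; exact: PQS (he w we) (hd w wd).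
Qed.

Lemma near_dnbhsS2C z (P Q S : R[i] -> Prop) : (forall w, w != z -> P w -> Q w -> S w) ->
  (\forall w \near (z : C)^', P w) -> (\forall w \near (z : C)^', Q w) ->
  \forall w \near (z : C)^', S w.
Proof.
move=> PQS /near_dnbhsC[e e0 he] /near_dnbhsC[d d0 hd]; apply/near_dnbhsC.
exists (Num.min e d) => [|w wz]; first by rewrite lt_min e0.
by rewrite lt_min => /andP[we wd]; exact: PQS (he w wz we) (hd w wz wd).
Qed.

Lemma near_dnbhs_weakC z (P : R[i] -> Prop) :
  (\forall w \near (z : C), P w) -> \forall w \near (z : C)^', P w.
Proof. by move=> /nearC[e e0 he]; apply/near_dnbhsC; exists e => // w _; exact: he. Qed.

(** Multiplying out the difference quotient removes the division and the exclusion of [w = z], which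
    makes remainder estimates composable. *)
Lemma is_deriveC (g : R[i] -> R[i]) z (d : R[i]) :
  is_derive (z : C) 1 (g : C -> C) d <->
  forall e : R, 0 < e -> exists2 del : R, 0 < del & forall w, modulus (w - z) < del ->
    modulus (g w - g z - d * (w - z)) <= e * modulus (w - z).
Proof.
split=> [[dg <-] e e0|h].
  have /cvgrPdist_le/(_ e%:C) := dg; rewrite ltcR => /(_ e0)/near_dnbhsC[del del0 h].
  exists del => // w wd; have [->|wz] := eqVneq w z.
    by rewrite !subrr mulr0 subr0 modulus0 mulr0.
  have wz0 : w - z != 0 by rewrite subr_eq0.
  move: (h (w - z) wz0); rewrite subr0 => /(_ wd); rewrite /derive normE lecR.
  move: (lim _) => /= D {}h.
  have {h} : modulus (D - (w - z)^-1 * (g w - g z)) <= e.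
    by move: h; rewrite /= [_%:A]mulr1 subrK.
  have -> : g w - g z - D * (w - z) = - (w - z) * (D - (w - z)^-1 * (g w - g z)).
    by field.
  by move=> h; rewrite modulusM modulusN mulrC ler_wpM2r ?modulus_ge0.
suff cv : ((h0 : C)^-1 *: ((g : C -> C) (h0 *: (1 : C) + z) - g z) @[h0 --> (0 : C)^'] --> (d : C)).
  by split; [apply/cvg_ex; exists d|exact: cvg_lim cv].
apply/cvgrPdist_le => e e0.
have [e1 e2] : 0 < Re e /\ Im e = 0 by move: e0; rewrite ltcE/= => /andP[/eqP-> ->].
have [del del0 hd] := h _ e1.
apply/near_dnbhsC; exists del => // k k0; rewrite subr0 => kd.
have := hd (k + z); rewrite addrK => /(_ kd) hk.
have -> : e = (Re e)%:C by case: (e) e2 => a b /= ->.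
rewrite normE lecR.
have -> : d - k^-1 *: ((g : C -> C) (k *: (1 : C) + z) - g z) = - k^-1 * (g (k + z) - g z - d * k).
  have E (u v : R[i]) : u - k^-1 * v = - k^-1 * (v - u * k) by field.
  by rewrite [k *: _]mulr1; exact: E.
by rewrite modulusM modulusN modulusV mulrC ler_pdivrMr ?modulus_gt0.
Qed.

Lemma derivableC (g : R[i] -> R[i]) z : derivable (g : C -> C) z 1 <->
  exists d, is_derive (z : C) 1 (g : C -> C) d.
Proof.
by split=> [/derivableP h|[d [h _]]] //; eexists; exact: h.
Qed.

Lemma is_derive_nearC (g1 g2 : R[i] -> R[i]) z (d : R[i]) (e : R) : 0 < e ->
  (forall w, modulus (w - z) < e -> g1 w = g2 w) ->
  is_derive (z : C) 1 (g1 : C -> C) d -> is_derive (z : C) 1 (g2 : C -> C) d.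
Proof.
move=> e0 g12 /is_deriveC h; apply/is_deriveC => e1 /h[del del0 hdel].
exists (Num.min del e); first by rewrite lt_min del0.
move=> w; rewrite lt_min => /andP[wd we].
by rewrite -!g12 ?subrr ?modulus0//; exact: hdel.
Qed.

Lemma is_deriveZC (c : R[i]) (g : R[i] -> R[i]) z (d : R[i]) :
  is_derive (z : C) 1 (g : C -> C) d -> is_derive (z : C) 1 ((fun w => c * g w) : C -> C) (c * d).
Proof.
move=> /is_deriveC h; apply/is_deriveC => e e0.
(* The [+ 1] keeps the divisor positive when [c = 0]. *)
have B0 : 0 < modulus c + 1 by rewrite ltr_wpDl ?modulus_ge0.
have [|del del0 hdel] := h (e / (modulus c + 1)); first by rewrite divr_gt0.
exists del => // w /hdel {}h.
have -> : c * g w - c * g z - c * d * (w - z) = c * (g w - g z - d * (w - z)) by ring.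
rewrite modulusM; apply: (le_trans (ler_wpM2l (modulus_ge0 _) h)).
rewrite mulrA ler_wpM2r ?modulus_ge0// mulrA ler_pdivrMr// mulrC ler_wpM2l ?lerDl//.
exact: ltW.
Qed.

Lemma is_derive_affineC (g : R[i] -> R[i]) (c b : R[i]) z (d : R[i]) :
  is_derive (c * z + b : C) 1 (g : C -> C) d ->
  is_derive (z : C) 1 ((fun w => g (c * w + b)) : C -> C) (d * c).
Proof.
move=> /is_deriveC h; apply/is_deriveC => e e0.
have B0 : 0 < modulus c + 1 by rewrite ltr_wpDl ?modulus_ge0.
have [|del del0 hdel] := h (e / (modulus c + 1)); first by rewrite divr_gt0.
have E w : c * w + b - (c * z + b) = c * (w - z) by ring.
have le w : modulus (c * (w - z)) <= (modulus c + 1) * modulus (w - z).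
  by rewrite modulusM ler_wpM2r ?modulus_ge0// lerDl.
exists (del / (modulus c + 1)); first by rewrite divr_gt0.
move=> w wd; have := hdel (c * w + b); rewrite E mulrA => {}h.
apply: (le_trans (h _)).
  by apply: le_lt_trans (le w) _; rewrite mulrC -ltr_pdivlMr.
apply: (le_trans (ler_wpM2l _ (le w))); first by rewrite ltW// divr_gt0.
by rewrite mulrA divfK// gt_eqF.
Qed.

Lemma derivable_nearC (g1 g2 : R[i] -> R[i]) z (e : R) : 0 < e ->
  (forall w, modulus (w - z) < e -> g1 w = g2 w) ->
  derivable (g1 : C -> C) z 1 -> derivable (g2 : C -> C) z 1.
Proof.
move=> e0 g12 /derivableC[d h]; apply/derivableC; exists d.
exact: is_derive_nearC e0 g12 h.
Qed.

Lemma derivable_continuousC (g : R[i] -> R[i]) z : derivable (g : C -> C) z 1 ->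
  {for (z : C), continuous (g : C -> C)}.
Proof. by move=> /derivable1_diffP/differentiable_continuous. Qed.

Lemma continuousC (g : R[i] -> R[i]) z : {for (z : C), continuous (g : C -> C)} <->
  forall e : R, 0 < e -> exists2 del : R, 0 < del & forall w, modulus (w - z) < del ->
    modulus (g w - g z) < e.
Proof.
split=> [/cvgrPdist_lt h e e0|h].
  have /nearC[del d0 hd] := h e%:C (ltac:(by rewrite ltcR)); exists del => // w /hd.
  by rewrite distrC normE ltcR.
suff : (g : C -> C) w @[w --> (z : C)] --> (g z : C) by [].
apply/(@cvgrPdist_lt R[i] C C (nbhs (z : C)) (nbhs_filter (z : C))) => e e0.
have [e1 e2] : 0 < Re e /\ Im e = 0 by move: e0; rewrite ltcE/= => /andP[/eqP-> ->].
have [del d0 hd] := h _ e1; apply/nearC; exists del => // w /hd.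
rewrite distrC normE => hw; have -> : e = (Re e)%:C by case: (e) e2 => a b /= ->.
by rewrite ltcR.
Qed.

Lemma continuous_path (g : R -> R[i]) t : {for t, continuous (g : R -> C)} <->
  {for t, continuous (fun x => Re (g x))} /\ {for t, continuous (fun x => Im (g x))}.
Proof.
split=> [/cvgrPdist_lt h|[/cvgrPdist_lt h1 /cvgrPdist_lt h2]].
  split; apply/cvgrPdist_lt => e e0; have := h e%:C (ltac:(by rewrite ltcR));
    apply: filterS => x; rewrite normE ltcR; apply: le_lt_trans.
    by rewrite -raddfB Re_le_modulus.
  by rewrite -raddfB Im_le_modulus.
apply/cvgrPdist_lt => e e0.
have [e1 e2] : 0 < Re e /\ Im e = 0 by move: e0; rewrite ltcE/= => /andP[/eqP-> ->].
have -> : e = (Re e)%:C by case: (e) e2 => a b /= ->.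
near=> x; rewrite normE ltcR; apply: le_lt_trans (modulus_le_ReIm _) _.
rewrite !raddfB/= [Re e]splitr ltrD//.
  by near: x; apply: h1; rewrite divr_gt0.
by near: x; apply: h2; rewrite divr_gt0.
Unshelve. all: by end_near. Qed.

Lemma continuous_modulus (g : R -> R[i]) t : {for t, continuous (g : R -> C)} ->
  {for t, continuous (fun x => modulus (g x))}.
Proof.
move=> /cvgrPdist_lt h; apply/cvgrPdist_lt => e e0.
have := h e%:C (ltac:(by rewrite ltcR)); apply: filterS => x; rewrite normE ltcR.
by apply: le_lt_trans; exact: modulus_dist_le.
Qed.

Lemma continuous_comp_path (g : R[i] -> R[i]) (p : R -> R[i]) t :
  {for t, continuous (p : R -> C)} -> derivable (g : C -> C) (p t) 1 ->
  {for t, continuous (g \o p : R -> C)}.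
Proof. by move=> cp /derivable_continuousC; apply: continuous_comp. Qed.

End Modulus.

Section RealIntegral.
Context {R : realType}.
Local Notation mu := (@lebesgue_measure R).
Implicit Types (f g : R -> R) (a b c : R).

Definition rint a b f : R := \int[mu]_(t in `[a, b]) f t.

(** Two-sided continuity, also at the end points: the integrands extend beyond the interval, and
    this form composes without the subspace topology. *)
Definition rcont a b f := forall t, a <= t <= b -> {for t, continuous f}.

Lemma rcontD a b f g : rcont a b f -> rcont a b g -> rcont a b (f \+ g).
Proof. by move=> hf hg t ht; apply: cvgD; [exact: hf|exact: hg]. Qed.

Lemma rcontZ a b k f : rcont a b f -> rcont a b (fun t => k * f t).
Proof. by move=> hf t ht; apply: cvgM; [exact: cvg_cst|exact: hf]. Qed.

Lemma rcont_cst a b k : rcont a b (fun=> k).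
Proof. by move=> t _; exact: cvg_cst. Qed.

Lemma rcont_norm a b f : rcont a b f -> rcont a b (fun t => `|f t|).
Proof. by move=> hf t ht; apply: cvg_norm; exact: hf. Qed.

Lemma rcont_within a b f : rcont a b f -> {within `[a, b], continuous f}.
Proof.
move=> h; apply: continuous_in_subspaceT => t; rewrite inE/= in_itv/=.
exact: h.
Qed.

Lemma rint_integrable a b f : rcont a b f -> mu.-integrable `[a, b] (EFin \o f).
Proof.
move=> /rcont_within h; apply: continuous_compact_integrable => //.
exact: segment_compact.
Qed.

Lemma eq_rint a b f g : (forall t, a <= t <= b -> f t = g t) -> rint a b f = rint a b g.
Proof.
by move=> h; apply: eq_Rintegral => t; rewrite inE/= in_itv/=; exact: h.
Qed.

Lemma rintD a b f g : rcont a b f -> rcont a b g ->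
  rint a b (fun t => f t + g t) = rint a b f + rint a b g.
Proof. by move=> hf hg; apply: RintegralD => //; exact: rint_integrable. Qed.

Lemma rintZ a b k f : rcont a b f -> rint a b (fun t => k * f t) = k * rint a b f.
Proof. by move=> hf; apply: RintegralZl => //; exact: rint_integrable. Qed.

Lemma rint_le a b f g : rcont a b f -> rcont a b g ->
  (forall t, a <= t <= b -> f t <= g t) -> rint a b f <= rint a b g.
Proof.
move=> hf hg h; apply: le_Rintegral => //; try exact: rint_integrable.
Qed.

Lemma rint_cst a b k : a <= b -> rint a b (fun=> k) = k * (b - a).
Proof.
move=> ab; rewrite /rint Rintegral_cst//= lebesgue_measure_itv/= lte_fin.
by case: ltgtP ab => //= -> _; rewrite subrr.
Qed.

Lemma rint_abs a b f : rcont a b f -> `|rint a b f| <= rint a b (fun t => `|f t|).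
Proof. by move=> hf; apply: le_normr_Rintegral => //; exact: rint_integrable. Qed.

Lemma rint_split a b c f : a <= c <= b -> rcont a b f ->
  rint a b f = rint a c f + rint c b f.
Proof.
move=> /andP[ac cb] hf; have fi := rint_integrable hf.
apply/eqP; rewrite addrC -subr_eq; apply/eqP; rewrite /rint.
rewrite Rintegral_itvB// ?bnd_simp// Rintegral_itv_obnd_cbnd//.
apply: (integrableS _ _ _ fi) => //.
by apply: subset_itvr; rewrite bnd_simp.
Qed.

Lemma rint_FTC a b F f : a <= b -> rcont a b f ->
  (forall t, a <= t <= b -> is_derive t 1 F (f t)) -> rint a b f = F b - F a.
Proof.
rewrite le_eqVlt => /predU1P[<- _ _|ab hf dF].
  by rewrite /rint set_itv1 Rintegral_set1 subrr.
have dFc t : a <= t <= b -> {for t, continuous F}.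
  by move=> /dF[/derivable1_diffP/differentiable_continuous].
rewrite /rint /Rintegral (@continuous_FTC2 _ f F a b) //.
- exact: rcont_within.
- split => [t||].
  + by rewrite in_itv/= => /andP[h1 h2]; have [] : is_derive t 1 F (f t) by apply: dF; rewrite !ltW.
  + by apply: cvg_at_right_filter; apply: dFc; rewrite lexx ltW.
  + by apply: cvg_at_left_filter; apply: dFc; rewrite lexx ltW.
- move=> t; rewrite in_itv/= => /andP[h1 h2]; rewrite derive1E.
  by have [_ ->] : is_derive t 1 F (f t) by apply: dF; rewrite !ltW.
Qed.

End RealIntegral.

Section ComplexIntegral.
Context {R : realType}.
Local Notation C := (R[i]^o).
Implicit Types (g p : R -> R[i]) (a b c : R).

Definition ccont a b g := forall t, a <= t <= b -> {for t, continuous (g : R -> C)}.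

Definition cint a b g : R[i] := rint a b (Re \o g) +i* rint a b (Im \o g).

Lemma ccont_Re a b g : ccont a b g -> rcont a b (Re \o g).
Proof. by move=> h t /h/continuous_path[]. Qed.

Lemma ccont_Im a b g : ccont a b g -> rcont a b (Im \o g).
Proof. by move=> h t /h/continuous_path[]. Qed.

Lemma ccont_cst a b (k : R[i]) : ccont a b (fun=> k).
Proof. by move=> t _; exact: cvg_cst. Qed.

Lemma ccontD a b f g : ccont a b f -> ccont a b g -> ccont a b (fun t => f t + g t).
Proof. by move=> hf hg t ht; apply: cvgD; [exact: hf|exact: hg]. Qed.

Lemma ccontM a b f g : ccont a b f -> ccont a b g -> ccont a b (fun t => f t * g t).
Proof. by move=> hf hg t ht; apply: cvgM; [exact: hf|exact: hg]. Qed.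

Lemma ccontB a b f g : ccont a b f -> ccont a b g -> ccont a b (fun t => f t - g t).
Proof. by move=> hf hg t ht; apply: cvgB; [exact: hf|exact: hg]. Qed.

Lemma ccontV a b f : (forall t, a <= t <= b -> f t != 0) -> ccont a b f ->
  ccont a b (fun t => (f t)^-1).
Proof. by move=> f0 hf t ht; apply: cvgV; [exact: f0|exact: hf]. Qed.

Lemma ccontX a b f n : ccont a b f -> ccont a b (fun t => f t ^+ n).
Proof.
move=> hf; elim: n => [|n IH]; first exact: (@ccont_cst a b 1).
have -> : (fun t => f t ^+ n.+1) = (fun t => f t * f t ^+ n).
  by apply/funext => t; rewrite exprS.
exact: (ccontM hf IH).
Qed.

Lemma ccont_real a b (f : R -> R) : rcont a b f -> ccont a b (fun t => (f t)%:C).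
Proof.
move=> h t /h ht; apply/continuous_path; split => //=.
by apply: cvg_cst.
Qed.

Lemma eq_cint a b f g : (forall t, a <= t <= b -> f t = g t) -> cint a b f = cint a b g.
Proof. by move=> h; congr (_ +i* _); apply: eq_rint => t /h /= ->. Qed.

Lemma cintD a b f g : ccont a b f -> ccont a b g ->
  cint a b (fun t => f t + g t) = cint a b f + cint a b g.
Proof.
move=> hf hg; rewrite /cint -[RHS]/(_ +i* _); congr (_ +i* _).
  by rewrite -rintD; [apply: eq_rint => t _ /=; rewrite raddfD|exact: ccont_Re..].
by rewrite -rintD; [apply: eq_rint => t _ /=; rewrite raddfD|exact: ccont_Im..].
Qed.

Lemma cintZ a b (k : R[i]) g : ccont a b g ->
  cint a b (fun t => k * g t) = k * cint a b g.
Proof.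
move=> hg; have hr := ccont_Re hg; have hi := ccont_Im hg.
rewrite /cint; case: k => x y; rewrite -[RHS]/(_ +i* _); congr (_ +i* _).
  rewrite -mulNr -!rintZ// -rintD; [|exact: rcontZ..].
  by apply: eq_rint => t _ /=; case: (g t) => u v /=; rewrite mulNr.
rewrite -!rintZ// -rintD; [|exact: rcontZ..].
by apply: eq_rint => t _ /=; case: (g t).
Qed.

Lemma cintB a b f g : ccont a b f -> ccont a b g ->
  cint a b (fun t => f t - g t) = cint a b f - cint a b g.
Proof.
move=> hf hg; have hg' : ccont a b (fun t => -1 * g t).
  exact: (ccontM (@ccont_cst a b (-1)) hg).
transitivity (cint a b (fun t => f t + -1 * g t)).
  by apply: eq_cint => t _; rewrite mulN1r.
by rewrite cintD// cintZ// mulN1r.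
Qed.

Lemma cint_cst a b (k : R[i]) : a <= b -> cint a b (fun=> k) = k * (b - a)%:C.
Proof.
move=> ab; rewrite /cint !rint_cst//; case: k => x y /=.
by simpc.
Qed.

Lemma cint_split a b c g : a <= c <= b -> ccont a b g ->
  cint a b g = cint a c g + cint c b g.
Proof.
move=> acb hg; rewrite /cint (rint_split acb (ccont_Re hg)) (rint_split acb (ccont_Im hg)).
by [].
Qed.

(* The factor 2 spares the rotation argument. *)
Lemma cint_bound a b (M : R) g : a <= b -> ccont a b g ->
  (forall t, a <= t <= b -> modulus (g t) <= M) ->
  modulus (cint a b g) <= 2 * M * (b - a).
Proof.
move=> ab hg hM; apply: (le_trans (modulus_le_ReIm _)) => /=.
have -> : 2 * M * (b - a) = M * (b - a) + M * (b - a) by ring.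
rewrite -rint_cst//; apply: lerD.
- have h := ccont_Re hg; apply: (le_trans (rint_abs h)).
  apply: rint_le; [exact: rcont_norm|exact: rcont_cst|].
  by move=> t /hM; apply: le_trans; exact: Re_le_modulus.
- have h := ccont_Im hg; apply: (le_trans (rint_abs h)).
  apply: rint_le; [exact: rcont_norm|exact: rcont_cst|].
  by move=> t /hM; apply: le_trans; exact: Im_le_modulus.
Qed.

Lemma cintJ a b g : ccont a b g ->
  cint a b (fun t => (g t)^*) = (cint a b g)^*.
Proof.
move=> hg; rewrite /cint -[RHS]/(_ +i* _); congr (_ +i* _).
  by apply: eq_rint => t _ /=; case: (g t).
rewrite -[RHS]mulN1r; transitivity (rint a b (fun t => -1 * Im (g t))).
  by apply: eq_rint => t _ /=; rewrite mulN1r; case: (g t).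
by rewrite rintZ//; exact: ccont_Im.
Qed.

(** The variable is real while the values lie in a module over [R[i]], hence the derivative is taken
    by components. *)
Definition path_derive p (t : R) (d : R[i]) :=
  is_derive t 1 (Re \o p) (Re d) /\ is_derive t 1 (Im \o p) (Im d).

Lemma cint_FTC a b p g : a <= b -> ccont a b g ->
  (forall t, a <= t <= b -> path_derive p t (g t)) -> cint a b g = p b - p a.
Proof.
move=> ab hg dp; rewrite /cint.
have -> : rint a b (Re \o g) = (Re \o p) b - (Re \o p) a.
  by apply: rint_FTC => //; [exact: ccont_Re|move=> t /dp[]].
have -> : rint a b (Im \o g) = (Im \o p) b - (Im \o p) a.
  by apply: rint_FTC => //; [exact: ccont_Im|move=> t /dp[]].
by rewrite /=; case: (p b) => ? ?; case: (p a).
Qed.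

(** The same remainder form as in [is_deriveC], so that a path can be composed with a holomorphic
    function. *)
Lemma path_deriveP p t d : path_derive p t d <->
  forall e : R, 0 < e -> exists2 del : R, 0 < del & forall h, `|h| < del ->
    modulus (p (h + t) - p t - d * h%:C) <= e * `|h|.
Proof.
have key (f : R -> R) (k : R) : is_derive t 1 f k <->
    forall e : R, 0 < e -> exists2 del : R, 0 < del & forall h, `|h| < del ->
      `|f (h + t) - f t - k * h| <= e * `|h|.
  split=> [[dg <-] e e0|H].
    have /cvgrPdist_le/(_ e e0)[del /= del0 H] := dg; exists del => // h hd.
    have [->|h0] := eqVneq h 0; first by rewrite add0r subrr mulr0 subr0 normr0 mulr0.
    have {H} : `|'D_1 f t - h^-1 * (f (h + t) - f t)| <= e.
      have := H h; rewrite /= sub0r normrN => /(_ hd h0).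
      by rewrite [_%:A]mulr1.
    have -> : f (h + t) - f t - 'D_1 f t * h = - h * ('D_1 f t - h^-1 * (f (h + t) - f t)).
      by field.
    by move=> H; rewrite normrM normrN mulrC ler_wpM2r.
  suff cv : (h^-1 *: (f (h *: (1 : R) + t) - f t) @[h --> 0^'] --> k).
    by split; [apply/cvg_ex; exists k|exact: cvg_lim cv].
  apply/cvgrPdist_le => e e0.
  have [del del0 hd] := H _ e0.
  exists del => //= h; rewrite /= sub0r normrN => /hd hk h0.
  have -> : k - h^-1 *: (f (h *: (1 : R) + t) - f t) = - h^-1 * (f (h + t) - f t - k * h).
    have E (u v : R) : u - h^-1 * v = - h^-1 * (v - u * h) by field.
    by rewrite [_%:A]mulr1; exact: E.
  by rewrite normrM normrN normfV mulrC ler_pdivrMr ?normr_gt0.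
split=> [[/key h1 /key h2] e e0|H].
  have [|d1 d10 H1] := h1 (e / 2); first by rewrite divr_gt0.
  have [|d2 d20 H2] := h2 (e / 2); first by rewrite divr_gt0.
  exists (Num.min d1 d2); first by rewrite lt_min d10.
  move=> h; rewrite lt_min => /andP[/H1 a1 /H2 a2].
  apply: (le_trans (modulus_le_ReIm _)).
  rewrite [e]splitr mulrDl lerD//.
    by move: a1 => /=; case: (p (h + t)) => ? ?; case: (p t) => ? ?; case: (d) => ? ? /=; rewrite mulr0 subr0.
  by move: a2 => /=; case: (p (h + t)) => ? ?; case: (p t) => ? ?; case: (d) => ? ? /=; rewrite mulr0 add0r.
split; apply/key => e /H[del del0 hd]; exists del => // h /hd; apply: le_trans.
  apply: le_trans (Re_le_modulus _).
  by rewrite !raddfB/= [d * _]mulrC Re_real_mul mulrC.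
apply: le_trans (Im_le_modulus _).
by rewrite !raddfB/= [d * _]mulrC Im_real_mul mulrC.
Qed.

End ComplexIntegral.

Lemma dist_itv {R : realType} (a b x y : R) : a <= x <= b -> a <= y <= b -> `|x - y| <= b - a.
Proof. by move=> /andP[? ?] /andP[? ?]; rewrite ler_norml; apply/andP; split; lra. Qed.

Section Circle.
Context {R : realType}.
Local Notation C := (R[i]^o).

Definition circ (r t : R) : R[i] := (r * cos t) +i* (r * sin t).

Lemma circE r t : circ r t = r%:C * circ 1 t.
Proof. by rewrite /circ; simpc; rewrite ?mul1r. Qed.

Lemma modulus_circ r t : 0 <= r -> modulus (circ r t) = r.
Proof.
move=> r0; rewrite /modulus/= !exprMn -mulrDr cos2Dsin2 mulr1 sqrtr_sqr.
by rewrite ger0_norm.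
Qed.

Lemma circ_neq0 r t : 0 < r -> circ r t != 0.
Proof. by move=> r0; rewrite -modulus_gt0 modulus_circ// ltW. Qed.

Lemma path_derive_circ r t : path_derive (circ r) t ('i * circ r t).
Proof.
split.
  have -> : Re ('i * circ r t) = r * - sin t by rewrite /circ /= mulrN; ring.
  exact: is_derive_eq.
have -> : Im ('i * circ r t) = r * cos t by rewrite /circ /=; ring.
exact: is_derive_eq.
Qed.

Lemma continuous_circ r a b : ccont a b (circ r).
Proof.
move=> t _; apply/continuous_path; split; apply: cvgM; try exact: cvg_cst.
  exact: continuous_cos.
exact: continuous_sin.
Qed.

Lemma cint_circ r a b : a <= b -> cint a b (fun t => 'i * circ r t) = circ r b - circ r a.
Proof.
move=> ab; apply: cint_FTC => //; last by move=> t _; exact: path_derive_circ.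
exact: (ccontM (@ccont_cst _ a b 'i) (@continuous_circ r a b)).
Qed.

(** The chord is the integral of the velocity, whose modulus is [r]; the 2 is that of
    [cint_bound]. *)
Lemma circ_lipschitz r t u : 0 <= r -> modulus (circ r t - circ r u) <= 2 * r * `|t - u|.
Proof.
move=> r0; wlog ut : t u / u <= t.
  by move=> h; have [/h//|/ltW/h] := leP u t; rewrite modulusC distrC.
rewrite -cint_circ// ger0_norm ?subr_ge0//; apply: cint_bound => //.
  exact: (ccontM (@ccont_cst _ u t 'i) (@continuous_circ r u t)).
by move=> x _; rewrite modulusM modulus_i mul1r modulus_circ.
Qed.

Lemma circ_2pi r : circ r (2 * pi) = circ r 0.
Proof. by rewrite /circ mulr_natl -[pi *+ 2]add0r cosD2pi sinD2pi. Qed.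

End Circle.

(** * Goursat's lemma for a circle contracted to a point of its disc *)

Section Goursat.
Context {R : realType}.
Local Notation C := (R[i]^o).
Variables (a : R[i]) (r : R).
Hypothesis ar : modulus a < r.

(** Contracts the circle to [a], which need not be its centre; so Cauchy's formula comes out at
    every point of the disc. *)
Definition homoth (s t : R) : R[i] := a + s%:C * (circ r t - a).
(* The derivative of [ln (homoth s t - a)] in [t]; its derivative in [s] is
   [s^-1]. So [contour G] below integrates [G z / (z - a)] over the boundary of
   the image of the rectangle [I x J] under [homoth]. *)
Definition kappa (t : R) : R[i] := 'i * circ r t * (circ r t - a)^-1.

Definition hedge (G : R[i] -> R[i]) t (I : R * R) :=
  cint I.1 I.2 (fun s => G (homoth s t) * (s%:C)^-1).
Definition vedge (G : R[i] -> R[i]) s (J : R * R) :=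
  cint J.1 J.2 (fun t => G (homoth s t) * kappa t).
Definition contour (G : R[i] -> R[i]) (I J : R * R) :=
  hedge G J.1 I + vedge G I.2 J - hedge G J.2 I - vedge G I.1 J.

Definition dcont (G : R[i] -> R[i]) :=
  forall z, modulus z <= r -> {for (z : C), continuous (G : C -> C)}.

Let r0 : 0 < r. Proof. exact: le_lt_trans (modulus_ge0 _) ar. Qed.

Lemma homoth_le s t : 0 <= s <= 1 -> modulus (homoth s t) <= r.
Proof.
move=> /andP[s0 s1]; have -> : homoth s t = (1 - s)%:C * a + s%:C * circ r t.
  by rewrite /homoth rmorphB rmorph1; ring.
apply: (le_trans (modulusD _ _)); rewrite !modulusM !modulus_real modulus_circ; last exact: ltW.
rewrite !ger0_norm ?subr_ge0//; have := ltW ar; nra.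
Qed.

Lemma circ_sub_ge t : r - modulus a <= modulus (circ r t - a).
Proof. by rewrite -{1}(modulus_circ t (ltW r0)) modulus_sub_le. Qed.

Lemma circ_sub_neq0 t : circ r t - a != 0.
Proof. by rewrite -modulus_gt0; apply: lt_le_trans (circ_sub_ge t); rewrite subr_gt0. Qed.

Lemma modulus_kappa t : modulus (kappa t) <= r / (r - modulus a).
Proof.
rewrite /kappa !modulusM modulus_i mul1r modulus_circ ?(ltW r0)// modulusV.
rewrite ler_wpM2l ?(ltW r0)// lef_pV2 ?posrE ?subr_gt0// ?circ_sub_ge//.
by rewrite modulus_gt0 circ_sub_neq0.
Qed.

Lemma continuous_kappa c d : ccont c d kappa.
Proof.
apply: (ccontM (ccontM (@ccont_cst _ c d 'i) (@continuous_circ _ r c d))).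
apply: ccontV => [t _|]; first exact: circ_sub_neq0.
exact: (ccontD (@continuous_circ _ r c d) (@ccont_cst _ c d (- a))).
Qed.

Lemma continuous_homoth1 t c d : ccont c d (fun s => homoth s t).
Proof.
apply: (ccontD (@ccont_cst _ c d a)).
apply: (ccontM _ (@ccont_cst _ c d (circ r t - a))).
by apply: ccont_real => s _; exact: cvg_id.
Qed.

Lemma continuous_homoth2 s c d : ccont c d (homoth s).
Proof.
apply: (ccontD (@ccont_cst _ c d a)).
apply: (ccontM (@ccont_cst _ c d (s%:C))).
exact: (ccontD (@continuous_circ _ r c d) (@ccont_cst _ c d (- a))).
Qed.

Lemma ccont_dcont G p c d : dcont G -> ccont c d p ->
  (forall t, c <= t <= d -> modulus (p t) <= r) -> ccont c d (G \o p).
Proof.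
move=> hG hp pr t ht.
have h1 : {for t, continuous (p : R -> C)} by exact: hp.
have h2 : {for (p t : C), continuous (G : C -> C)} by apply: hG; exact: pr.
exact: (continuous_comp h1 h2).
Qed.

Lemma ccont_hedge G t c d : dcont G -> 0 < c -> d <= 1 ->
  ccont c d (fun s => G (homoth s t) * (s%:C)^-1).
Proof.
move=> hG c0 d1; apply: (@ccontM _ c d (fun s => G (homoth s t))).
  apply: (ccont_dcont hG (@continuous_homoth1 t c d)) => s /andP[cs sd].
  by apply: homoth_le; rewrite (le_trans (ltW c0) cs) (le_trans sd d1).
apply: ccontV; last by apply: ccont_real => s _; exact: cvg_id.
by move=> s /andP[cs _]; rewrite -modulus_gt0 modulus_real normr_gt0 gt_eqF// (lt_le_trans c0).
Qed.

Lemma ccont_vedge G s c d : dcont G -> 0 <= s <= 1 ->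
  ccont c d (fun t => G (homoth s t) * kappa t).
Proof.
move=> hG s01; apply: (@ccontM _ c d (fun t => G (homoth s t)) kappa).
  by apply: (ccont_dcont hG (@continuous_homoth2 s c d)) => t _; exact: homoth_le.
exact: continuous_kappa.
Qed.

(** Each inner edge is traversed twice, in opposite directions. *)
Lemma contour_split G I J : dcont G -> 0 < I.1 -> I.1 < I.2 -> I.2 <= 1 -> J.1 < J.2 ->
  contour G I J = contour G (half true I) (half true J) + contour G (half true I) (half false J)
   + contour G (half false I) (half true J) + contour G (half false I) (half false J).
Proof.
move=> hG I0 I12 I1 J12.
have hH t : hedge G t I = hedge G t (half true I) + hedge G t (half false I).
  by apply: cint_split; [apply/andP; split=> /=; lra|exact: ccont_hedge].
have hV s : 0 <= s <= 1 -> vedge G s J = vedge G s (half true J) + vedge G s (half false J).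
  by move=> s01; apply: cint_split; [apply/andP; split=> /=; lra|exact: ccont_vedge].
rewrite /contour /= !hH !hV; [|apply/andP; split=> /=; lra..].
have E (a1 a2 b1 b2 c1 c2 d1 d2 m1 m2 n1 n2 : R[i]) :
    a1 + a2 + (b1 + b2) - (c1 + c2) - (d1 + d2) = (a1 + m1 - n1 - d1) +
    (n1 + m2 - c1 - d2) + (a2 + b1 - n2 - m1) + (n2 + b2 - c2 - m2) by ring.
exact: E.
Qed.

Lemma contourD G1 G2 I J : dcont G1 -> dcont G2 -> 0 < I.1 -> I.1 < I.2 -> I.2 <= 1 ->
  contour (fun z => G1 z + G2 z) I J = contour G1 I J + contour G2 I J.
Proof.
move=> h1 h2 I0 I12 I1.
have hH t : hedge (fun z => G1 z + G2 z) t I = hedge G1 t I + hedge G2 t I.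
  rewrite /hedge -cintD; [|exact: ccont_hedge..].
  by apply: eq_cint => s _; rewrite mulrDl.
have hV s : 0 <= s <= 1 -> vedge (fun z => G1 z + G2 z) s J = vedge G1 s J + vedge G2 s J.
  move=> s01; rewrite /vedge -cintD; [|exact: ccont_vedge..].
  by apply: eq_cint => t _; rewrite mulrDl.
rewrite /contour !hH !hV; [|apply/andP; split=> /=; lra..].
by ring.
Qed.

Lemma contour_cst c I J : 0 < I.1 -> I.1 < I.2 -> contour (fun=> c) I J = 0.
Proof. by move=> I0 I12; rewrite /contour /hedge /vedge; ring. Qed.

(** The factor [z - a] cancels the pole of the kernel, so all four edges are explicit integrals. *)
Lemma contour_lin d I J : 0 < I.1 -> I.1 < I.2 -> J.1 < J.2 ->
  contour (fun z => d * (z - a)) I J = 0.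
Proof.
move=> I0 I12 J12.
have hH t : hedge (fun z => d * (z - a)) t I = d * (circ r t - a) * (I.2 - I.1)%:C.
  rewrite /hedge -cint_cst; last exact: ltW.
  apply: eq_cint => s /andP[Is _].
  have s0 : s%:C != 0 :> R[i].
    by rewrite -modulus_gt0 modulus_real normr_gt0 gt_eqF// (lt_le_trans I0).
  by rewrite /homoth; field.
have hV s : vedge (fun z => d * (z - a)) s J = d * s%:C * (circ r J.2 - circ r J.1).
  rewrite /vedge -cint_circ; last exact: ltW.
  rewrite -cintZ; last exact: (ccontM (@ccont_cst _ _ _ 'i) (@continuous_circ _ r _ _)).
  apply: eq_cint => t _; have := circ_sub_neq0 t; rewrite /homoth /kappa => nz.
  by field.
by rewrite /contour !hH !hV rmorphB; ring.
Qed.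

(** [I.1^-1] and [ka] bound the two components of the kernel; the 4 is the 2 of [cint_bound] times
    the two edges of each direction. *)
Lemma contour_bound G (M ka : R) I J : dcont G -> 0 < I.1 -> I.1 < I.2 -> I.2 <= 1 -> J.1 < J.2 ->
  ka = r / (r - modulus a) ->
  (forall s t, I.1 <= s <= I.2 -> J.1 <= t <= J.2 -> modulus (G (homoth s t)) <= M) ->
  modulus (contour G I J) <= 4 * M * (I.1^-1 * (I.2 - I.1) + ka * (J.2 - J.1)).
Proof.
move=> hG I0 I12 I1 J12 kaE hM.
have M0 : 0 <= M.
  by apply: le_trans (hM I.1 J.1 _ _); rewrite ?modulus_ge0 ?lexx ?ltW.
have hH t : J.1 <= t <= J.2 -> modulus (hedge G t I) <= 2 * (M / I.1) * (I.2 - I.1).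
  move=> ht; apply: cint_bound; [exact: ltW|exact: ccont_hedge|move=> s /andP[s1 s2]].
  rewrite modulusM modulusV modulus_real; have s0 : 0 < s by exact: lt_le_trans s1.
  rewrite ger0_norm ?(ltW s0)//; apply: ler_pM; rewrite ?modulus_ge0 ?invr_ge0 ?(ltW s0)//.
    by apply: hM => //; rewrite s1.
  by rewrite lef_pV2 ?posrE.
have hV s : I.1 <= s <= I.2 -> modulus (vedge G s J) <= 2 * (M * ka) * (J.2 - J.1).
  move=> /andP[s1 s2]; apply: cint_bound; first exact: ltW.
    by apply: ccont_vedge => //; rewrite (le_trans (ltW I0) s1) (le_trans s2 I1).
  move=> t ht; rewrite modulusM kaE; apply: ler_pM; rewrite ?modulus_ge0 ?modulus_kappa//.
  by apply: hM => //; rewrite s1.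
rewrite /contour.
have h1 := hH J.1 ltac:(by rewrite lexx ltW).
have h2 := hH J.2 ltac:(by rewrite lexx ltW).
have h3 := hV I.1 ltac:(by rewrite lexx ltW).
have h4 := hV I.2 ltac:(by rewrite lexx ltW).
apply: (le_trans (modulusB _ _)); apply: (le_trans (lerD (modulusB _ _) (lexx _))).
apply: (le_trans (lerD (lerD (modulusD _ _) (lexx _)) (lexx _))).
apply: (le_trans (lerD (lerD (lerD h1 h4) h2) h3)).
by rewrite le_eqVlt; apply/orP; left; apply/eqP; ring.
Qed.

Lemma homoth_dist s t s' t' : 0 <= s <= 1 -> 0 <= s' <= 1 ->
  modulus (homoth s t - homoth s' t') <= 2 * r * (`|s - s'| + `|t - t'|).
Proof.
move=> /andP[s0 s1] _.
have -> : homoth s t - homoth s' t' =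
    s%:C * (circ r t - circ r t') + (s - s')%:C * (circ r t' - a).
  by rewrite /homoth rmorphB; ring.
apply: (le_trans (modulusD _ _)); rewrite !modulusM !modulus_real (ger0_norm s0) mulrDr [leRHS]addrC.
apply: lerD.
  apply: le_trans (circ_lipschitz t t' (ltW r0)).
  by rewrite ler_piMl ?modulus_ge0.
rewrite mulrC ler_wpM2r//; apply: (le_trans (modulusB _ _)).
by rewrite modulus_circ ?(ltW r0)// mulrDl mul1r lerD2l ltW.
Qed.

(** Goursat's argument: [cousin] propagates the bound [e / A] times the area, which is additive over
    quarters. Near a point the affine part of [g] contributes 0. The remainder is a small multiple
    of the diameter, so it contributes a small multiple of diameter times perimeter, and this is
    comparable to the area because the rectangles are similar. The kernel [s^-1] stays bounded since
    [s >= s0]. *)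
Lemma contour_eq0 g (s0 : R) : (forall z, modulus z <= r -> derivable (g : C -> C) z 1) ->
  0 < s0 < 1 -> contour g (s0, 1) (0, 2 * pi) = 0.
Proof.
move=> dg /andP[s00 s01].
have p0 : 0 < 2 * pi :> R by rewrite mulr_gt0 ?pi_gt0.
have hg : dcont g by move=> z /dg; exact: derivable_continuousC.
apply/eqP; rewrite -modulus_eq0 eq_le modulus_ge0 andbT.
apply/ler_addgt0Pl => e e0; rewrite addr0.
pose A := (1 - s0) * (2 * pi).
have A0 : 0 < A by rewrite mulr_gt0// subr_gt0.
pose P (I J : R * R) := s0 <= I.1 -> I.2 <= 1 ->
  modulus (contour g I J) <= e / A * ((I.2 - I.1) * (J.2 - J.1)).
suff : P (s0, 1) (0, 2 * pi).
  by move=> /(_ (lexx _) (lexx _)) /=; rewrite subr0 divfK ?gt_eqF.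
pose ka := r / (r - modulus a).
have ka0 : 0 < ka by rewrite divr_gt0 ?subr_gt0.
(* Chosen so that the local estimate becomes exactly [e / A * (w * h)]: similarity gives
   [w + h = w * (1 - s0 + 2 * pi) / (1 - s0)], and [4 * (2 * r) * (s0^-1 + ka)] collects the factors
   of [contour_bound] and [homoth_dist]. *)
pose K := 4 * (2 * r) * (s0^-1 + ka) * ((1 - s0 + 2 * pi) ^+ 2).
have K0 : 0 < K.
  have h1 : 0 < s0^-1 + ka by rewrite addr_gt0 ?invr_gt0.
  have h2 : 0 < (1 - s0 + 2 * pi) ^+ 2 by rewrite exprn_gt0// addr_gt0 ?subr_gt0.
  by rewrite /K mulr_gt0// mulr_gt0// !mulr_gt0.
apply: cousin => //.
- move=> I J I12 J12 h I0 I1; rewrite contour_split//; last exact: lt_le_trans I0.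
  have H b c : modulus (contour g (half b I) (half c J)) <=
      e / A * (((half b I).2 - (half b I).1) * ((half c J).2 - (half c J).1)).
    have [h1 h2] := half_sub b I12.
    by apply: h; [exact: le_trans h1|exact: le_trans h2 _].
  apply: le_trans (modulusD _ _) _; apply: le_trans (lerD (modulusD _ _) (lexx _)) _.
  apply: le_trans (lerD (lerD (modulusD _ _) (lexx _)) (lexx _)) _.
  apply: le_trans (lerD (lerD (lerD (H _ _) (H _ _)) (H _ _)) (H _ _)) _.
  clear; rewrite -!mulrDr le_eqVlt; apply/orP; left; apply/eqP; congr (_ * _).
  by rewrite /half /=; field.
- move=> s t /= hs ht; set z0 := homoth s t.
  have hs01 : 0 <= s <= 1 by move/andP: hs => [? ?]; apply/andP; split; lra.
  have z0r : modulus z0 <= r by exact: homoth_le.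
  have /derivableC[d /is_deriveC dgz] := dg z0 z0r.
  pose e1 := e / K.
  have e10 : 0 < e1 by rewrite divr_gt0.
  have [del del0 hdel] := dgz e1 e10.
  exists (del / (4 * r)); first by rewrite divr_gt0// mulr_gt0.
  move=> I J I12 J12 I0 I1 J0 J1 sI tJ wI wJ asp _ _.
  have I00 : 0 < I.1 by exact: lt_le_trans I0.
  pose L z := (g z0 - d * (z0 - a)) + d * (z - a).
  pose E z := g z - L z.
  have hL1 : dcont (fun=> g z0 - d * (z0 - a)).
    by move=> z _; apply: derivable_continuousC; exact: derivable_cst.
  have hL2 : dcont (fun z => d * (z - a)).
    move=> z _; apply: derivable_continuousC.
    apply: derivableM; first exact: derivable_cst.
    by apply: derivableB; [exact: derivable_id|exact: derivable_cst].
  have hE' : forall z, modulus z <= r -> derivable (E : C -> C) z 1.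
    move=> z zr; apply: derivableB; first exact: dg.
    apply: derivableD; first exact: derivable_cst.
    apply: derivableM; first exact: derivable_cst.
    by apply: derivableB; [exact: derivable_id|exact: derivable_cst].
  have hE : dcont E by move=> z zr; apply: derivable_continuousC; exact: hE'.
  have hL : dcont L.
    move=> z zr; apply: derivable_continuousC.
    apply: derivableD; first exact: derivable_cst.
    apply: derivableM; first exact: derivable_cst.
    by apply: derivableB; [exact: derivable_id|exact: derivable_cst].
  have -> : contour g I J = contour E I J.
    have e1' : contour g I J = contour (fun z => E z + L z) I J.
      by congr (contour _ I J); apply/funext => z; rewrite /E subrK.
    have e2 : contour L I J = 0.
      have := @contourD (fun=> g z0 - d * (z0 - a)) (fun z => d * (z - a)) I J hL1 hL2 I00 I12 I1.
      by rewrite contour_cst// contour_lin// addr0.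
    by rewrite e1' (@contourD E L I J hE hL I00 I12 I1) e2 addr0.
  pose w := I.2 - I.1; pose h := J.2 - J.1.
  have w0 : 0 < w by rewrite subr_gt0.
  have h0 : 0 < h by rewrite subr_gt0.
  have Ebound s' t' : I.1 <= s' <= I.2 -> J.1 <= t' <= J.2 ->
      modulus (E (homoth s' t')) <= e1 * (2 * r * (w + h)).
    move=> /andP[s1 s2] /andP[t1 t2].
    have s'01 : 0 <= s' <= 1 by rewrite (le_trans (le_trans (ltW s00) I0) s1) (le_trans s2 I1).
    have dist : modulus (homoth s' t' - z0) <= 2 * r * (w + h).
      apply: (le_trans (homoth_dist _ _ s'01 hs01)); rewrite ler_wpM2l ?mulr_ge0 ?(ltW r0)//.
      by apply: lerD; apply: dist_itv => //; [rewrite s1|rewrite t1].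
    have -> : E (homoth s' t') = g (homoth s' t') - g z0 - d * (homoth s' t' - z0).
      by rewrite /E /L; ring.
    apply: (le_trans (hdel _ _)); last by rewrite ler_wpM2l// ltW.
    apply: (le_lt_trans dist); rewrite -ltr_pdivlMl ?mulr_gt0//.
    have -> : (2 * r)^-1 * del = del / (4 * r) + del / (4 * r).
      by field; rewrite gt_eqF.
    by apply: ltrD.
  apply: (le_trans (contour_bound hE I00 I12 I1 J12 (erefl ka) Ebound)).
  rewrite -/w -/h.
  have hw : h = w * (2 * pi) / (1 - s0).
    have -> : w * (2 * pi) = h * (1 - s0) by move: asp; rewrite /= subr0.
    by rewrite mulfK ?gt_eqF ?subr_gt0.
  have step : I.1^-1 * w + ka * h <= (s0^-1 + ka) * (w + h).
    have : I.1^-1 * w <= s0^-1 * w by rewrite ler_wpM2r ?(ltW w0)// lef_pV2 ?posrE.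
    have : 0 <= s0^-1 * h by rewrite mulr_ge0 ?invr_ge0 ?ltW.
    have : 0 <= ka * w by rewrite mulr_ge0 ?ltW.
    by nra.
  apply: (le_trans (ler_wpM2l _ step)).
    apply: mulr_ge0 => //; apply: mulr_ge0; first exact: ltW.
    by apply: mulr_ge0; [apply: mulr_ge0 => //; exact: ltW|apply: addr_ge0; exact: ltW].
  rewrite le_eqVlt; apply/orP; left; apply/eqP; rewrite /e1 /K /A hw.
  have n1 : 1 - s0 != 0 by rewrite gt_eqF ?subr_gt0.
  have n2 : s0^-1 + ka != 0 by rewrite gt_eqF// addr_gt0 ?invr_gt0.
  have n3 : 1 - s0 + 2 * pi != 0 by rewrite gt_eqF// addr_gt0 ?subr_gt0.
  have n4 : r != 0 by rewrite (gt_eqF r0).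
  have n5 : pi != 0 :> R by rewrite gt_eqF ?pi_gt0.
  move: n1 n2 n3 n4 n5; clear; move: (s0^-1 + ka) => k n1 n2 n3 n4 n5.
  have -> : w + w * (2 * pi) / (1 - s0) = w * (1 - s0 + 2 * pi) / (1 - s0) by field.
  move: n1 n3; move: (1 - s0 + 2 * pi); move: (1 - s0) => v u n1 n3.
  by move: pi n5 u n3 => p n5 u n3; field; rewrite n1 n3 n4 n5 n2.
Qed.

End Goursat.

(** * The Cauchy and Poisson formulas *)

Section Cauchy.
Context {R : realType}.
Local Notation C := (R[i]^o).
Implicit Types (g h : R[i] -> R[i]).

Definition holo (r : R) g := forall z, modulus z <= r -> derivable (g : C -> C) z 1.

Lemma holoS r r' g : r' <= r -> holo r g -> holo r' g.
Proof. by move=> rr h z zr; apply: h; exact: le_trans rr. Qed.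

Lemma holo_circ r g c d : 0 <= r -> holo r g -> ccont c d (fun t => g (circ r t)).
Proof.
move=> r0 hg t ht; apply: (@continuous_comp_path _ g (circ r)).
  exact: (@continuous_circ _ r c d t ht).
by apply: hg; rewrite modulus_circ.
Qed.

Lemma pi2_gt0 : 0 < 2 * pi :> R. Proof. by rewrite mulr_gt0 ?pi_gt0. Qed.

(** By periodicity the edges [t = 0] and [t = 2 * pi] cancel, so the integral over the circle equals
    the one over its contraction by any [s > 0]. As [s] tends to 0, continuity at [a] replaces [g]
    by [g a]. *)
Lemma holo_homothety g (a : R[i]) r : modulus a < r -> holo r g ->
  cint 0 (2 * pi) (fun t => g (circ r t) * kappa a r t) = g a * cint 0 (2 * pi) (kappa a r).
Proof.
move=> ar hg; have r0 : 0 < r by exact: le_lt_trans (modulus_ge0 _) ar.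
have p0 := pi2_gt0.
have dg : dcont r g by move=> z /hg; exact: derivable_continuousC.
have step s : 0 < s < 1 -> vedge a r g 1 (0, 2 * pi) = vedge a r g s (0, 2 * pi).
  move=> s01; have := contour_eq0 ar hg s01; rewrite /contour /=.
  have -> : hedge a r g (2 * pi) (s, 1) = hedge a r g 0 (s, 1).
    by apply: eq_cint => x _; rewrite /homoth circ_2pi.
  have E (x y z : R[i]) : x + y - x - z = y - z by ring.
  by rewrite E => /eqP; rewrite subr_eq0 => /eqP.
apply/eqP; rewrite -subr_eq0 -modulus_eq0 eq_le modulus_ge0 andbT.
apply/ler_addgt0Pl => e e0; rewrite addr0.
have -> : cint 0 (2 * pi) (fun t => g (circ r t) * kappa a r t) = vedge a r g 1 (0, 2 * pi).
  by apply: eq_cint => t _; rewrite /homoth rmorph1 mul1r addrC subrK.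
pose ka := r / (r - modulus a).
have ka0 : 0 < ka by rewrite divr_gt0 ?subr_gt0.
pose e1 := e / (2 * ka * (2 * pi)).
have e10 : 0 < e1 by rewrite divr_gt0// mulr_gt0// mulr_gt0.
have [del del0 hdel] := (continuousC g a).1 (dg a (ltW ar)) e1 e10.
have [s s01 hs] : exists2 s, 0 < s < 1 & s * (2 * r) < del.
  pose m := Num.min 1 (del / (2 * r)).
  have m0 : 0 < m by rewrite lt_min ltr01 divr_gt0// mulr_gt0.
  exists (m / 2); first rewrite divr_gt0//= ltr_pdivrMr//.
    have : m <= 1 by rewrite ge_min lexx.
    by lra.
  have : m <= del / (2 * r) by rewrite ge_min lexx orbT.
  rewrite ler_pdivlMr ?mulr_gt0//; have : 0 < m * (2 * r) by rewrite !mulr_gt0.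
  by rewrite [m / 2 * _]mulrAC; move: (m * (2 * r)) => x; lra.
have s01' : 0 <= s <= 1 by move/andP: s01 => [? ?]; rewrite !ltW.
rewrite (step s s01) /vedge /= -cintZ; last exact: (@continuous_kappa _ a r ar).
rewrite -cintB; last 2 first.
- exact: (ccont_vedge ar dg s01').
- exact: (ccontM (@ccont_cst _ _ _ (g a)) (@continuous_kappa _ a r ar _ _)).
have -> : e = 2 * (e1 * ka) * (2 * pi - 0).
  have E (x k p : R) : k != 0 -> p != 0 -> x = 2 * (x / (2 * k * (2 * p)) * k) * (2 * p).
    by move=> k0 p0'; field; rewrite k0 p0'.
  by rewrite subr0; apply: E; rewrite gt_eqF// pi_gt0.
apply: cint_bound; first exact: ltW.
  apply: (ccontB (ccont_vedge ar dg s01')).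
  exact: (ccontM (@ccont_cst _ 0 (2 * pi) (g a)) (@continuous_kappa _ a r ar 0 (2 * pi))).
move=> t _; rewrite -mulrBl modulusM; apply: ler_pM; rewrite ?modulus_ge0 ?modulus_kappa//.
apply: ltW; apply: hdel; rewrite /homoth addrC addKr modulusM modulus_real.
rewrite ger0_norm; last by case/andP: s01'.
apply: le_lt_trans hs; rewrite ler_wpM2l; [by []|by case/andP: s01'|].
by apply: (le_trans (modulusB _ _)); rewrite modulus_circ ?(ltW r0)// mulrDl mul1r lerD2l ltW.
Qed.

Lemma cint_kappa0 (r : R) : 0 < r -> cint 0 (2 * pi) (kappa (0 : R[i]) r) = 'i * (2 * pi)%:C.
Proof.
move=> r0; rewrite -[X in _ * X%:C]subr0 -cint_cst ?(ltW pi2_gt0)//.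
by apply: eq_cint => t _; rewrite /kappa subr0 mulfK// circ_neq0.
Qed.

Lemma mean_value g r : 0 < r -> holo r g ->
  cint 0 (2 * pi) (fun t => g (circ r t)) = g 0 * (2 * pi)%:C.
Proof.
move=> r0 hg; have i0 : 'i != 0 :> R[i] by rewrite -modulus_eq0 modulus_i oner_eq0.
apply: (mulfI i0); rewrite -cintZ; last exact: holo_circ (ltW r0) hg.
have m0 : modulus (0 : R[i]) < r by rewrite modulus0.
rewrite mulrCA -(cint_kappa0 r0) -(holo_homothety m0 hg).
by apply: eq_cint => t _; rewrite /kappa subr0 mulfK ?circ_neq0// mulrC.
Qed.

Lemma ccont_cauchy_kernel (a : R[i]) r c d : modulus a < r -> ccont c d (fun t => (circ r t - a)^-1).
Proof.
move=> ar; apply: ccontV => [t _|]; first exact: circ_sub_neq0.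
exact: (ccontD (@continuous_circ _ r c d) (@ccont_cst _ c d (- a))).
Qed.

(** On the circle [conj z = r^2 / z], so the conjugate of the Cauchy kernel is the boundary value of
    a rational function of [z]. *)
Lemma conj_circ_sub (a : R[i]) r t : 0 < r ->
  ((circ r t - a)^-1)^* = circ r t / ((r ^+ 2)%:C - a^* * circ r t).
Proof.
move=> r0; have z0 := circ_neq0 t r0.
have E : (r ^+ 2)%:C = circ r t * (circ r t)^*.
  by rewrite -sqr_normc normE modulus_circ ?(ltW r0)// rmorphXn.
rewrite conjc_inv rmorphB E.
have -> : circ r t * (circ r t)^* - a^* * circ r t = circ r t * ((circ r t)^* - a^*) by ring.
by rewrite invfM mulrA divff// mul1r.
Qed.

(** The denominator vanishes only at [r^2 / conj a], the reflection of [a] in the circle, which lies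
    outside the closed disc. *)
Lemma holo_reflected (a : R[i]) r : modulus a < r ->
  holo r (fun z => ((r ^+ 2)%:C - a^* * z)^-1).
Proof.
move=> ar z zr; have r0 : 0 < r by exact: le_lt_trans (modulus_ge0 _) ar.
apply: (@derivableV _ _ (fun z : C => (r ^+ 2)%:C - a^* * z)).
  rewrite -modulus_gt0; apply: lt_le_trans (modulus_sub_le _ _).
  rewrite modulus_real modulusM modulusJ ger0_norm ?sqr_ge0// subr_gt0 expr2.
  by apply: (@le_lt_trans _ _ (modulus a * r)); rewrite ?ler_wpM2l ?modulus_ge0// ltr_pM2r.
apply: derivableB; first exact: derivable_cst.
by apply: derivableM; [exact: derivable_cst|exact: derivable_id].
Qed.

(** By [conj_circ_sub] the integrand extends to a holomorphic function of the disc that vanishes at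
    0, and [mean_value] applies. *)
Lemma cint_conj_kernel g (a : R[i]) r : modulus a < r -> holo r g ->
  cint 0 (2 * pi) (fun t => g (circ r t) * (a / (circ r t - a))^*) = 0.
Proof.
move=> ar hg; have r0 : 0 < r by exact: le_lt_trans (modulus_ge0 _) ar.
pose G z := g z * (a^* * (z * ((r ^+ 2)%:C - a^* * z)^-1)).
have -> : cint 0 (2 * pi) (fun t => g (circ r t) * (a / (circ r t - a))^*) =
    cint 0 (2 * pi) (fun t => G (circ r t)).
  apply: eq_cint => t _; rewrite /G -(conj_circ_sub a t r0).
  by congr (_ * _); exact: (rmorphM (@conjc R)).
have hG : holo r G.
  move=> z zr; apply: derivableM; first exact: hg.
  apply: derivableM; first exact: derivable_cst.
  by apply: derivableM; [exact: derivable_id|exact: holo_reflected].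
by rewrite (mean_value r0 hG) /G mul0r !mulr0 mul0r.
Qed.

(** The integrand is [1 + a / (z - a)]. The conjugate of the second term has integral 0 by
    [cint_conj_kernel], so the winding number is found without a logarithm. *)
Lemma cint_kappa (a : R[i]) r : modulus a < r ->
  cint 0 (2 * pi) (fun t => circ r t / (circ r t - a)) = (2 * pi)%:C.
Proof.
move=> ar; have r0 : 0 < r by exact: le_lt_trans (modulus_ge0 _) ar.
have h := @cint_conj_kernel (fun=> 1) a r ar (fun z _ => @derivable_cst _ _ _ _ _ _).
have E t : circ r t / (circ r t - a) = 1 + a / (circ r t - a).
  by have := circ_sub_neq0 ar t => nz; field.
have cc : ccont 0 (2 * pi) (fun t => a / (circ r t - a)).
  by apply: (ccontM (@ccont_cst _ _ _ a)); exact: ccont_cauchy_kernel.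
rewrite (eq_cint (g := fun t => 1 + a / (circ r t - a))); last by move=> t _; exact: E.
rewrite (cintD (@ccont_cst _ _ _ 1) cc).
rewrite cint_cst ?(ltW pi2_gt0)// subr0 mul1r.
have -> : cint 0 (2 * pi) (fun t => a / (circ r t - a)) = 0; last by rewrite addr0.
apply: (can_inj (@conjcK R)); rewrite conjc0 -cintJ// -[RHS]h.
by apply: eq_cint => t _; rewrite mul1r.
Qed.

Lemma cauchy g (a : R[i]) r : modulus a < r -> holo r g ->
  cint 0 (2 * pi) (fun t => g (circ r t) * (circ r t / (circ r t - a))) = g a * (2 * pi)%:C.
Proof.
move=> ar hg; have r0 : 0 < r by exact: le_lt_trans (modulus_ge0 _) ar.
have i0 : 'i != 0 :> R[i] by rewrite -modulus_eq0 modulus_i oner_eq0.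
have c1 : ccont 0 (2 * pi) (fun t => circ r t / (circ r t - a)).
  by apply: (ccontM (@continuous_circ _ r _ _)); exact: ccont_cauchy_kernel.
apply: (mulfI i0); rewrite -cintZ; last exact: (ccontM (holo_circ (ltW r0) hg) c1).
rewrite mulrCA -(cint_kappa ar) -cintZ//.
have -> : cint 0 (2 * pi) (fun t => 'i * (circ r t / (circ r t - a))) = cint 0 (2 * pi) (kappa a r).
  by apply: eq_cint => t _; rewrite /kappa mulrA.
rewrite -(holo_homothety ar hg); apply: eq_cint => t _; by rewrite /kappa -complexiE; ring.
Qed.

(* Another way of writing [Re ((circ r t + a) / (circ r t - a))]. *)
Definition poisson r (a : R[i]) t : R := 1 + 2 * Re (a / (circ r t - a)).

Lemma rcont_poisson r a c d : modulus a < r -> rcont c d (poisson r a).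
Proof.
move=> ar; apply: rcontD; first exact: rcont_cst.
apply: rcontZ; apply: (@ccont_Re _ c d (fun t => a / (circ r t - a))).
by apply: (ccontM (@ccont_cst _ _ _ a)); exact: ccont_cauchy_kernel.
Qed.

Lemma poisson_dist r (a : R[i]) t : modulus a < r ->
  `|poisson r a t - 1| <= 2 * modulus a / (r - modulus a).
Proof.
move=> ar; rewrite /poisson addrC addKr normrM ger0_norm// -mulrA ler_wpM2l//.
apply: (le_trans (Re_le_modulus _)); rewrite modulusM modulusV.
rewrite ler_wpM2l ?modulus_ge0// lef_pV2 ?posrE ?subr_gt0 ?circ_sub_ge//.
by apply: lt_le_trans (circ_sub_ge ar t); rewrite subr_gt0.
Qed.

(** The Poisson kernel is the Cauchy kernel [z / (z - a)] plus the conjugate of [a / (z - a)]: the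
    first reproduces [g a] and the second integrates to 0. *)
Lemma poisson_holo g (a : R[i]) r : modulus a < r -> holo r g ->
  cint 0 (2 * pi) (fun t => g (circ r t) * (poisson r a t)%:C) = g a * (2 * pi)%:C.
Proof.
move=> ar hg; have r0 : 0 < r by exact: le_lt_trans (modulus_ge0 _) ar.
have hc := holo_circ (c := 0) (d := 2 * pi) (ltW r0) hg.
have ck : ccont 0 (2 * pi) (fun t => a / (circ r t - a)).
  by apply: (ccontM (@ccont_cst _ _ _ a)); exact: ccont_cauchy_kernel.
have c1 : ccont 0 (2 * pi) (fun t => circ r t / (circ r t - a)).
  by apply: (ccontM (@continuous_circ _ r _ _)); exact: ccont_cauchy_kernel.
have cP : ccont 0 (2 * pi) (fun t => (poisson r a t)%:C).
  by apply: ccont_real; exact: rcont_poisson.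
have E t : (poisson r a t)%:C = circ r t / (circ r t - a) + (a / (circ r t - a))^*.
  have nz := circ_sub_neq0 ar t.
  have -> : circ r t / (circ r t - a) = 1 + a / (circ r t - a) by field.
  by rewrite -addrA addcJ /poisson rmorphD rmorphM/= rmorph1 rmorph_nat.
have cj : ccont 0 (2 * pi) (fun t => (a / (circ r t - a))^*).
  have h : ccont 0 (2 * pi) (fun t => (poisson r a t)%:C + -1 * (circ r t / (circ r t - a))).
    by apply: (ccontD cP); exact: (ccontM (@ccont_cst _ _ _ (-1)) c1).
  move=> t ht; suff -> : (fun t => (a / (circ r t - a))^*) =
      (fun t => (poisson r a t)%:C + -1 * (circ r t / (circ r t - a))) by exact: h.
  by apply/funext => x; rewrite E; ring.
rewrite -(cauchy ar hg) -[RHS]addr0 -(cint_conj_kernel ar hg) -cintD.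
- by apply: eq_cint => t _; rewrite E mulrDr.
- exact: (ccontM hc c1).
- exact: (ccontM hc cj).
Qed.

End Cauchy.

(** * Analyticity *)

Section Analyticity.
Context {R : realType}.
Local Notation C := (R[i]^o).
Implicit Types (g h : R[i] -> R[i]) (a z : R[i]).

Lemma ccont_bounded (p : R -> R[i]) c d : c <= d -> ccont c d p ->
  exists2 M, 0 <= M & forall t, c <= t <= d -> modulus (p t) <= M.
Proof.
move=> cd hp; have h : rcont c d (fun t => modulus (p t)).
  by move=> t /hp; exact: continuous_modulus.
have [u _ hu] := EVT_max cd (rcont_within h).
exists (modulus (p u)) => [|t ht]; first exact: modulus_ge0.
by apply: hu; rewrite in_itv.
Qed.

(** A remainder that is quadratic in [z - a], uniformly in [t], makes differentiation under the
    integral an instance of [cint_bound]. *)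
Lemma cint_derive (k : R -> R[i] -> R[i]) (k' : R -> R[i]) a (del K : R) :
  0 < del -> 0 <= K ->
  (forall z, modulus (z - a) < del -> ccont 0 (2 * pi) (k ^~ z)) -> ccont 0 (2 * pi) k' ->
  (forall t z, 0 <= t <= 2 * pi -> modulus (z - a) < del ->
     modulus (k t z - k t a - (z - a) * k' t) <= K * modulus (z - a) ^+ 2) ->
  is_derive (a : C) 1 ((fun z => cint 0 (2 * pi) (k ^~ z)) : C -> C) (cint 0 (2 * pi) k').
Proof.
move=> del0 K0 ck ck' hk; apply/is_deriveC => e e0.
pose B : R := 2 * K * (2 * pi) + 1.
have B0 : 0 < B.
  by rewrite ltr_wpDl// !mulr_ge0// ltW// pi_gt0.
exists (Num.min del (e / B)); first by rewrite lt_min del0 divr_gt0.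
move=> z; rewrite lt_min => /andP[zd ze].
have ca : ccont 0 (2 * pi) (k ^~ a) by apply: ck; rewrite subrr modulus0.
have cz := ck z zd.
have cd := ccontM (@ccont_cst _ 0 (2 * pi) (z - a)) ck'.
have -> : cint 0 (2 * pi) (k^~ z) - cint 0 (2 * pi) (k^~ a) - cint 0 (2 * pi) k' * (z - a) =
    cint 0 (2 * pi) (fun t => k t z - k t a - (z - a) * k' t).
  by rewrite (cintB (ccontB cz ca) cd) (cintB cz ca) (cintZ _ ck') [_ * (z - a)]mulrC.
have p0 := @pi2_gt0 R.
apply: (le_trans (cint_bound (ltW p0) (ccontB (ccontB cz ca) cd) (fun t ht => hk t z ht zd))).
rewrite subr0; have -> : 2 * (K * modulus (z - a) ^+ 2) * (2 * pi) =
   (2 * K * (2 * pi) * modulus (z - a)) * modulus (z - a) by rewrite expr2; ring.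
rewrite ler_wpM2r ?modulus_ge0//.
have : B * modulus (z - a) <= e by rewrite mulrC -ler_pdivlMr// ltW.
by apply: le_trans; rewrite ler_wpM2r ?modulus_ge0// lerDl.
Qed.

Section CauchyTransform.
Variables (psi : R -> R[i]) (r : R).
Hypothesis cpsi : ccont 0 (2 * pi) psi.

(** Cauchy integral with density [psi]; differentiation in [z] sends index [n] to [n] times index
    [n + 1]. *)
Definition ctrans n z := cint 0 (2 * pi) (fun t => psi t * (circ r t - z)^-1 ^+ n).

Let rho a := r - modulus a.

Lemma ccont_ctrans n a : modulus a < r -> ccont 0 (2 * pi) (fun t => psi t * (circ r t - a)^-1 ^+ n).
Proof.
move=> ar; have h : ccont 0 (2 * pi) (fun t => (circ r t - a)^-1 ^+ n).
  by apply: (@ccontX _ _ _ (fun t => (circ r t - a)^-1)); exact: ccont_cauchy_kernel.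
exact: (ccontM cpsi h).
Qed.

Lemma kernel_le a z t : modulus a < r -> modulus (z - a) < (r - modulus a) / 2 ->
  circ r t - z != 0 /\ modulus (circ r t - z)^-1 <= 2 / (r - modulus a).
Proof.
move=> ar hz; have rho0 : 0 < r - modulus a by rewrite subr_gt0.
have h : (r - modulus a) / 2 <= modulus (circ r t - z).
  have -> : circ r t - z = (circ r t - a) - (z - a) by ring.
  apply: le_trans (modulus_sub_le _ _).
  have := circ_sub_ge ar t; move: (modulus _) (modulus (z - a)) hz => x y; lra.
have h0 : 0 < modulus (circ r t - z) by apply: lt_le_trans h; rewrite divr_gt0.
split; first by rewrite -modulus_gt0.
by rewrite modulusV -invf_div lef_pV2 ?posrE// divr_gt0.
Qed.

(** The exponent 1 yields the derivative of a Cauchy integral, and the exponent 2 shows that this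
    derivative is differentiable in turn. *)
Lemma ctrans_derive n a : modulus a < r -> (0 < n <= 2)%N ->
  is_derive (a : C) 1 (ctrans n : C -> C) (n%:R * ctrans n.+1 a).
Proof.
move=> ar n12; have rho0 : 0 < r - modulus a by rewrite subr_gt0.
have [M M0 hM] := ccont_bounded (ltW (@pi2_gt0 R)) cpsi.
pose q := 2 / (r - modulus a).
have q0 : 0 < q by rewrite divr_gt0.
have qn m : 0 <= q ^+ m by rewrite exprn_ge0// ltW.
pose k' t := n%:R * (psi t * (circ r t - a)^-1 ^+ n.+1).
have ck' : ccont 0 (2 * pi) k' 
  by have := ccontM (@ccont_cst _ 0 (2 * pi) n%:R) (ccont_ctrans (n := n.+1) ar).
have -> : n%:R * ctrans n.+1 a = cint 0 (2 * pi) k' by rewrite (cintZ _ (ccont_ctrans (n := n.+1) ar)).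
have lt_r z : modulus (z - a) < (r - modulus a) / 2 -> modulus z < r.
  move=> hz; rewrite -(subrK a z); apply: le_lt_trans (modulusD _ _) _.
  by move: (modulus (z - a)) hz => x; lra.
have aa : modulus (a - a) < (r - modulus a) / 2 by rewrite subrr modulus0 divr_gt0.
(* The two summands are the remainder constants for [n = 1] and [n = 2]. With [x] and [y] the
   kernels at [z] and [a], [x - y = (z - a) * (x * y)] gives the remainders
   [(z - a)^2 * psi * x * y^2] and the same times [x + 2 * y], where [x] and [y] are at most [q] in
   modulus. *)
apply: (@cint_derive (fun t z => psi t * (circ r t - z)^-1 ^+ n) k' a ((r - modulus a) / 2) (M * q ^+ 3 + 3 * M * q ^+ 4)).
- by rewrite divr_gt0.
- by apply: addr_ge0; [exact: mulr_ge0 (qn _)|apply: mulr_ge0 (qn _); exact: mulr_ge0].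
- by move=> z /lt_r zr; exact: ccont_ctrans.
- exact: ck'.
move=> t z ht hz; rewrite /k'.
have [z0 hx] := kernel_le t ar hz; have [a0 hy] := kernel_le t ar aa.
have hp := hM t ht; rewrite -/q in hx hy.
set x := (circ r t - z)^-1; set y := (circ r t - a)^-1; rewrite -/x -/y in hx hy.
have xy : x - y = (z - a) * (x * y) by rewrite /x /y; field; rewrite z0 a0.
have q0' := ltW q0; have x0 := modulus_ge0 x; have y0 := modulus_ge0 y.
have xyy : modulus x * modulus y ^+ 2 <= q ^+ 3.
  by rewrite [q ^+ 3]exprS ler_pM ?sqr_ge0 ?lerXn2r ?nnegrE.
have xy0 : 0 <= modulus x * modulus y ^+ 2 by rewrite mulr_ge0 ?sqr_ge0.
have Mq : modulus (psi t) * (modulus x * modulus y ^+ 2) <= M * q ^+ 3.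
  by rewrite ler_pM ?modulus_ge0.
have zz : 0 <= modulus (z - a) ^+ 2 by rewrite exprn_ge0// modulus_ge0.
have [->|->] : n = 1%N \/ n = 2%N by case: n n12 {k' ck'} => [|[|[|]]]//; auto.
- have -> : psi t * x ^+ 1 - psi t * y ^+ 1 - (z - a) * (1 * (psi t * y ^+ 2)) =
      (z - a) ^+ 2 * (psi t * (x * y ^+ 2)).
    apply/eqP; rewrite -subr_eq0; set D := (X in X == 0).
    have -> : D = (x - y - (z - a) * (x * y)) * (psi t * (1 + (z - a) * y)) by rewrite /D; ring.
    by rewrite xy subrr mul0r.
  rewrite modulusM modulusX (modulusM (psi t)) (modulusM x) (modulusX y).
  rewrite mulrC ler_wpM2r//; apply: (le_trans Mq).
  by rewrite lerDl; apply: mulr_ge0 (qn _); exact: mulr_ge0.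
- have -> : psi t * x ^+ 2 - psi t * y ^+ 2 - (z - a) * (2 * (psi t * y ^+ 3)) =
      (z - a) ^+ 2 * (psi t * (x * y ^+ 2) * (x + 2 * y)).
    apply/eqP; rewrite -subr_eq0; set D := (X in X == 0).
    have -> : D = (x - y - (z - a) * (x * y)) * (psi t * (x + y) + psi t * (z - a) * y * (x + 2 * y)).
      by rewrite /D; ring.
    by rewrite xy subrr mul0r.
  rewrite modulusM modulusX (modulusM (psi t * _)) (modulusM (psi t)) (modulusM x) (modulusX y).
  rewrite mulrC ler_wpM2r//.
  have x2y : modulus (x + 2 * y) <= 3 * q.
    apply: le_trans (modulusD _ _) _; rewrite modulusM.
    have -> : modulus (2 : R[i]) = 2.
      by have := modulus_real (2 : R); rewrite rmorph_nat => ->; rewrite ger0_norm.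
    by move: (modulus x) (modulus y) hx hy => u v; lra.
  apply: (@le_trans _ _ (M * q ^+ 3 * (3 * q))).
    by apply: ler_pM => //; [apply: mulr_ge0 => //; exact: modulus_ge0|exact: modulus_ge0].
  have -> : M * q ^+ 3 * (3 * q) = 3 * M * q ^+ 4 by ring.
  by rewrite lerDr; apply: mulr_ge0 (qn _).
Qed.
End CauchyTransform.

(** Cauchy's formula writes [g] as a Cauchy integral, whose derivative is again one. *)
Lemma holo_derive g r : 0 < r -> holo r g -> exists g', forall z, modulus z < r ->
  is_derive (z : C) 1 (g : C -> C) (g' z) /\ derivable (g' : C -> C) z 1.
Proof.
move=> r0 hg.
pose psi t := g (circ r t) * circ r t.
have cpsi : ccont 0 (2 * pi) psi.
  exact: (ccontM (holo_circ (ltW r0) hg) (@continuous_circ _ r 0 (2 * pi))).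
pose c : R[i] := ((2 * pi)%:C)^-1.
have c0 : (2 * pi)%:C != 0 :> R[i].
  by rewrite -modulus_eq0 modulus_real normr_eq0 gt_eqF// pi2_gt0.
have gE z : modulus z < r -> g z = c * ctrans psi r 1 z.
  move=> zr; rewrite /c -[g z](mulfK c0) -(cauchy zr hg) mulrC; congr (_ * _).
  by apply: eq_cint => t _; rewrite /psi mulrA.
exists (fun z => c * (1%:R * ctrans psi r 2 z)) => z zr.
have nz w : modulus (w - z) < r - modulus z -> c * ctrans psi r 1 w = g w.
  move=> wz; rewrite -gE//; rewrite -(subrK z w); apply: le_lt_trans (modulusD _ _) _.
  by rewrite -ltrBrDr.
have d1 := ctrans_derive cpsi zr (isT : (0 < 1 <= 2)%N).
have d2 := ctrans_derive cpsi zr (isT : (0 < 2 <= 2)%N).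
split.
  have rz : 0 < r - modulus z by rewrite subr_gt0.
  exact: (is_derive_nearC rz nz (is_deriveZC c d1)).
apply: derivableM; first exact: derivable_cst.
by apply: derivableM; [exact: derivable_cst|case: d2].
Qed.

(** The quotient is a Cauchy integral: subtract the mean value formula from Cauchy's formula and use
    [w / (w - z) - 1 = z / (w - z)]. *)
Lemma holo_div g r : 0 < r -> holo r g -> exists k, forall z, modulus z < r ->
  derivable (k : C -> C) z 1 /\ g z = g 0 + z * k z.
Proof.
move=> r0 hg.
pose psi t := g (circ r t).
have cpsi : ccont 0 (2 * pi) psi by exact: (holo_circ (ltW r0) hg).
pose c : R[i] := ((2 * pi)%:C)^-1.
have c0 : (2 * pi)%:C != 0 :> R[i].
  by rewrite -modulus_eq0 modulus_real normr_eq0 gt_eqF// pi2_gt0.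
exists (fun z => c * ctrans psi r 1 z) => z zr; split.
  have d1 := ctrans_derive cpsi zr (isT : (0 < 1 <= 2)%N).
  by apply: derivableM; [exact: derivable_cst|case: d1].
have cz := ccont_ctrans cpsi (n := 1) zr.
apply: (mulIf c0); rewrite [RHS]mulrDl -(cauchy zr hg) -(mean_value r0 hg).
have -> : z * (c * ctrans psi r 1 z) * (2 * pi)%:C = z * ctrans psi r 1 z.
  have E (x y p : R[i]) : p != 0 -> x * (p^-1 * y) * p = x * y by move=> ?; field.
  exact: E.
rewrite /ctrans -(cintZ _ cz) -(cintD cpsi (ccontM (@ccont_cst _ _ _ z) cz)).
apply: eq_cint => t _; rewrite /psi; have nz := circ_sub_neq0 zr t.
by rewrite expr1; field.
Qed.

(** Cauchy's formula bounds [g] on the smaller disc by its maximum on a circle, so the compactness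
    of an interval is enough. *)
Lemma holo_bounded g r r' : r' < r -> holo r g ->
  exists M, forall z, modulus z <= r' -> modulus (g z) <= M.
Proof.
move=> r'r hg; have [r0|r0] := leP r 0.
  exists 0 => z zr; exfalso; have := modulus_ge0 z.
  by rewrite leNgt (le_lt_trans zr)// (lt_le_trans r'r).
pose psi t := g (circ r t) * circ r t.
have cpsi : ccont 0 (2 * pi) psi.
  exact: (ccontM (holo_circ (ltW r0) hg) (@continuous_circ _ r 0 (2 * pi))).
have [M M0 hM] := ccont_bounded (ltW (@pi2_gt0 R)) cpsi.
exists (2 * (M * (r - r')^-1)) => z zr'.
have zr : modulus z < r by exact: le_lt_trans r'r.
have cz : ccont 0 (2 * pi) (fun t => psi t * (circ r t - z)^-1).
  exact: (ccontM cpsi (@ccont_cauchy_kernel _ z r 0 (2 * pi) zr)).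
rewrite -(ler_pM2r (@pi2_gt0 R)).
have -> : modulus (g z) * (2 * pi) = modulus (g z * (2 * pi)%:C).
  by rewrite modulusM modulus_real ger0_norm// ltW// pi2_gt0.
rewrite -(cauchy zr hg) -[X in _ <= _ * X]subr0.
have -> : cint 0 (2 * pi) (fun t => g (circ r t) * (circ r t / (circ r t - z))) =
    cint 0 (2 * pi) (fun t => psi t * (circ r t - z)^-1).
  by apply: eq_cint => t _; rewrite /psi mulrA.
apply: cint_bound => [|//|t ht]; first exact: ltW (@pi2_gt0 R).
rewrite modulusM modulusV; apply: ler_pM; rewrite ?modulus_ge0 ?invr_ge0 ?modulus_ge0 ?hM//.
have h : r - r' <= modulus (circ r t - z) by apply: le_trans (circ_sub_ge zr t); rewrite lerD2l lerN2.
have h0 : 0 < r - r' by rewrite subr_gt0.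
by rewrite lef_pV2 ?posrE// (lt_le_trans h0 h).
Qed.

End Analyticity.

(** * Mean values of the logarithm of the modulus *)

Section LogModulus.
Context {R : realType}.
Local Notation C := (R[i]^o).
Implicit Types (g h : R[i] -> R[i]) (a z d : R[i]) (p : R -> R[i]).

Lemma continuous_ln_modulus p (t : R) : {for t, continuous (p : R -> C)} -> p t != 0 ->
  {for t, continuous (fun x => ln (modulus (p x)))}.
Proof.
move=> /continuous_modulus c1 pt0.
have c2 : {for modulus (p t), continuous (@ln R)}.
  by apply: continuous_ln; rewrite modulus_gt0.
exact: (continuous_comp c1 c2).
Qed.

Lemma path_derive_comp p g (t : R) d d' : path_derive p t d ->
  is_derive (p t : C) 1 (g : C -> C) d' -> path_derive (g \o p) t (d' * d).
Proof.
move=> /path_deriveP hp /is_deriveC hg; apply/path_deriveP => e e0.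
have B0 : 0 < 2 * (modulus d + 1) by rewrite mulr_gt0// ltr_wpDl ?modulus_ge0.
have B1 : 0 < 2 * (modulus d' + 1) by rewrite mulr_gt0// ltr_wpDl ?modulus_ge0.
have [|del1 d10 h1] := hg (e / (2 * (modulus d + 1))); first by rewrite divr_gt0.
pose e2 := Num.min 1 (e / (2 * (modulus d' + 1))).
have e20 : 0 < e2 by rewrite lt_min ltr01 divr_gt0.
have [del2 d20 h2] := hp e2 e20.
have e21 : e2 <= 1 by rewrite ge_min lexx.
exists (Num.min del2 (del1 / (modulus d + 1))).
  by rewrite lt_min d20 divr_gt0// ltr_wpDl ?modulus_ge0.
move=> k; rewrite lt_min => /andP[kd2 kd1].
have hk := h2 k kd2.
have incr : modulus (p (k + t) - p t) <= (modulus d + 1) * `|k|.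
  have -> : p (k + t) - p t = (p (k + t) - p t - d * k%:C) + d * k%:C by ring.
  apply: (le_trans (modulusD _ _)); rewrite modulusM modulus_real mulrDl mul1r addrC lerD2l.
  by apply: (le_trans hk); rewrite ler_piMl.
have close : modulus (p (k + t) - p t) < del1.
  by apply: (le_lt_trans incr); rewrite mulrC -ltr_pdivlMr// ltr_wpDl ?modulus_ge0.
have {}h1 := h1 _ close.
have -> : (g \o p) (k + t) - (g \o p) t - d' * d * k%:C =
    (g (p (k + t)) - g (p t) - d' * (p (k + t) - p t)) + d' * (p (k + t) - p t - d * k%:C).
  by rewrite /=; ring.
apply: (le_trans (modulusD _ _)); rewrite [e]splitr mulrDl; apply: lerD.
  apply: (le_trans h1); apply: (@le_trans _ _ (e / (2 * (modulus d + 1)) * ((modulus d + 1) * `|k|))).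
    by rewrite ler_wpM2l// ltW// divr_gt0.
  have : modulus d + 1 != 0 by rewrite gt_eqF// ltr_wpDl ?modulus_ge0.
  by move: (modulus d + 1) => m m0; rewrite le_eqVlt; apply/orP; left; apply/eqP; field.
rewrite modulusM; apply: (@le_trans _ _ (modulus d' * (e / (2 * (modulus d' + 1)) * `|k|))).
  rewrite ler_wpM2l ?modulus_ge0//; apply: (le_trans hk).
  by rewrite ler_wpM2r// ge_min lexx orbT.
rewrite mulrA ler_wpM2r// mulrC -mulrA ler_wpM2l ?(ltW e0)//.
rewrite invfM -mulrA ler_piMr// mulrC ler_pdivrMr ?mul1r ?lerDl//.
by rewrite ltr_wpDl ?modulus_ge0.
Qed.

Lemma path_derive_line z (s : R) : path_derive (fun x => x%:C * z) s z.
Proof.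
apply/path_deriveP => e e0; exists 1 => // k _.
have -> : (k + s)%:C * z - s%:C * z - z * k%:C = 0 by rewrite rmorphD; ring.
by rewrite modulus0 mulr_ge0// ltW.
Qed.

Lemma is_derive_ln_modulus p (t : R) d : path_derive p t d -> p t != 0 ->
  is_derive t 1 (fun x => ln (modulus (p x))) (Re (d / p t)).
Proof.
move=> [dr di] pt0.
have mE x : modulus (p x) ^+ 2 = Re (p x) ^+ 2 + Im (p x) ^+ 2.
  by rewrite /modulus; case: (p x) => u v /=; rewrite sqr_sqrtr// addr_ge0 ?sqr_ge0.
have lnE (m : R) : 0 <= m -> ln m = 2^-1 * ln (m ^+ 2).
  rewrite le_eqVlt => /predU1P[<-|m0]; first by rewrite expr0n/= ln0// mulr0.
  by rewrite lnXn// -(mulr_natr (ln m)) mulrC mulfK.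
have -> : (fun x => ln (modulus (p x))) = (fun x => 2^-1 * ln (Re (p x) ^+ 2 + Im (p x) ^+ 2)).
  by apply/funext => x; rewrite lnE ?modulus_ge0// mE.
have m0 : 0 < Re (p t) ^+ 2 + Im (p t) ^+ 2 by rewrite -mE exprn_gt0// modulus_gt0.
have dq : is_derive t 1 (fun x => Re (p x) ^+ 2 + Im (p x) ^+ 2)
    (2 * (Re (p t) * Re d + Im (p t) * Im d)).
  apply: (@is_derive_eq _ _ _ _ _ _ _ _ (is_deriveD (is_deriveM dr dr) (is_deriveM di di))).
  by rewrite /GRing.scale/=; ring.
have dl := @is_derive1_comp R (@ln R) (fun x => Re (p x) ^+ 2 + Im (p x) ^+ 2) t _ _ (is_derive1_ln m0) dq.
have h := @is_deriveZ _ _ _ _ (2^-1 : R) t 1 _ dl.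
apply: (is_derive_eq h).
rewrite /GRing.scale/=; move: m0; case: (p t) => u v /=; case: (d) => x y /= m0.
have m0' : u ^+ 2 + v ^+ 2 != 0 by rewrite gt_eqF.
by simpc; field.
Qed.

Lemma cint_mul_real g r a : modulus a < r -> holo r g ->
  rint 0 (2 * pi) (fun t => Re (g (circ r t)) * poisson r a t) = Re (g a) * (2 * pi).
Proof.
move=> ar hg; have := congr1 (fun z => Re z) (poisson_holo ar hg).
rewrite {1}/cint; rewrite [Re (g a * _)](_ : _ = Re (g a) * (2 * pi)); last first.
  by rewrite mulrC Re_real_mul mulrC.
by move=> <- /=; apply: eq_rint => t _ /=; rewrite [g _ * _]mulrC Re_real_mul mulrC.
Qed.

Lemma rint_poisson r a : modulus a < r -> rint 0 (2 * pi) (poisson r a) = 2 * pi.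
Proof.
move=> ar; have := @cint_mul_real (fun=> 1) r a ar (fun z _ => @derivable_cst _ _ _ _ _ _).
by rewrite /= mul1r => h; rewrite -[RHS]h; apply: eq_rint => t _; rewrite mul1r.
Qed.

(** No branch of [log h] is constructed. The Poisson integral of [ln |h (s z)|] has [s]-derivative
    [2 * pi * Re (a * h' (s a) / h (s a))], by the Poisson formula for the holomorphic function
    [z * h' (s z) / h (s z)]. This is also the derivative of [2 * pi * ln |h (s a)|], and the two
    functions agree at [s = 0]. *)
Lemma poisson_ln h a r r1 : modulus a < r -> r < r1 -> holo r1 h ->
  (forall z, modulus z <= r1 -> h z != 0) ->
  rint 0 (2 * pi) (fun t => ln (modulus (h (circ r t))) * poisson r a t) =
  ln (modulus (h a)) * (2 * pi).
Proof.
move=> ar rr1 hh h0; have r0 : 0 < r by exact: le_lt_trans (modulus_ge0 _) ar.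
have r10 : 0 < r1 by exact: lt_trans rr1.
have p0 := @pi2_gt0 R.
have [h' dh] := holo_derive r10 hh.
pose k z := h' z / h z.
have dk z : modulus z < r1 -> derivable (k : C -> C) z 1.
  move=> zr; have [dhz dh'z] := dh z zr.
  apply: (@derivableM _ _ (h' : C -> R[i]) (fun w => (h w)^-1)); first exact: dh'z.
  by apply: (@derivableV _ _ (h : C -> R[i])); [apply: h0; exact: ltW|case: dhz].
(* Since [v > 1], the value [s = 1] is interior to the range of differentiation, while [v * r],
   halfway between [r] and [r1], keeps [s z] where [h' / h] is bounded. *)
pose v := (r + r1) / (2 * r).
have vr : v * r = (r + r1) / 2 by rewrite /v; field; rewrite gt_eqF.
have v1 : 1 < v by rewrite /v ltr_pdivlMr ?mulr_gt0// mul1r; lra.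
have [M hM] : exists M, forall z, modulus z <= v * r -> modulus (k z) <= M.
  have h1 : v * r < (v * r + r1) / 2 by rewrite vr; lra.
  apply: (holo_bounded h1) => z zr; apply: dk; apply: (le_lt_trans zr); rewrite vr; lra.
have M0 : 0 <= M by apply: le_trans (modulus_ge0 (k 0)) _; rewrite hM// modulus0 vr; lra.
have sle (s : R) z : `|s| < v -> modulus z <= r -> modulus (s%:C * z) <= v * r.
  by move=> sv zr; rewrite modulusM modulus_real ler_pM ?modulus_ge0// ltW.
have slt (s : R) z : `|s| < v -> modulus z <= r -> modulus (s%:C * z) < r1.
  by move=> sv zr; apply: le_lt_trans (sle _ _ sv zr) _; rewrite vr; lra.
have mc t : modulus (circ r t) <= r by rewrite modulus_circ// ltW.
pose F (s : R) t := ln (modulus (h (s%:C * circ r t))) * poisson r a t.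
have dln (s : R) z : `|s| < v -> modulus z <= r ->
    is_derive s 1 (fun x => ln (modulus (h (x%:C * z)))) (Re (z * k (s%:C * z))).
  move=> sv zr; have sz := slt s z sv zr.
  have [dhz _] := dh _ sz.
  have hp := path_derive_comp (path_derive_line z s) dhz.
  have := is_derive_ln_modulus hp (h0 _ (ltW sz)).
  by rewrite /= /k mulrCA mulrA.
pose dF (s : R) t := Re (circ r t * k (s%:C * circ r t)) * poisson r a t.
have dFE (s : R) t : `|s| < v -> is_derive s 1 (F ^~ t) (dF s t).
  move=> sv; have h1 := dln s (circ r t) sv (mc t).
  have h2 := @is_deriveM _ _ _ (cst (poisson r a t)) s 1 _ _ h1 (is_derive_cst _ _ _).
  by apply: (is_derive_eq h2); rewrite /GRing.scale/= mulr0 add0r mulrC.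
have csc (s : R) : ccont 0 (2 * pi) (fun t => s%:C * circ r t).
  exact: (ccontM (@ccont_cst _ _ _ s%:C) (@continuous_circ _ r 0 (2 * pi))).
have cF (s : R) : `|s| < v -> rcont 0 (2 * pi) (F s).
  move=> sv t ht; apply: cvgM; last exact: (rcont_poisson ar ht).
  have zr := slt s (circ r t) sv (mc t).
  have c1 : {for t, continuous ((fun t => h (s%:C * circ r t)) : R -> C)}.
    apply: (@continuous_comp_path _ h (fun t => s%:C * circ r t)); first exact: csc.
    by apply: hh; exact: ltW.
  by have := continuous_ln_modulus c1 (h0 _ (ltW zr)).
have Pb t : `|poisson r a t| <= 1 + 2 * modulus a / (r - modulus a).
  have := poisson_dist t ar; have := ler_normD 1 (poisson r a t - 1).
  by rewrite addrC subrK normr1 => h1 h2; apply: (le_trans h1); rewrite lerD2l.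
pose K := r * M * (1 + 2 * modulus a / (r - modulus a)).
have PK0 : 0 <= 1 + 2 * modulus a / (r - modulus a) by exact: le_trans (normr_ge0 _) (Pb 0).
have dFb (s : R) t : `|s| < v -> `|dF s t| <= K.
  move=> sv; rewrite /dF normrM ler_pM// (le_trans (Re_le_modulus _))//.
  by rewrite modulusM ler_pM ?modulus_ge0// hM// sle.
pose mu := @lebesgue_measure R.
have dJ (s : R) : `|s| < v -> is_derive s 1 (fun x => rint 0 (2 * pi) (F x)) (Re (a * k (s%:C * a)) * (2 * pi)).
  move=> sv; have sI : `](- v), v[%classic s.
    by rewrite /= in_itv/= -ltr_norml.
  have hI (x : R) : `](- v), v[%classic x -> `|x| < v by rewrite /= in_itv/= ltr_norml.
  have i1 : forall x, `](- v), v[%classic x -> mu.-integrable `[0, 2 * pi] (EFin \o F x).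
    by move=> x /hI xv; apply: rint_integrable; exact: cF.
  have i2 : forall x y, `](- v), v[%classic x -> `[0, 2 * pi]%classic y -> derivable (F ^~ y) x 1.
    by move=> x y /hI xv _; have [] := dFE x y xv.
  have i3 : mu.-integrable `[0, 2 * pi] (EFin \o (cst K)).
    by apply: rint_integrable; exact: rcont_cst.
  have K0 : forall y : R, 0 <= cst K y by move=> y; rewrite /= !mulr_ge0// ltW.
  have d1E x y : `|x| < v -> partial1of2 F x y = dF x y.
    by move=> xv; rewrite partial1of2E; have [_ ->] := dFE x y xv.
  have i4 : forall x y, `](- v), v[%classic x -> `[0, 2 * pi]%classic y -> `|partial1of2 F x y| <= cst K y.
    by move=> x y /hI xv _; rewrite d1E//; exact: dFb.
  have dd := @derivable_under_integral R _ _ mu F `[0, 2 * pi] (measurable_itv _) s (- v) v sI i1 i2 (cst K) K0 i3 i4.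
  have vv := @differentiation_under_integral R _ _ mu F `[0, 2 * pi] (measurable_itv _) s (- v) v sI i1 i2 (cst K) K0 i3 i4.
  split; first exact: dd.
  rewrite -derive1E [LHS]vv.
  have -> : \int[mu]_(y in `[0, 2 * pi]) partial1of2 F s y = rint 0 (2 * pi) (dF s).
    by apply: eq_rint => t _; rewrite d1E.
  rewrite /dF (@cint_mul_real (fun z => z * k (s%:C * z)) r a ar)// => z zr.
  apply: derivableM; first exact: derivable_id.
  have /derivableC[d hd] := dk _ (slt s z sv zr).
  rewrite -[_ * z]addr0 in hd; have [h1 _] := is_derive_affineC hd.
  by under eq_fun do rewrite -[_%:C * _]addr0; exact: h1.
have Phi (s : R) : `|s| < v -> is_derive s 1 (fun x => rint 0 (2 * pi) (F x) - 2 * pi * ln (modulus (h (x%:C * a)))) 0.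
  move=> sv; have h1 := @is_deriveZ _ _ _ _ (2 * pi : R) s 1 _ (dln s a sv (ltW ar)).
  have h2 := is_deriveB (dJ s sv) h1.
  by apply: (is_derive_eq h2); rewrite /GRing.scale/= mulrC subrr.
have [||c _] := @MVT_segment R (fun x => rint 0 (2 * pi) (F x) - 2 * pi * ln (modulus (h (x%:C * a)))) (fun=> 0) 0 1 ler01.
- move=> x; rewrite in_itv/= => /andP[x0 x1]; apply: Phi.
  by rewrite ger0_norm ?(ltW x0)//; exact: lt_trans v1.
- apply: rcont_within => x /andP[x0 x1].
  have xv : `|x| < v by rewrite ger0_norm//; exact: le_lt_trans v1.
  by have [/derivable1_diffP/differentiable_continuous] := Phi x xv.
rewrite rmorph1 rmorph0 !mul0r mul1r => /eqP; rewrite subr_eq0 => /eqP E.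
have -> : rint 0 (2 * pi) (fun t => ln (modulus (h (circ r t))) * poisson r a t) = rint 0 (2 * pi) (F 1).
  by apply: eq_rint => t _; rewrite /F rmorph1 mul1r.
have F0 : rint 0 (2 * pi) (F 0) = ln (modulus (h 0)) * (2 * pi).
  transitivity (rint 0 (2 * pi) (fun t => ln (modulus (h 0)) * poisson r a t)).
    by apply: eq_rint => t _; rewrite /F rmorph0 mul0r.
  by rewrite (rintZ _ (rcont_poisson ar)) rint_poisson.
by move: E; rewrite F0 [_ * (2 * pi)]mulrC subrr => /eqP; rewrite subr_eq0 => /eqP ->; rewrite mulrC.
Qed.

Lemma rcont_ln_modulus h (r u v : R) : 0 <= r ->
  (forall z, modulus z = r -> h z != 0 /\ {for (z : C), continuous (h : C -> C)}) ->
  rcont u v (fun t => ln (modulus (h (circ r t)))).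
Proof.
move=> r0 hh t ht; have [h0 ch] := hh (circ r t) (modulus_circ t r0).
have c1 : {for t, continuous ((fun t => h (circ r t)) : R -> C)}.
  have c2 : {for t, continuous (circ r : R -> C)} by exact: (@continuous_circ _ r u v).
  exact: (continuous_comp c2 ch).
exact: continuous_ln_modulus c1 h0.
Qed.

Lemma rcont_ln_holo h (r u v : R) : 0 <= r -> holo r h -> (forall z, modulus z <= r -> h z != 0) ->
  rcont u v (fun t => ln (modulus (h (circ r t)))).
Proof.
move=> r0 hh h0; apply: rcont_ln_modulus => // z zr.
by split; [rewrite h0// zr|apply: derivable_continuousC; apply: hh; rewrite zr].
Qed.

Lemma mean_ln h r r1 : 0 < r -> r < r1 -> holo r1 h -> (forall z, modulus z <= r1 -> h z != 0) ->
  rint 0 (2 * pi) (fun t => ln (modulus (h (circ r t)))) = ln (modulus (h 0)) * (2 * pi).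
Proof.
move=> r0 rr1 hh h0; have ar : modulus (0 : R[i]) < r by rewrite modulus0.
rewrite -(poisson_ln ar rr1 hh h0); apply: eq_rint => t _.
by rewrite /poisson mul0r mulr0 addr0 mulr1.
Qed.

(** The difference is the integral of [ln |h|] against the Poisson kernel minus 1. This weight has
    integral 0, so any constant [L] may be subtracted from [ln |h|]. *)
Lemma ln_oscillation h a r r1 L : modulus a < r -> r < r1 -> holo r1 h ->
  (forall z, modulus z <= r1 -> h z != 0) ->
  `|ln (modulus (h a)) - ln (modulus (h 0))| * (2 * pi) <=
  2 * modulus a / (r - modulus a) * rint 0 (2 * pi) (fun t => `|ln (modulus (h (circ r t))) - L|).
Proof.
move=> ar rr1 hh h0; have r0 : 0 < r by exact: le_lt_trans (modulus_ge0 _) ar.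
have p0 := @pi2_gt0 R.
have cu : rcont 0 (2 * pi) (fun t => ln (modulus (h (circ r t)))).
  apply: rcont_ln_holo; [exact: ltW|exact: holoS (ltW rr1) hh|].
  by move=> z zr; apply: h0; exact: le_trans (ltW rr1).
have cuL : rcont 0 (2 * pi) (fun t => ln (modulus (h (circ r t))) - L).
  by move=> t ht; apply: cvgB; [exact: cu|exact: cvg_cst].
have cP1 : rcont 0 (2 * pi) (fun t => poisson r a t - 1).
  by move=> t ht; apply: cvgB; [exact: (rcont_poisson ar ht)|exact: cvg_cst].
have cprod : rcont 0 (2 * pi) (fun t => (ln (modulus (h (circ r t))) - L) * (poisson r a t - 1)).
  by move=> t ht; apply: cvgM; [exact: cuL|exact: cP1].
have cuP : rcont 0 (2 * pi) (fun t => ln (modulus (h (circ r t))) * poisson r a t).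
  by move=> t ht; apply: cvgM; [exact: cu|exact: (rcont_poisson ar ht)].
have E : (ln (modulus (h a)) - ln (modulus (h 0))) * (2 * pi) =
    rint 0 (2 * pi) (fun t => (ln (modulus (h (circ r t))) - L) * (poisson r a t - 1)).
  have -> : rint 0 (2 * pi) (fun t => (ln (modulus (h (circ r t))) - L) * (poisson r a t - 1)) =
    rint 0 (2 * pi) (fun t => (ln (modulus (h (circ r t))) * poisson r a t +
      -1 * ln (modulus (h (circ r t)))) + ((- L) * poisson r a t + L)).
    by apply: eq_rint => t _; ring.
  have c1 := rcontZ (k := -1) cu.
  have c2 := rcontZ (k := - L) (@rcont_poisson R r a 0 (2 * pi) ar).
  rewrite (rintD (rcontD cuP c1) (rcontD c2 (@rcont_cst _ _ _ L))).
  rewrite (rintD cuP c1) (rintD c2 (@rcont_cst _ _ _ L)) !rintZ//; last exact: rcont_poisson.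
  rewrite (poisson_ln ar rr1 hh h0) (mean_ln r0 rr1 hh h0) (rint_poisson ar) (rint_cst L (ltW p0)).
  by ring.
have -> : `|ln (modulus (h a)) - ln (modulus (h 0))| * (2 * pi) =
    `|(ln (modulus (h a)) - ln (modulus (h 0))) * (2 * pi)|.
  by rewrite normrM (ger0_norm (ltW p0)).
rewrite E; apply: (le_trans (rint_abs cprod)); rewrite -(rintZ _ (rcont_norm cuL)).
apply: rint_le; [exact: rcont_norm|exact: rcontZ (rcont_norm cuL)|].
by move=> t _; rewrite normrM mulrC ler_wpM2r// poisson_dist.
Qed.

(* The mean of [ln |z - s|] over the circle [|z| = r]. *)
Definition lnmax r (s : R[i]) : R := if modulus s < r then ln r else ln (modulus s).

Lemma rcont_ln_sub (s : R[i]) r u v : 0 < r -> modulus s != r ->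
  rcont u v (fun t => ln (modulus (circ r t - s))).
Proof.
move=> r0 sr; apply: (@rcont_ln_modulus (fun z => z - s)) => [|z zr]; first exact: ltW.
split; first by rewrite subr_eq0; apply: contra sr => /eqP <-; rewrite zr.
apply: derivable_continuousC; apply: derivableB; [exact: derivable_id|exact: derivable_cst].
Qed.

(** For [s] inside the circle, [|z - s| = |r^2 - conj s * z| / r] on the circle, and the numerator
    has no zero in a larger disc; outside, [z - s] itself has none. *)
Lemma mean_ln_sub (s : R[i]) r : 0 < r -> modulus s != r ->
  rint 0 (2 * pi) (fun t => ln (modulus (circ r t - s))) = lnmax r s * (2 * pi).
Proof.
move=> r0 sr; have s0 := modulus_ge0 s; have p0 := @pi2_gt0 R.
rewrite /lnmax; case: ifPn => [lt|].
  pose h z : R[i] := (r ^+ 2)%:C - s^* * z.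
  (* A radius beyond [r] with [|s| * r1 < r^2], because [|s| < r] gives [2 * |s| < r + |s|]. *)
  pose r1 := 2 * r ^+ 2 / (r + modulus s).
  have rs0 : 0 < r + modulus s by rewrite ltr_wpDr.
  have rr1 : r < r1 by rewrite /r1 ltr_pdivlMr//; nra.
  have hh : holo r1 h.
    move=> z _; apply: derivableB; first exact: derivable_cst.
    by apply: derivableM; [exact: derivable_cst|exact: derivable_id].
  have h0 z : modulus z <= r1 -> h z != 0.
    move=> zr; rewrite -modulus_gt0; apply: lt_le_trans (modulus_sub_le _ _).
    rewrite modulus_real modulusM modulusJ ger0_norm ?sqr_ge0// subr_gt0.
    apply: (le_lt_trans (ler_wpM2l s0 zr)); rewrite /r1 mulrA ltr_pdivrMr//.
    have : 0 < r ^+ 2 * (r - modulus s) by rewrite mulr_gt0 ?exprn_gt0 ?subr_gt0.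
    by move: (modulus s) (r ^+ 2) => x y; nra.
  have := mean_ln r0 rr1 hh h0; rewrite {2}/h mulr0 subr0 modulus_real ger0_norm ?sqr_ge0// => E.
  have -> : rint 0 (2 * pi) (fun t => ln (modulus (circ r t - s))) =
      rint 0 (2 * pi) (fun t => ln (modulus (h (circ r t))) + - ln r).
    apply: eq_rint => t _; have := conj_circ_sub s t r0; rewrite -/(h _) => /(congr1 modulus).
    rewrite modulusJ modulusV modulusM modulusV modulus_circ ?(ltW r0)// => E1.
    have h1 : 0 < modulus (h (circ r t)).
      by rewrite modulus_gt0 h0// modulus_circ ltW.
    have -> : modulus (circ r t - s) = modulus (h (circ r t)) / r.
      by apply: invr_inj; rewrite E1 invfM invrK mulrC.
    by rewrite ln_div// posrE.
  have ch : rcont 0 (2 * pi) (fun t => ln (modulus (h (circ r t)))).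
    apply: rcont_ln_holo; [exact: ltW|exact: holoS (ltW rr1) hh|].
    by move=> z zr; apply: h0; exact: le_trans (ltW rr1).
  rewrite (rintD ch (@rcont_cst _ _ _ (- ln r))) E (rint_cst _ (ltW p0)) lnXn// mulr2n.
  by ring.
rewrite -leNgt => le; have lt : r < modulus s by rewrite lt_def sr.
have h0 z : modulus z <= (r + modulus s) / 2 -> z - s != 0.
  move=> zr; rewrite subr_eq0; apply/eqP => zs; move: zr; rewrite zs; lra.
have := @mean_ln (fun z => z - s) r ((r + modulus s) / 2) r0 _ _ h0.
rewrite sub0r modulusN; apply; first by lra.
by move=> z _; apply: derivableB; [exact: derivable_id|exact: derivable_cst].
Qed.

(** The deviation [x] from the mean is at most [ln 2] pointwise, hence [|x| <= 2 * ln 2 - x], and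
    [x] has mean 0. *)
Lemma mean_abs_ln_sub (s : R[i]) r : 0 < r -> modulus s != r ->
  rint 0 (2 * pi) (fun t => `|ln (modulus (circ r t - s)) - lnmax r s|) <= 2 * ln 2 * (2 * pi).
Proof.
move=> r0 sr; have s0 := modulus_ge0 s; have p0 := @pi2_gt0 R.
have c1 := rcont_ln_sub (u := 0) (v := 2 * pi) r0 sr.
have c2 : rcont 0 (2 * pi) (fun t => ln (modulus (circ r t - s)) - lnmax r s).
  by move=> t ht; apply: cvgB; [exact: c1|exact: cvg_cst].
have c3 := rcontZ (k := -1) c1.
have c4 := rcontD (@rcont_cst _ 0 (2 * pi) (2 * ln 2 + lnmax r s)) c3.
apply: (le_trans (rint_le (rcont_norm c2) c4 _)) => [t _ /=|].
  have nz : 0 < modulus (circ r t - s).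
    rewrite modulus_gt0 subr_eq0; apply: contra sr => /eqP <-.
    by rewrite modulus_circ// ltW.
  have ub : ln (modulus (circ r t - s)) <= ln 2 + lnmax r s.
    have h := modulusB (circ r t) s; rewrite modulus_circ ?(ltW r0)// in h.
    rewrite /lnmax; case: ifPn => [lt|].
      rewrite -lnM ?posrE// ler_ln ?posrE ?mulr_gt0//; lra.
    rewrite -leNgt => le; have ms : 0 < modulus s by exact: lt_le_trans le.
    by rewrite -lnM ?posrE// ler_ln ?posrE ?mulr_gt0//; lra.
  have l2 : 0 <= ln 2 :> R by rewrite ln_ge0// ler1n.
  by rewrite ler_norml; apply/andP; split; lra.
rewrite (rintD (@rcont_cst _ _ _ _) c3) (rint_cst _ (ltW p0)) (rintZ _ c1) mean_ln_sub//.
by rewrite le_eqVlt; apply/orP; left; apply/eqP; ring.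
Qed.

End LogModulus.

(** * Orders of zeros and poles *)

Section Orders.
Context {R : realType}.
Local Notation C := (R[i]^o).
Implicit Types (g h k : R[i] -> R[i]) (a z w : R[i]).

Definition holoo (r : R) g := forall z, modulus z < r -> derivable (g : C -> C) z 1.

(** The quotient is [(g z - g 0) / z] off 0 and a Cauchy integral near 0. No radius is lost, so the
    division can be iterated. *)
Lemma holoo_div g r : 0 < r -> holoo r g -> exists2 k, holoo r k &
  forall z, modulus z < r -> g z = g 0 + z * k z.
Proof.
move=> r0 hg; have r20 : 0 < r / 2 by rewrite divr_gt0.
have h2 : holo (r / 2) g by move=> z zr; apply: hg; apply: le_lt_trans zr _; lra.
have [k0 hk0] := holo_div r20 h2.
pose k z := if z == 0 then k0 0 else (g z - g 0) / z.
have kE z : modulus z < r / 2 -> k0 z = k z.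
  rewrite /k; case: eqVneq => [->//|z0 zr]; have [_ ->] := hk0 z zr.
  by field.
exists k => [z zr|z zr]; last first.
  rewrite /k; case: eqVneq => [->|z0]; first by rewrite mul0r addr0.
  by field.
have [->|z0] := eqVneq z 0.
  apply: (derivable_nearC (g1 := k0) r20) => [w|]; first by rewrite subr0; exact: kE.
  by have [] := hk0 0; rewrite ?modulus0.
have mz : 0 < modulus z by rewrite modulus_gt0.
apply: (derivable_nearC (g1 := fun w => (g w - g 0) / w) mz) => [w wz|].
  rewrite /k; case: eqVneq => // w0; move: wz; rewrite w0 sub0r modulusN ltxx//.
apply: (@derivableM _ _ (fun w : C => g w - g 0) (fun w => w^-1)).
  by apply: derivableB; [exact: hg|exact: derivable_cst].
by apply: (@derivableV _ _ (fun w : C => w)); [exact: z0|exact: derivable_id].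
Qed.

(** A crude maximum principle: on the half disc the Cauchy kernel is at most 2 in modulus, and
    [cint_bound] costs another 2. *)
Lemma holo_sup g r (M : R) : 0 < r -> holo r g -> (forall t, 0 <= t <= 2 * pi -> modulus (g (circ r t)) <= M) ->
  forall z, modulus z <= r / 2 -> modulus (g z) <= 4 * M.
Proof.
move=> r0 hg hM z zr; have p0 := @pi2_gt0 R.
have zr' : modulus z < r by apply: le_lt_trans zr _; lra.
rewrite -(ler_pM2r p0).
have -> : modulus (g z) * (2 * pi) = modulus (g z * (2 * pi)%:C).
  by rewrite modulusM modulus_real ger0_norm// ltW.
rewrite -(cauchy zr' hg).
have -> : 4 * M * (2 * pi) = 2 * (M * 2) * (2 * pi - 0) by rewrite subr0; ring.
have ck := ccontM (@continuous_circ _ r 0 (2 * pi)) (@ccont_cauchy_kernel _ z r 0 (2 * pi) zr').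
apply: cint_bound => [||t ht]; [exact: ltW|exact: (ccontM (holo_circ (ltW r0) hg) ck)|].
rewrite modulusM; apply: ler_pM; rewrite ?modulus_ge0 ?hM//.
have h : r - modulus z <= modulus (circ r t - z) by exact: circ_sub_ge.
have h0 : 0 < modulus (circ r t - z) by apply: lt_le_trans h; rewrite subr_gt0.
rewrite modulusM modulusV modulus_circ ?(ltW r0)// ler_pdivrMr//.
by move: (modulus (_ - _)) (modulus z) h zr => x y; lra.
Qed.

(** If [z ^+ m] divides [g] for every [m], then [holo_sup] applied to the quotients on the circle of
    radius [r / 2] gives [|g z| <= 4 * M / 2 ^+ m] for all [m] when [|z| <= r / 4]. This stands in
    for the power series. *)
Lemma zero_orderP g r : 0 < r -> holoo r g ->
  (exists m k, [/\ holoo r k, k 0 != 0 & forall z, modulus z < r -> g z = z ^+ m * k z]) \/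
  (forall z, modulus z < r / 4 -> g z = 0).
Proof.
move=> r0 hg; have [|no] := pselect (exists m k, [/\ holoo r k, k 0 != 0 & forall z, modulus z < r -> g z = z ^+ m * k z]); first by left.
right.
have all m : exists2 k, holoo r k & forall z, modulus z < r -> g z = z ^+ m * k z.
  elim: m => [|m [k hk kE]]; first by exists g => // z _; rewrite expr0 mul1r.
  have [k00|k0] := eqVneq (k 0) 0; last by exfalso; apply: no; exists m, k.
  have [k1 hk1 k1E] := holoo_div r0 hk.
  by exists k1 => // z zr; rewrite kE// k1E// k00 add0r exprSr mulrA.
pose p := r / 2; have p0 : 0 < p by rewrite divr_gt0.
have hp : holo p g by move=> z zr; apply: hg; apply: le_lt_trans zr _; rewrite /p; lra.
have [M M0 hM] := ccont_bounded (ltW (@pi2_gt0 R)) (holo_circ (c := 0) (d := 2 * pi) (ltW p0) hp).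
move=> z zr; have zp : modulus z <= p / 2 by apply: ltW; apply: lt_le_trans zr _; rewrite /p; lra.
have bound m : modulus (g z) * 2 ^+ m <= 4 * M.
  have [k hk kE] := all m.
  have hk' : holo p k by move=> x xr; apply: hk; apply: le_lt_trans xr _; rewrite /p; lra.
  have kM t : 0 <= t <= 2 * pi -> modulus (k (circ p t)) <= M / p ^+ m.
    move=> ht; rewrite ler_pdivlMr ?exprn_gt0//; have := hM t ht.
    rewrite kE ?modulus_circ ?(ltW p0)//; last by rewrite /p; lra.
    by rewrite modulusM modulusX modulus_circ ?(ltW p0)// mulrC.
  have := holo_sup p0 hk' kM zp; rewrite mulrA ler_pdivlMr ?exprn_gt0// => h.
  have zr0 : modulus z < r by apply: le_lt_trans zp _; rewrite /p; lra.
  rewrite (kE _ zr0) modulusM modulusX mulrAC -exprMn mulrC.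
  apply: le_trans h; rewrite ler_wpM2l ?modulus_ge0// lerXn2r ?nnegrE ?mulr_ge0 ?modulus_ge0 ?(ltW p0) ?(ltW r0)//.
  by clear -zp; lra.
apply/eqP; rewrite -modulus_eq0 eq_le modulus_ge0 andbT leNgt; apply/negP => gz.
pose n := Num.bound (4 * M / modulus (g z)).
have : 4 * M / modulus (g z) < n%:R.
  by apply: archi_boundP; rewrite divr_ge0 ?mulr_ge0// ltW.
rewrite ltr_pdivrMr// => h1; have := bound n; rewrite leNgt => /negP; apply.
apply: lt_le_trans h1 _; rewrite mulrC ler_wpM2l ?(ltW gz)//.
by rewrite -natrX ler_nat ltnW// ltn_expl.
Qed.

Lemma holomorphic_atP g z : holomorphic_at g z <->
  exists2 e : R, 0 < e & forall w, modulus (w - z) < e -> derivable (g : C -> C) w 1.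
Proof. exact: nearC. Qed.

Lemma holomorphic_holoo g z : holomorphic_at g z <->
  exists2 e : R, 0 < e & holoo e (fun w => g (w + z)).
Proof.
split=> /= [/holomorphic_atP[e e0 he]|[e e0 he]].
  exists e => // w we; have /derivableC[d hd] : derivable (g : C -> C) (w + z) 1.
    by apply: he; rewrite addrK.
  rewrite -[w + z]/(w + z) -{1}[w]mul1r in hd; have [h1 _] := is_derive_affineC hd.
  by under eq_fun do rewrite -[X in X + z]mul1r; exact: h1.
apply/holomorphic_atP; exists e => // w we; have /derivableC[d hd] := he _ we.
have -> : (g : C -> C) = (fun x => g (1 * x + - z + z)).
  by apply/funext => x; rewrite mul1r subrK.
rewrite -[w - z]/(w + - z) -{1}[w]mul1r in hd.
by have [] := is_derive_affineC hd.
Qed.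

Lemma holomorphic_derivable g z : holomorphic_at g z -> derivable (g : C -> C) z 1.
Proof. by move=> /holomorphic_atP[e e0]; apply; rewrite subrr modulus0. Qed.

Lemma holomorphic_continuous g z : holomorphic_at g z -> {for (z : C), continuous (g : C -> C)}.
Proof. by move=> /holomorphic_derivable/derivable_continuousC. Qed.

Lemma holomorphicM g h z : holomorphic_at g z -> holomorphic_at h z ->
  holomorphic_at (fun w => g w * h w) z.
Proof.
apply: nearS2C => w hg hh.
exact: (@derivableM _ _ (g : C -> R[i]) (h : C -> R[i]) _ _ hg hh).
Qed.

Lemma holomorphicD g h z : holomorphic_at g z -> holomorphic_at h z ->
  holomorphic_at (fun w => g w + h w) z.
Proof.
apply: nearS2C => w hg hh.
exact: (@derivableD _ _ _ (g : C -> C) (h : C -> C) _ _ hg hh).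
Qed.

Lemma holomorphic_cst (c : R[i]) z : holomorphic_at (fun=> c) z.
Proof. by apply/holomorphic_atP; exists 1 => // w _; exact: derivable_cst. Qed.

Lemma holomorphic_id z : holomorphic_at id z.
Proof. by apply/holomorphic_atP; exists 1 => // w _; exact: derivable_id. Qed.

Lemma holomorphicV g z : g z != 0 -> holomorphic_at g z -> holomorphic_at (fun w => (g w)^-1) z.
Proof.
move=> gz hg; have gz0 : 0 < modulus (g z) by rewrite modulus_gt0.
have [del del0 hd] := (continuousC g z).1 (holomorphic_continuous hg) _ gz0.
have /holomorphic_atP[e e0 he] := hg.
apply/holomorphic_atP; exists (Num.min e del); first by rewrite lt_min e0.
move=> w; rewrite lt_min => /andP[we wd].
apply: (@derivableV _ _ (g : C -> R[i])); last exact: he.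
apply/eqP => gw; have := hd w wd; by rewrite gw sub0r modulusN ltxx.
Qed.

Lemma holomorphic_affine g (c b : R[i]) z : holomorphic_at g (c * z + b) ->
  holomorphic_at (fun w => g (c * w + b)) z.
Proof.
move=> /holomorphic_atP[e e0 he]; have B0 : 0 < modulus c + 1 by rewrite ltr_wpDl ?modulus_ge0.
apply/holomorphic_atP; exists (e / (modulus c + 1)); first by rewrite divr_gt0.
move=> w we; have /derivableC[d hd] : derivable (g : C -> C) (c * w + b) 1.
  apply: he; have -> : c * w + b - (c * z + b) = c * (w - z) by ring.
  rewrite modulusM; apply: (@le_lt_trans _ _ ((modulus c + 1) * modulus (w - z))).
    by rewrite ler_wpM2r ?modulus_ge0// lerDl.
  by rewrite mulrC -ltr_pdivlMr.
by have [] := is_derive_affineC hd.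
Qed.

Lemma near_dnbhs_eq g h z : {for (z : C), continuous (g : C -> C)} ->
  {for (z : C), continuous (h : C -> C)} -> (\forall w \near (z : C)^', g w = h w) -> g z = h z.
Proof.
move=> /continuousC cg /continuousC ch /near_dnbhsC[e e0 he].
apply/eqP; rewrite -subr_eq0 -modulus_eq0 eq_le modulus_ge0 andbT.
apply/ler_addgt0Pl => x x0; rewrite addr0.
have x2 : 0 < x / 2 by rewrite divr_gt0.
have [d1 d10 h1] := cg _ x2; have [d2 d20 h2] := ch _ x2.
pose d := Num.min e (Num.min d1 d2) / 2.
have d0 : 0 < d by rewrite divr_gt0// !lt_min e0 d10.
have dlt : d < Num.min e (Num.min d1 d2) by rewrite /d; move: d0; rewrite /d; move: (Num.min _ _) => y; lra.
move: dlt; rewrite !lt_min => /and3P[de dd1 dd2].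
have md : modulus (z + d%:C - z) = d by rewrite addrC addKr modulus_real ger0_norm// ltW.
have E : g (z + d%:C) = h (z + d%:C).
  apply: he; last by rewrite md.
  by rewrite -subr_eq0 -modulus_eq0 md gt_eqF.
have -> : g z - h z = (h (z + d%:C) - h z) - (g (z + d%:C) - g z) by rewrite E; ring.
apply: (le_trans (modulusB _ _)); rewrite [x]splitr lerD// ltW//.
  by apply: h2; rewrite md.
by apply: h1; rewrite md.
Qed.

Lemma holomorphic_near g z : holomorphic_at g z -> \forall w \near (z : C), holomorphic_at g w.
Proof.
move=> /holomorphic_atP[e e0 he]; apply/nearC; exists e => // w we.
apply/holomorphic_atP; exists (e - modulus (w - z)); first by rewrite subr_gt0.
move=> x xw; apply: he; have -> : x - z = (x - w) + (w - z) by ring.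
by apply: le_lt_trans (modulusD _ _) _; rewrite -ltrBrDr.
Qed.

Lemma holomorphicX g z n : holomorphic_at g z -> holomorphic_at (fun w => g w ^+ n) z.
Proof.
move=> hg; elim: n => [|n IH]; first exact: holomorphic_cst.
have -> : (fun w => g w ^+ n.+1) = (fun w => g w * g w ^+ n).
  by apply/funext => w; rewrite exprS.
exact: holomorphicM.
Qed.

(* [order_ge g z m]: the germ of g at z has order at least m, or vanishes. *)
Definition order_ge g z (m : int) :=
  exists2 h, holomorphic_at h z & \forall w \near (z : C)^', g w = (w - z) ^ m * h w.

Definition vanishes_near g z := \forall w \near (z : C)^', g w = 0.

Lemma has_order_ge g z m : has_order g z m -> order_ge g z m.
Proof. by case=> h [h1 h2 h3]; exists h. Qed.

Lemma holomorphic_order g z : holomorphic_at g z ->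
  (exists m : nat, has_order g z m) \/ (\forall w \near (z : C), g w = 0).
Proof.
move=> /holomorphic_holoo[e e0 he].
have [[m [k [hk k0 kE]]]|zero] := zero_orderP e0 he; last first.
  right; apply/nearC; exists (e / 4); first by rewrite divr_gt0.
  by move=> w we; rewrite -(zero _ we) subrK.
left; exists m, (fun w => k (w - z)); split.
- apply/holomorphic_holoo; exists e; first exact: e0.
  have kE' : (fun w => k (w + z - z)) = k by apply/funext => w; rewrite addrK.
  by rewrite /= kE'.
- by rewrite subrr.
apply/near_dnbhsC; exists e => // w _ we.
by rewrite -[in LHS](subrK z w) kE.
Qed.

Lemma order_ge_dichotomy g z n : order_ge g z n ->
  (exists2 m : int, n <= m & has_order g z m) \/ vanishes_near g z.
Proof.
move=> [h hh gE]; have [[m [k [hk k0 kE]]]|zero] := holomorphic_order hh; last first.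
  right; apply: near_dnbhsS2C gE (near_dnbhs_weakC zero) => w _ -> ->.
  by rewrite mulr0.
left; exists (n + m%:Z); first by rewrite lerDl.
exists k; split=> //; apply: near_dnbhsS2C gE kE => w wz -> ->.
by rewrite mulrA -expfzDr// subr_eq0.
Qed.

(** Otherwise a positive power of [w - z] divides the unit [h], and continuity gives [h z = 0].
    Uniqueness of the order follows. *)
Lemma has_order_le g z m n : has_order g z m -> order_ge g z n -> n <= m.
Proof.
move=> [h [hh h0 hE]] [k hk kE]; rewrite leNgt; apply/negP => mn.
have [d dE] : exists d : nat, n - m = d.+1%:Z.
  by exists (absz (n - m - 1)%R); move: mn; clear; lia.
have e1 : \forall w \near (z : C)^', h w = (w - z) ^+ d.+1 * k w.
  apply: near_dnbhsS2C hE kE => w wz E1 E2.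
  have wz0 : w - z != 0 by rewrite subr_eq0.
  apply: (mulfI (expfz_neq0 m wz0)); rewrite -E1 E2 mulrA; congr (_ * _).
  by rewrite -[_ ^+ d.+1]/(_ ^ d.+1%:Z) -expfzDr// -dE [m + _]addrC subrK.
have hp : holomorphic_at (fun w => (w - z) ^+ d.+1 * k w) z.
  have h1 : holomorphic_at (fun w => w - z) z.
    exact: (holomorphicD (holomorphic_id z) (holomorphic_cst (- z) z)).
  exact: (holomorphicM (holomorphicX d.+1 h1) hk).
have c1 := holomorphic_continuous hh; have c2 := holomorphic_continuous hp.
have : h z = (z - z) ^+ d.+1 * k z.
  exact: near_dnbhs_eq c1 c2 e1.
by rewrite subrr expr0n/= mul0r => /eqP; rewrite (negbTE h0).
Qed.

Lemma order_atE g z m : has_order g z m -> order_at g z = m.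
Proof.
move=> hm; rewrite /order_at; case: xgetP => [n _ hn|/(_ m)] //.
apply/eqP; rewrite eq_le (has_order_le hn (has_order_ge hm)).
by rewrite (has_order_le hm (has_order_ge hn)).
Qed.

End Orders.

Section Germs.
Context {R : realType}.
Local Notation C := (R[i]^o).
Implicit Types (g h k : R[i] -> R[i]) (a s z w : R[i]) (m n : int).

(** Stronger than having order 0, since the value at [z] counts: where poles cancel in a difference,
    the point can have order 0 and still be irregular. *)
Definition regular_at g z := holomorphic_at g z /\ g z != 0.

Lemma regular_order g z : regular_at g z -> has_order g z 0.
Proof.
move=> [hg g0]; exists g; split=> //.
by apply/near_dnbhsC; exists 1 => // w _ _; rewrite expr0z mul1r.
Qed.

Lemma holomorphic_nearE g h z (e : R) : 0 < e -> (forall w, modulus (w - z) < e -> g w = h w) ->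
  holomorphic_at g z -> holomorphic_at h z.
Proof.
move=> e0 gh /holomorphic_atP[d d0 hd]; apply/holomorphic_atP.
exists (Num.min d e / 2); first by rewrite divr_gt0// lt_min d0.
move=> w wd; have m0 : 0 < Num.min d e / 2 by rewrite divr_gt0// lt_min d0.
have [md me] : Num.min d e <= d /\ Num.min d e <= e by rewrite !ge_min !lexx orbT.
apply: (derivable_nearC (g1 := g) m0) => [x xw|]; last by apply: hd; lra.
apply: gh; have -> : x - z = (x - w) + (w - z) by ring.
apply: le_lt_trans (modulusD _ _) _; lra.
Qed.

Lemma holomorphic_exprz z w m : w != z -> holomorphic_at (fun x => (x - z) ^ m) w.
Proof.
move=> wz; have wz0 : w - z != 0 by rewrite subr_eq0.
have h1 : holomorphic_at (fun x => x - z) w.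
  exact: (holomorphicD (holomorphic_id w) (holomorphic_cst (- z) w)).
case: m => n; first exact: (holomorphicX n h1).
rewrite NegzE.
have -> : (fun x => (x - z) ^ (- n.+1%:Z)) = (fun x => ((x - z) ^+ n.+1)^-1).
  by apply/funext => x; rewrite exprnN.
apply: (@holomorphicV _ (fun x => (x - z) ^+ n.+1)); first by rewrite expf_neq0.
exact: (holomorphicX n.+1 h1).
Qed.

Lemma regularM g h z : regular_at g z -> regular_at h z -> regular_at (fun w => g w * h w) z.
Proof.
by move=> [hg g0] [hh h0]; split; [exact: holomorphicM|rewrite mulf_neq0].
Qed.

Lemma regular_exprz z w m : w != z -> regular_at (fun x => (x - z) ^ m) w.
Proof.
move=> wz; split; first exact: holomorphic_exprz.
by rewrite expfz_neq0// subr_eq0.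
Qed.

Lemma regular_nearE g h z (e : R) : 0 < e -> (forall w, modulus (w - z) < e -> g w = h w) ->
  regular_at g z -> regular_at h z.
Proof.
move=> e0 gh [hg g0]; split; first exact: holomorphic_nearE e0 gh hg.
by rewrite -gh// subrr modulus0.
Qed.

Lemma regular_near g z : regular_at g z -> exists2 e : R, 0 < e &
  forall w, modulus (w - z) < e -> regular_at g w.
Proof.
move=> [hg g0]; have /nearC[e e0 he] := holomorphic_near hg.
have gz0 : 0 < modulus (g z) by rewrite modulus_gt0.
have [del del0 hd] := (continuousC g z).1 (holomorphic_continuous hg) _ gz0.
exists (Num.min e del); first by rewrite lt_min e0.
move=> w; rewrite lt_min => /andP[we wd]; split; first exact: he.
by apply/eqP => gw; have := hd w wd; rewrite gw sub0r modulusN ltxx.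
Qed.

Lemma has_order_isolated g z m : has_order g z m -> exists2 e : R, 0 < e &
  forall w, w != z -> modulus (w - z) < e -> regular_at g w.
Proof.
move=> [h [hh h0 /near_dnbhsC[e e0 he]]].
have [d d0 hd] := regular_near (conj hh h0).
exists (Num.min e d); first by rewrite lt_min e0.
move=> w wz; rewrite lt_min => /andP[we wd].
have x0 : 0 < Num.min (modulus (w - z)) (e - modulus (w - z)).
  by rewrite lt_min modulus_gt0 subr_eq0 wz subr_gt0.
apply: (regular_nearE (g := fun x => (x - z) ^ m * h x) x0) => [x|].
  rewrite lt_min => /andP[x1 x2]; rewrite he//.
    by apply: contraTneq x1 => ->; rewrite modulusC ltxx.
  have -> : x - z = (x - w) + (w - z) by ring.
  by apply: le_lt_trans (modulusD _ _) _; rewrite -ltrBrDr.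
exact: regularM (regular_exprz m wz) (hd w wd).
Qed.

Lemma order_not_vanishing g z m : has_order g z m -> ~ vanishes_near g z.
Proof.
move=> hm vn; suff : m + 1 <= m by lia.
apply: (has_order_le hm); exists (fun=> 0); first exact: holomorphic_cst.
by apply: (near_dnbhsS2C _ vn vn) => w _ -> _; rewrite mulr0.
Qed.

Lemma vanishing_spread g z : vanishes_near g z -> exists2 e : R, 0 < e &
  forall w, modulus (w - z) < e -> vanishes_near g w.
Proof.
move=> vz; have /near_dnbhsC[e e0 he] := vz; exists e => // w we.
have [->//|wz] := eqVneq w z.
have x0 : 0 < Num.min (modulus (w - z)) (e - modulus (w - z)).
  by rewrite lt_min modulus_gt0 subr_eq0 wz subr_gt0.
apply/near_dnbhsC; exists (Num.min (modulus (w - z)) (e - modulus (w - z))) => // x _.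
rewrite lt_min => /andP[x1 x2]; apply: he.
  by apply: contraTneq x1 => ->; rewrite modulusC ltxx.
have -> : x - z = (x - w) + (w - z) by ring.
by apply: le_lt_trans (modulusD _ _) _; rewrite -ltrBrDr.
Qed.

Definition rect (I J : R * R) : set R[i] :=
  [set z | I.1 <= Re z <= I.2 /\ J.1 <= Im z <= J.2].

Lemma rect_halves (I J : R * R) z : rect I J z -> exists b c, rect (half b I) (half c J) z.
Proof.
move=> [/andP[a1 a2] /andP[b1 b2]]; exists (Re z <= (I.1 + I.2) / 2), (Im z <= (J.1 + J.2) / 2).
by case: leP => h1; case: leP => h2; split=> /=; apply/andP; split => //; exact: ltW.
Qed.

(** Compactness as an induction principle. It gives the finiteness of the irregular points in a
    disc, and replaces connectedness in the identity principle. *)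
Lemma cousin_rect (P : set R[i] -> Prop) (I J : R * R) : I.1 < I.2 -> J.1 < J.2 ->
  (forall I J, I.1 < I.2 -> J.1 < J.2 ->
     (forall b c, P (rect (half b I) (half c J))) -> P (rect I J)) ->
  (forall z, exists2 e : R, 0 < e & forall A : set R[i], A z ->
     (forall w, A w -> modulus (w - z) < e) -> P A) ->
  P (rect I J).
Proof.
move=> lI lJ split_P loc_P; apply: (@cousin R (fun I J => P (rect I J)) I J lI lJ split_P).
move=> x y hx hy; have [e e0 he] := loc_P (x +i* y).
exists (e / 2) => [|I' J' lI' lJ' _ _ _ _ xI yJ dI dJ _]; first by rewrite divr_gt0.
apply: he => [|w [wI wJ]]; first by split.
apply: le_lt_trans (modulus_le_ReIm _) _; rewrite !raddfB/= [e]splitr.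
by apply: ltrD; [apply: le_lt_trans dI|apply: le_lt_trans dJ]; exact: dist_itv.
Qed.

Lemma in_big_rect (r : R) z : modulus z <= r -> rect (- (r + 1), r + 1) (- (r + 1), r + 1) z.
Proof.
move=> zr; have := le_trans (Re_le_modulus z) zr; have := le_trans (Im_le_modulus z) zr.
by rewrite !ler_norml => /andP[? ?] /andP[? ?]; split; apply/andP; split=> /=; lra.
Qed.

Lemma finite_irregular g (r : R) : (forall z, exists m, has_order g z m) ->
  finite_set [set z | modulus z <= r /\ ~ regular_at g z].
Proof.
move=> hg; have [r0|r0] := leP 0 r; last first.
  rewrite (_ : [set _ | _] = set0); first exact: finite_set0.
  apply/seteqP; split => // z [zr _]; exfalso.
  by have := le_lt_trans zr r0; rewrite ltNge modulus_ge0.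
pose B := [set z | ~ regular_at g z].
suff : finite_set (rect (- (r + 1), r + 1) (- (r + 1), r + 1) `&` B).
  apply: sub_finite_set => z [zr bz]; split=> //; exact: in_big_rect.
apply: (@cousin_rect (fun A => finite_set (A `&` B))) => /= [|||z]; [lra|lra| |].
- move=> I J _ _ h.
  have h4 : finite_set ((rect (half true I) (half true J) `&` B) `|` (rect (half true I) (half false J) `&` B)
     `|` (rect (half false I) (half true J) `&` B) `|` (rect (half false I) (half false J) `&` B)).
    by rewrite !finite_setU; do !split; exact: h.
  apply: sub_finite_set h4 => z [/rect_halves[b [c hbc]] bz].
  by case: b c hbc => [] []; [left; left; left|left; left; right|left; right|right].
- have [m /has_order_isolated[e e0 he]] := hg z; exists e => // A Az hA.
  apply: (@sub_finite_set _ _ [set z]); last exact: finite_set1.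
  move=> w [Aw nw]; apply: contrapT => wz; apply: nw; apply: he; last exact: hA.
  exact/eqP.
Qed.

Definition mero g := forall z, exists n, order_ge g z n.

(** Both alternatives hold locally. The four quarters of a rectangle share its centre, which forces
    the same alternative on all of them. *)
Lemma identity_principle g : mero g ->
  (forall z, exists m, has_order g z m) \/ (forall z, vanishes_near g z).
Proof.
move=> hg.
pose A := [set z | exists m, has_order g z m]; pose B := [set z | vanishes_near g z].
have disj z : A z -> B z -> False by move=> [m hm]; exact: order_not_vanishing hm.
have cov z : A z \/ B z.
  by have [n /order_ge_dichotomy[[m _ hm]|]] := hg z; [left; exists m|right].
have main (r : R) : 0 <= r -> let X := rect (- (r + 1), r + 1) (- (r + 1), r + 1) in X `<=` A \/ X `<=` B.
  move=> r0; apply: (@cousin_rect (fun X => X `<=` A \/ X `<=` B)) => /= [|||z]; [lra|lra| |].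
  - move=> I J lI lJ h.
    pose c := ((I.1 + I.2) / 2) +i* ((J.1 + J.2) / 2) : R[i].
    have cin b d : rect (half b I) (half d J) c.
      by case: b; case: d; split; apply/andP; split => /=; lra.
    case: (cov c) => hc; [left|right] => z /rect_halves[b [d hz]].
      by have [/(_ z hz)//|/(_ c (cin b d)) /disj] := h b d; case.
    by have [/(_ c (cin b d)) /disj|/(_ z hz)//] := h b d; case.
  - case: (cov z) => [[m hm]|/vanishing_spread[e e0 he]]; last first.
      by exists e => // X Xz hX; right => w /hX; exact: he.
    have [e e0 he] := has_order_isolated hm; exists e => // X Xz hX; left => w /hX hw.
    have [->|wz] := eqVneq w z; first by exists m.
    by exists 0; apply: regular_order; exact: he.
case: (cov 0) => h0; [left|right] => z.
  have [] := main (modulus z) (modulus_ge0 z).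
    by apply; exact: in_big_rect.
  move=> /(_ 0) hB; exfalso; apply: (disj 0 h0); apply: hB; apply: in_big_rect.
  by rewrite modulus0 modulus_ge0.
have [/(_ 0) hA|] := main (modulus z) (modulus_ge0 z).
  exfalso; apply: (disj 0 _ h0); apply: hA; apply: in_big_rect.
  by rewrite modulus0 modulus_ge0.
by apply; exact: in_big_rect.
Qed.

Lemma has_orderM_regular g h z m : has_order g z m -> regular_at h z -> has_order (fun w => g w * h w) z m.
Proof.
move=> [k [hk k0 kE]] [hh h0]; exists (fun w => k w * h w); split; first exact: (holomorphicM hk hh).
  by rewrite mulf_neq0.
have := kE; apply: (near_dnbhsS2C _ kE) => w _ E _.
by rewrite E mulrA.
Qed.

Lemma has_order_nearE g h z m (e : R) : 0 < e -> (forall w, w != z -> modulus (w - z) < e -> g w = h w) ->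
  has_order g z m -> has_order h z m.
Proof.
move=> e0 gh [k [hk k0 kE]]; exists k; split=> //.
have gh' : \forall w \near (z : C)^', g w = h w by apply/near_dnbhsC; exists e.
by apply: near_dnbhsS2C gh' kE => w _ <-.
Qed.

(** The points of [S] are removed one by one: multiplying by [(z - s) ^ (- m)] and filling in the
    value at [s] makes [s] regular and leaves the orders at the other points unchanged. *)
Lemma factorization (r : R) (S : seq R[i]) g : uniq S ->
  (forall z, modulus z <= r -> z \notin S -> regular_at g z) ->
  (forall s, s \in S -> exists m, has_order g s m) ->
  exists2 h, (forall z, modulus z <= r -> regular_at h z) &
    forall z, z \notin S -> g z = (\prod_(s <- S) (z - s) ^ order_at g s) * h z.
Proof.
elim: S g => [|s S IH] g /=.
  by move=> _ hr _; exists g => [z zr|z _]; [exact: hr|rewrite big_nil mul1r].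
move=> /andP[sS uS] hr ho.
have [m hm] := ho s (mem_head _ _).
have [k [hk k0 kE]] := hm.
pose g1 z := if z == s then k s else g z * (z - s) ^ (- m).
have g1E z : z != s -> g1 z = g z * (z - s) ^ (- m) by rewrite /g1 => /negbTE ->.
have reg_away z : z != s -> regular_at g z -> regular_at g1 z.
  move=> zs rz; have d0 : 0 < modulus (z - s) by rewrite modulus_gt0 subr_eq0.
  apply: (regular_nearE (g := fun w => g w * (w - s) ^ (- m)) d0) => [w ws|].
    rewrite g1E//; apply: contraTneq ws => ->; by rewrite modulusC ltxx.
  exact: (regularM rz (regular_exprz (- m) zs)).
have reg_s : regular_at g1 s.
  have /near_dnbhsC[e e0 he] := kE.
  apply: (regular_nearE (g := k) e0) => [w ws|]; last by split.
  rewrite /g1; case: eqVneq => [->//|ws0]; rewrite he//.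
  have ws1 : w - s != 0 by rewrite subr_eq0.
  by rewrite mulrAC -expfzDr// addrN expr0z mul1r.
have ord_away z n : z != s -> has_order g z n -> has_order g1 z n.
  move=> zs hn; have d0 : 0 < modulus (z - s) by rewrite modulus_gt0 subr_eq0.
  apply: (has_order_nearE (g := fun w => g w * (w - s) ^ (- m)) d0) => [w _ ws|].
    rewrite g1E//; apply: contraTneq ws => ->; by rewrite modulusC ltxx.
  exact: (has_orderM_regular hn (regular_exprz (- m) zs)).
have [z zr zS|z zS|h hh hE] := IH g1 uS.
- have [->|zs] := eqVneq z s; first exact: reg_s.
  by apply: (reg_away _ zs); apply: (hr _ zr); rewrite inE negb_or zs.
- have zs : z != s by apply: contraNneq sS => <-.
  by have [n hn] := ho z (ltac:(by rewrite inE zS orbT)); exists n; exact: (ord_away _ _ zs hn).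
exists h; first exact: hh.
move=> z; rewrite inE negb_or => /andP[zs zS].
have zs0 : z - s != 0 by rewrite subr_eq0.
have -> : g z = (z - s) ^ m * g1 z by rewrite g1E// mulrCA -expfzDr// addrN expr0z mulr1.
rewrite big_cons (order_atE hm) -mulrA (hE _ zS); congr (_ * (_ * _)).
apply: eq_big_seq => x xS; have xs : x != s by apply: contraNneq sS => <-.
have [n hn] := ho x (ltac:(by rewrite inE xS orbT)).
by rewrite (order_atE hn) (order_atE (ord_away x n xs hn)).
Qed.

End Germs.

(** * Integrated counting functions *)

Section Counting.
Context {R : realType}.
Local Notation C := (R[i]^o).
Local Notation mu := (@lebesgue_measure R).
Implicit Types (m : R[i] -> R) (z s : R[i]) (r : R).

Lemma finite_uniq_seq (T : choiceType) (A : set T) : finite_set A ->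
  exists2 S : seq T, uniq S & forall x : T, x \in S <-> A x.
Proof.
move=> /finite_seqP[S ->]; exists (undup S); first exact: undup_uniq.
by move=> z; rewrite mem_undup.
Qed.

Definition locfin m := forall r, finite_set [set z | modulus z <= r /\ m z != 0].

(** The contribution of [s] to the integrated counting function, 0 outside the disc. Written with
    [lnmax], which is what the mean of [ln |z - s|] produces in Jensen's formula. *)
Definition wt r s : R := lnmax r s - ln (modulus s).

(* Since [ln 0 = 0], the point 0 gets the weight [ln r]. *)
Definition NN m r : R := \sum_(z \in [set z : R[i] | modulus z < r]) (m z * (ln r - ln (modulus z))).

Definition NC m r : R := \sum_(z \in [set z : R[i] | modulus z < r]) m z.

(** The list may exceed the support of [m], so that one list serves several functions. *)
Definition covers (S : seq R[i]) m r := forall z, modulus z < r -> m z != 0 -> z \in S.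

Lemma locfin_cover m r : locfin m -> exists2 S, uniq S & covers S m r.
Proof.
move=> hm; have [S uS hS] := finite_uniq_seq (hm r).
by exists S => // z zr mz; apply/hS; split=> //; exact: ltW.
Qed.

Lemma NC_seq m r S : uniq S -> covers S m r ->
  NC m r = \sum_(s <- S) (if modulus s < r then m s else 0).
Proof.
move=> uS hS; rewrite -big_mkcond/= (@bigfs _ _ _ _ _ (fun z => modulus z < r))//.
by move=> z zr zS; apply/eqP; apply: contraNT zS; exact: hS.
Qed.

Lemma NN_seq m r S : uniq S -> covers S m r -> NN m r = \sum_(s <- S) m s * wt r s.
Proof.
move=> uS hS; transitivity (\sum_(s <- S | modulus s < r) (m s * (ln r - ln (modulus s)))).
  rewrite (@bigfs _ _ _ _ _ (fun z => modulus z < r))// => z zr zS.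
  suff -> : m z = 0 by rewrite mul0r.
  by apply/eqP; apply: contraNT zS; exact: hS.
rewrite big_mkcond; apply: eq_bigr => s _; rewrite /wt /lnmax.
by case: ifP => // _; rewrite subrr mulr0.
Qed.

Lemma wt_ge0 r s : 1 <= r -> 0 <= wt r s.
Proof.
move=> r1; rewrite /wt /lnmax; case: ifP => [sr|_]; last by rewrite subrr.
rewrite subr_ge0; have := modulus_ge0 s; rewrite le_eqVlt => /predU1P[<-|s0].
  by rewrite ln0// ln_ge0.
by rewrite ler_ln ?posrE ?ltW// (lt_trans s0).
Qed.

Lemma locfin_le m1 m2 : (forall z, m1 z != 0 -> m2 z != 0) -> locfin m2 -> locfin m1.
Proof. by move=> h hm r; apply: sub_finite_set (hm r) => z [zr mz]; split=> //; exact: h. Qed.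

Lemma locfinD m1 m2 : locfin m1 -> locfin m2 -> locfin (fun z => m1 z + m2 z).
Proof.
move=> h1 h2 r; apply: (@sub_finite_set _ _ ([set z | modulus z <= r /\ m1 z != 0] `|`
    [set z | modulus z <= r /\ m2 z != 0])); last by rewrite finite_setU; split; [exact: h1|exact: h2].
move=> z [zr mz]; have [m10|m10] := eqVneq (m1 z) 0; last by left.
by right; split=> //; move: mz; rewrite m10 add0r.
Qed.

Lemma locfin_cover2 m1 m2 r : locfin m1 -> locfin m2 ->
  exists S, [/\ uniq S, covers S m1 r & covers S m2 r].
Proof.
move=> h1 h2.
have [S1 u1 c1] := locfin_cover r h1; have [S2 u2 c2] := locfin_cover r h2.
exists (undup (S1 ++ S2)); split; first exact: undup_uniq.
  by move=> z zr mz; rewrite mem_undup mem_cat c1.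
by move=> z zr mz; rewrite mem_undup mem_cat c2 ?orbT.
Qed.

Lemma NN_D m1 m2 r : locfin m1 -> locfin m2 -> NN (fun z => m1 z + m2 z) r = NN m1 r + NN m2 r.
Proof.
move=> h1 h2; have [S [uS c1 c2]] := locfin_cover2 r h1 h2.
rewrite (NN_seq uS c1) (NN_seq uS c2) (@NN_seq _ _ S uS).
  by rewrite -big_split/=; apply: eq_bigr => s _; rewrite mulrDl.
move=> z zr mz; have [m10|m10] := eqVneq (m1 z) 0; last exact: c1.
by apply: c2 => //; move: mz; rewrite m10 add0r.
Qed.

Lemma NN_Z k m r : locfin m -> NN (fun z => k * m z) r = k * NN m r.
Proof.
move=> h1; have [S uS c1] := locfin_cover r h1.
rewrite (NN_seq uS c1) (@NN_seq _ _ S uS).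
  by rewrite mulr_sumr; apply: eq_bigr => s _; rewrite mulrA.
by move=> z zr mz; apply: c1 => //; apply: contraNneq mz => ->; rewrite mulr0.
Qed.

Lemma NN_le m1 m2 r : 1 <= r -> locfin m1 -> locfin m2 -> (forall z, m1 z <= m2 z) ->
  NN m1 r <= NN m2 r.
Proof.
move=> r1 h1 h2 h; have [S [uS c1 c2]] := locfin_cover2 r h1 h2.
rewrite (NN_seq uS c1) (NN_seq uS c2); apply: ler_sum => s _.
by rewrite ler_wpM2r// wt_ge0.
Qed.

Lemma NN_ge0 m r : 1 <= r -> locfin m -> (forall z, 0 <= m z) -> 0 <= NN m r.
Proof.
move=> r1 h1 h; have [S uS c1] := locfin_cover r h1.
by rewrite (NN_seq uS c1) sumr_ge0// => s _; rewrite mulr_ge0// wt_ge0.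
Qed.

Lemma NN_sum (T : eqType) (a : seq T) (F : T -> R[i] -> R) r : (forall x, x \in a -> locfin (F x)) ->
  locfin (fun z => \sum_(x <- a) F x z) /\
  NN (fun z => \sum_(x <- a) F x z) r = \sum_(x <- a) NN (F x) r.
Proof.
elim: a => [|x a IH] h.
  have E : (fun z => \sum_(x <- [::]) F x z) = (fun=> 0 : R) by apply/funext => z; rewrite big_nil.
  rewrite E big_nil; split.
    by move=> u; apply: (@sub_finite_set _ _ set0) => // z [_]; rewrite eqxx.
  by rewrite /NN fsbig1// => z _; rewrite mul0r.
have [l1 E1] := IH (fun y ya => h y (ltac:(by rewrite inE ya orbT))).
have E : (fun z => \sum_(y <- x :: a) F y z) = (fun z => F x z + \sum_(y <- a) F y z).
  by apply/funext => z; rewrite big_cons.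
have lx : locfin (F x) by apply: h; rewrite mem_head.
by rewrite E big_cons -E1 NN_D//; split=> //; exact: locfinD.
Qed.

Lemma integral_inv (u r : R) : 0 < u -> u < r ->
  mu.-integrable `]0, r[ (EFin \o (fun t => if u < t then t^-1 else 0)) /\
  \int[mu]_(t in `]0, r[) (if u < t then t^-1 else 0) = ln r - ln u.
Proof.
move=> u0 ur.
have ci : rcont u r (fun t => t^-1).
  move=> t /andP[ut _]; apply: (@cvgV _ _ _ _ (fun x : R => x)); last exact: cvg_id.
  by rewrite gt_eqF// (lt_le_trans u0).
have ii := rint_integrable ci.
have ii1 : mu.-integrable `]u, r[ (EFin \o (fun t : R => t^-1)).
  apply: (integrableS _ _ _ ii) => //.
  by apply: subset_itv; rewrite bnd_simp.
have E : `]0, r[%classic `&` `]u, +oo[%classic = `]u, r[%classic :> set R.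
  apply/seteqP; split=> t /=; rewrite !in_itv/= ?andbT.
    by move=> [/andP[_ ->] ->].
  by move=> /andP[ut ->]; rewrite ut (lt_trans u0 ut).
have P t : (if u < t then t^-1 else 0) = patch (fun=> 0) `]u, +oo[%classic (fun t : R => t^-1) t.
  by rewrite /patch mem_setE in_itv/= andbT.
have eqf : (fun t => if u < t then t^-1 else 0) = patch (fun=> 0) `]u, +oo[%classic (fun t : R => t^-1).
  by apply/funext => t; exact: P.
rewrite eqf; split.
  rewrite -restrict_EFin; apply/integrable_restrict => //.
  by rewrite E.
rewrite -Rintegral_mkcondr E.
rewrite Rintegral_itv_bndo_bndc//.
have ii2 : mu.-integrable `]u, r] (EFin \o (fun t : R => t^-1)).
  apply: (integrableS _ _ _ ii) => //.
  by apply: subset_itv; rewrite bnd_simp.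
rewrite Rintegral_itv_obnd_cbnd//; apply: (rint_FTC (ltW ur) ci) => t /andP[ut _].
by apply: is_derive1_ln; exact: lt_le_trans ut.
Qed.

(** The point 0 is excluded because [t^-1] is not integrable at 0; [integrated_count] treats it by
    the separate term [n0 * ln r]. *)
Lemma integral_step_sum (S : seq R[i]) (c : R[i] -> R) r : 0 < r -> (forall s, s \in S -> s != 0) ->
  mu.-integrable `]0, r[ (EFin \o (fun t => \sum_(s <- S) c s * (if modulus s < t then t^-1 else 0))) /\
  \int[mu]_(t in `]0, r[) (\sum_(s <- S) c s * (if modulus s < t then t^-1 else 0)) =
  \sum_(s <- S) c s * wt r s.
Proof.
move=> r0; elim: S => [|s S IH] h.
  have E : (fun t => \sum_(s <- [::]) c s * (if modulus s < t then t^-1 else 0)) = (fun=> 0 : R).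
    by apply/funext => t; rewrite big_nil.
  rewrite E big_nil; split; last by rewrite Rintegral_cst// mul0r.
  exact: integrable0.
have [i1 E1] := IH (fun y ya => h y (ltac:(by rewrite inE ya orbT))).
have s0 : 0 < modulus s by rewrite modulus_gt0 h// mem_head.
have E : (fun t => \sum_(s <- s :: S) c s * (if modulus s < t then t^-1 else 0)) =
    (fun t => c s * (if modulus s < t then t^-1 else 0) + \sum_(s <- S) c s * (if modulus s < t then t^-1 else 0)).
  by apply/funext => t; rewrite big_cons.
have [i2 E2] : mu.-integrable `]0, r[ (EFin \o (fun t => if modulus s < t then t^-1 else 0)) /\
   \int[mu]_(t in `]0, r[) (if modulus s < t then t^-1 else 0) = wt r s.
  rewrite /wt /lnmax; have [sr|sr] := ltP (modulus s) r; first exact: integral_inv.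
  have Z : {in `]0, r[%classic, (fun t => if modulus s < t then t^-1 else 0) =1 (fun=> 0 : R)}.
    move=> t; rewrite inE/= in_itv/= => /andP[_ tr].
    by rewrite ltNge (le_trans (ltW tr) sr).
  have -> : \int[mu]_(t in `]0, r[) (if modulus s < t then t^-1 else 0) = \int[mu]_(t in `]0, r[) 0.
    by apply: eq_Rintegral; exact: Z.
  split; last by rewrite Rintegral_cst// mul0r subrr.
  apply: (@eq_integrable _ _ _ _ _ _ (EFin \o (fun=> 0 : R))) => //; last exact: integrable0.
  by move=> t tr /=; rewrite Z.
have i3 : mu.-integrable `]0, r[ (EFin \o (fun t => c s * (if modulus s < t then t^-1 else 0))).
  by apply: (@integrableZl _ _ _ _ _ _ (c s)) i2.
rewrite E big_cons; split.
  exact: (integrableD _ i3 i1).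
by rewrite RintegralD// RintegralZl// E2 E1.
Qed.

(** Exchange of sum and integral: a point [s != 0] of the disc contributes the integral of [1 / t]
    from [|s|] to [r]. *)
Lemma integrated_countE m r : 0 < r -> locfin m -> integrated_count (NC m) (m 0) r = NN m r.
Proof.
move=> r0 hm; have [S uS cS] := locfin_cover r hm.
pose S' := [seq s <- S | s != 0].
have [_ E] := @integral_step_sum S' m r r0 (fun s => ltac:(by rewrite mem_filter => /andP[])).
have split0 (F : R[i] -> R) : (m 0 != 0 -> 0 \in S) -> (m 0 = 0 -> F 0 = 0) ->
    \sum_(s <- S) F s = F 0 + \sum_(s <- S') F s.
  move=> h0 F0; rewrite big_filter; have [S0|S0] := boolP (0 \in S).
    by rewrite (bigD1_seq 0)//=.
  rewrite F0 ?add0r; last by apply/eqP; apply: contraNT S0.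
  rewrite [RHS]big_mkcond; apply: eq_big_seq => s sS.
  by rewrite ifT//; apply: contraNneq S0 => <-.
have m00 : m 0 != 0 -> 0 \in S by apply: cS; rewrite modulus0.
rewrite /integrated_count (NN_seq uS cS) split0//; last by move=> ->; rewrite mul0r.
rewrite -E [X in _ = X + _](_ : _ = m 0 * ln r); last first.
  by rewrite /wt /lnmax modulus0 r0 (@ln0 _ 0)// subr0.
rewrite addrC; congr (_ + _); apply: eq_Rintegral => t; rewrite inE/= in_itv/= => /andP[t0 tr].
have cSt : covers S m t by move=> z zt; apply: cS; exact: lt_trans tr.
rewrite (NC_seq uS cSt) split0//; last by rewrite modulus0 t0.
rewrite modulus0 t0 addrC addKr mulr_suml; apply: eq_bigr => s _.
by case: ifP; rewrite ?mul0r ?mulr0.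
Qed.

End Counting.

(** * Jensen's formula and the oscillation of the logarithm on circles *)

Section Jensen.
Context {R : realType}.
Local Notation C := (R[i]^o).
Implicit Types (F G : R[i] -> R) (g h : R[i] -> R[i]) (z s : R[i]) (r : R).

Definition mean r F : R := (2 * pi)^-1 * rint 0 (2 * pi) (fun t => F (circ r t)).

Definition mcont r F := rcont 0 (2 * pi) (fun t => F (circ r t)).

Let c0 : 0 < (2 * pi)^-1 :> R. Proof. by rewrite invr_gt0 pi2_gt0. Qed.
Let p0 : 0 < 2 * pi :> R := pi2_gt0.

Lemma eq_mean r F G : 0 <= r -> (forall z, modulus z = r -> F z = G z) -> mean r F = mean r G.
Proof.
move=> r0 h; congr (_ * _); apply: eq_rint => t _; apply: h; exact: modulus_circ.
Qed.

Lemma meanD r F G : mcont r F -> mcont r G -> mean r (fun z => F z + G z) = mean r F + mean r G.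
Proof. by move=> hF hG; rewrite /mean (rintD hF hG) mulrDr. Qed.

Lemma meanZ r k F : mcont r F -> mean r (fun z => k * F z) = k * mean r F.
Proof. by move=> hF; rewrite /mean (rintZ _ hF) mulrCA. Qed.

Lemma mean_cst r k : mean r (fun=> k) = k.
Proof.
rewrite /mean (rint_cst _ (ltW p0)) subr0 mulrC -mulrA mulfV ?mulr1// gt_eqF//.
Qed.

Lemma mean_le r F G : 0 <= r -> mcont r F -> mcont r G ->
  (forall z, modulus z = r -> F z <= G z) -> mean r F <= mean r G.
Proof.
move=> r0 hF hG h; rewrite /mean ler_pM2l//; apply: rint_le => // t _.
by apply: h; exact: modulus_circ.
Qed.

Lemma mcontD r F G : mcont r F -> mcont r G -> mcont r (fun z => F z + G z).
Proof. exact: rcontD. Qed.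

Lemma mcontZ r k F : mcont r F -> mcont r (fun z => k * F z).
Proof. exact: rcontZ. Qed.

Lemma mcont_cst r k : mcont r (fun=> k).
Proof. exact: rcont_cst. Qed.

Lemma mcont_abs r F : mcont r F -> mcont r (fun z => `|F z|).
Proof. exact: rcont_norm. Qed.

Lemma mcont_sum (T : eqType) (S : seq T) r (F : T -> R[i] -> R) :
  (forall x : T, x \in S -> mcont r (F x)) -> mcont r (fun z => \sum_(x <- S) F x z) /\
  mean r (fun z => \sum_(x <- S) F x z) = \sum_(x <- S) mean r (F x).
Proof.
elim: S => [|s S IH] h.
  have E : (fun z => \sum_(x <- [::]) F x z) = (fun=> 0 : R) by apply/funext => z; rewrite big_nil.
  by rewrite E big_nil; split; [exact: mcont_cst|exact: mean_cst].
have [l1 E1] := IH (fun y ya => h y (ltac:(by rewrite inE ya orbT))).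
have E : (fun z => \sum_(y <- s :: S) F y z) = (fun z => F s z + \sum_(y <- S) F y z).
  by apply/funext => z; rewrite big_cons.
have lx : mcont r (F s) by apply: h; rewrite mem_head.
by rewrite E big_cons -E1 (meanD lx l1); split=> //; exact: mcontD lx l1.
Qed.

Definition lnm g z : R := ln (modulus (g z)).

(** The logarithm of [|g|] is continuous on such a circle, and for each [g] in use only countably
    many radii are lost. *)
Definition good_circle g r := forall z, modulus z = r -> regular_at g z.

Lemma mcont_lnm g r : 0 <= r -> good_circle g r -> mcont r (lnm g).
Proof.
move=> r0 hg; apply: (@rcont_ln_modulus _ g r) => // z /hg[h1 h2]; split=> //.
exact: holomorphic_continuous.
Qed.

Definition has_orders g := forall z, exists m, has_order g z m.

Definition ordR g z : R := (order_at g z)%:~R.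

Lemma ordR_regular g z : regular_at g z -> ordR g z = 0.
Proof. by move=> /regular_order/order_atE; rewrite /ordR => ->. Qed.

Lemma locfin_ord g : has_orders g -> locfin (ordR g).
Proof.
move=> hg r; apply: sub_finite_set (finite_irregular r hg) => z [zr oz].
by split=> // /ordR_regular E; move: oz; rewrite E eqxx.
Qed.

Lemma disc_factorization g r : has_orders g -> exists S h, [/\ uniq S,
  forall s, s \in S <-> modulus s <= r /\ ~ regular_at g s,
  holo r h, forall z, modulus z <= r -> h z != 0 &
  forall z, modulus z <= r -> z \notin S ->
    lnm g z = \sum_(s <- S) ordR g s * ln (modulus (z - s)) + lnm h z].
Proof.
move=> hg; have [S uS hS] := finite_uniq_seq (finite_irregular r hg).
have [z zr zS|s _|h hh hE] := @factorization _ r S g uS.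
- by apply: contrapT => nr; move/negP: zS; apply; apply/hS.
- exact: hg.
exists S, h; split=> //.
- move=> z zr; have [h1 _] := hh z zr; exact: holomorphic_derivable.
- by move=> z zr; have [] := hh z zr.
move=> z zr zS; rewrite /lnm hE// modulusM; have [_ h0] := hh z zr.
have -> : modulus (\prod_(s <- S) (z - s) ^ order_at g s) =
    \prod_(s <- S) modulus (z - s) ^ order_at g s.
  elim: (S) => [|s S' IH]; first by rewrite !big_nil modulus1.
  rewrite !big_cons modulusM IH; congr (_ * _).
  case: (order_at g s) => n; first exact: modulusX.
  by rewrite !NegzE -!exprnN modulusV modulusX.
have pos s : s \in S -> 0 < modulus (z - s).
  by move=> sS; rewrite modulus_gt0 subr_eq0; apply: contraNneq zS => ->.
have lnexp (x : R) (m : int) : 0 < x -> ln (x ^ m) = m%:~R * ln x.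
  move=> x0; case: m => n; first by rewrite lnXn// -mulr_natl.
  by rewrite NegzE -exprnN lnV ?posrE ?exprn_gt0// lnXn// mulrNz mulNr -mulr_natl.
have [P0 PE] : 0 < \prod_(s <- S) modulus (z - s) ^ order_at g s /\
    ln (\prod_(s <- S) modulus (z - s) ^ order_at g s) =
    \sum_(s <- S) ordR g s * ln (modulus (z - s)).
  elim: (S) pos => [|s S' IH] pos; first by rewrite !big_nil ln1.
  have [h1 h2] := IH (fun y ya => pos y (ltac:(by rewrite inE ya orbT))).
  have h3 := pos s (mem_head _ _).
  rewrite !big_cons; split; first by rewrite mulr_gt0// exprz_gt0.
  by rewrite lnM ?posrE ?exprz_gt0// lnexp// h2.
by rewrite lnM ?posrE ?modulus_gt0// PE.
Qed.

Section Disc.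
Variables (g : R[i] -> R[i]) (rho : R) (S : seq R[i]) (h : R[i] -> R[i]).
Hypothesis uS : uniq S.
Hypothesis hS : forall s, s \in S <-> modulus s <= rho /\ ~ regular_at g s.
Hypothesis hh : holo rho h.
Hypothesis h0 : forall z, modulus z <= rho -> h z != 0.
Hypothesis gE : forall z, modulus z <= rho -> z \notin S ->
    lnm g z = \sum_(s <- S) ordR g s * ln (modulus (z - s)) + lnm h z.
Variable r : R.
Hypothesis r0 : 0 < r.
Hypothesis rrho : r < rho.
Hypothesis gr : good_circle g r.

Lemma circle_notin z : modulus z = r -> z \notin S.
Proof. by move=> zr; apply/negP => /hS[_]; apply; exact: gr. Qed.

Lemma zero_off_circle s : s \in S -> modulus s != r.
Proof. by move=> sS; apply/eqP => sr; have := circle_notin sr; rewrite sS. Qed.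

Lemma disc_mcont_h : mcont r (lnm h).
Proof.
apply: rcont_ln_holo; [exact: ltW|exact: holoS (ltW rrho) hh|].
by move=> z zr; apply: h0; exact: le_trans (ltW rrho).
Qed.

Lemma disc_mcont_term s : s \in S -> mcont r (fun z => ordR g s * ln (modulus (z - s))).
Proof. by move=> /zero_off_circle sr; apply: mcontZ; exact: rcont_ln_sub. Qed.

(** Termwise mean of the factorization: [ln |z - s|] has mean [lnmax r s], and [ln |h|] has its
    value at 0. *)
Lemma disc_jensen : mean r (lnm g) = \sum_(s <- S) ordR g s * lnmax r s + lnm h 0.
Proof.
have [c1 E1] := mcont_sum disc_mcont_term.
rewrite (eq_mean (ltW r0) (G := fun z => \sum_(s <- S) ordR g s * ln (modulus (z - s)) + lnm h z)).
  rewrite (meanD c1 disc_mcont_h) E1; congr (_ + _).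
    apply: eq_big_seq => s sS; have sr := zero_off_circle sS.
    rewrite meanZ; last exact: rcont_ln_sub.
    by congr (_ * _); rewrite /mean mean_ln_sub// mulrC mulfK// gt_eqF.
  rewrite /mean (mean_ln r0 rrho hh h0) mulrC mulfK// gt_eqF//.
move=> z zr; rewrite gE ?circle_notin// zr; exact: ltW.
Qed.

Lemma disc_mean_abs : mean r (fun z => \sum_(s <- S) `|ordR g s| * `|ln (modulus (z - s)) - lnmax r s|) <=
  2 * ln 2 * \sum_(s <- S) `|ordR g s|.
Proof.
have cs s : s \in S -> mcont r (fun z => `|ln (modulus (z - s)) - lnmax r s|).
  move=> /zero_off_circle sr; apply: mcont_abs.
  by apply: mcontD; [exact: rcont_ln_sub|exact: mcont_cst].
have [c1 ->] := mcont_sum (fun s sS => mcontZ (k := `|ordR g s|) (cs s sS)).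
rewrite mulr_sumr big_seq_cond [leRHS]big_seq_cond; apply: ler_sum => s; rewrite andbT => sS.
rewrite (meanZ _ (cs s sS)) mulrC ler_wpM2r// /mean mulrC ler_pdivrMr//.
exact: mean_abs_ln_sub r0 (zero_off_circle sS).
Qed.

Lemma disc_mcont_abs : mcont r (fun z => \sum_(s <- S) `|ordR g s| * `|ln (modulus (z - s)) - lnmax r s|).
Proof.
have cs s : s \in S -> mcont r (fun z => `|ordR g s| * `|ln (modulus (z - s)) - lnmax r s|).
  move=> /zero_off_circle sr; apply: mcontZ; apply: mcont_abs.
  by apply: mcontD; [exact: rcont_ln_sub|exact: mcont_cst].
by have [] := mcont_sum cs.
Qed.

Lemma disc_split (z : R[i]) : modulus z = r ->
  lnm g z - \sum_(s <- S) ordR g s * lnmax r s =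
  \sum_(s <- S) ordR g s * (ln (modulus (z - s)) - lnmax r s) + lnm h z.
Proof.
move=> zr; rewrite gE ?circle_notin// ?zr ?ltW// addrAC -sumrB; congr (_ + _).
by apply: eq_bigr => s _; rewrite mulrBr.
Qed.

Lemma disc_abs_sum (z : R[i]) : `|\sum_(s <- S) ordR g s * (ln (modulus (z - s)) - lnmax r s)| <=
  \sum_(s <- S) `|ordR g s| * `|ln (modulus (z - s)) - lnmax r s|.
Proof.
apply: (le_trans (ler_norm_sum _ _ _)); apply: ler_sum => s _.
by rewrite normrM.
Qed.

End Disc.

(** The constant is the logarithm of the modulus of the leading Laurent coefficient at 0. Instead of
    identifying it, the proof compares [r] with one fixed good radius [r1], through a factorization
    on a disc containing both circles. *)
Lemma jensen g : has_orders g -> exists K, forall r, 0 < r -> good_circle g r ->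
  mean r (lnm g) = NN (ordR g) r + K.
Proof.
move=> hg; have [[r1 [r10 g1]]|no] := pselect (exists r1, 0 < r1 /\ good_circle g r1); last first.
  by exists 0 => r r0 gr; exfalso; apply: no; exists r.
exists (mean r1 (lnm g) - NN (ordR g) r1) => r r0 gr.
pose rho := r + r1.
have [S [h [uS hS hh h0 gE]]] := disc_factorization rho hg.
have rr : r < rho by rewrite ltrDl.
have rr1 : r1 < rho by rewrite ltrDr.
have cov x : x < rho -> covers S (ordR g) x.
  move=> xr z zx oz; apply/hS; split; first exact: ltW (lt_trans zx xr).
  by move=> /ordR_regular E; move: oz; rewrite E eqxx.
rewrite (disc_jensen hS hh h0 gE r0 rr gr) (disc_jensen hS hh h0 gE r10 rr1 g1).
rewrite (NN_seq uS (cov _ rr)) (NN_seq uS (cov _ rr1)).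
have E x : \sum_(s <- S) ordR g s * lnmax x s = \sum_(s <- S) ordR g s * wt x s + \sum_(s <- S) ordR g s * ln (modulus s).
  by rewrite -big_split/=; apply: eq_bigr => s _; rewrite /wt; ring.
by rewrite !E; ring.
Qed.

(** [nu] bounds the number of zeros and poles in [|z| <= 2 * r1]. There [ln |g|] is a sum of terms
    [ord * ln |z - s|] plus [ln |h|] with [h] free of zeros. The sum has mean deviation at most
    [2 * ln 2 * nu] on [|z| = r]. By [ln_oscillation], the variation of [ln |h|] there is controlled
    by its mean deviation on [|z| = r1], where [ln |h|] is [ln |g|] minus a sum of the same kind. *)
Lemma oscillation g r r1 r2 : has_orders g -> 0 < r -> r < r1 -> 1 <= r1 -> 2 * r1 < r2 ->
  good_circle g r -> good_circle g r1 ->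
  forall nu, nu = NN (fun z => `|ordR g z|) r2 / ln (r2 / (2 * r1)) ->
  mean r (fun z => `|lnm g z - mean r (lnm g)|) <=
  2 * ln 2 * nu + 2 * r / (r1 - r) * (mean r1 (fun z => `|lnm g z|) + 2 * ln 2 * nu).
Proof.
move=> hg r0 rr1 r1_ge1 r12 gr gr1 nu nuE.
have r10 : 0 < r1 by exact: lt_trans rr1.
have [S [h [uS hS hh h0 gE]]] := disc_factorization (2 * r1) hg.
have rho1 : r1 < 2 * r1 by lra.
have rho0 : r < 2 * r1 by lra.
pose n := \sum_(s <- S) `|ordR g s|.
have n0 : 0 <= n by rewrite sumr_ge0.
have l0 : 0 < ln (r2 / (2 * r1)) by rewrite ln_gt0// ltr_pdivlMr ?mulr_gt0// mul1r.
(* Each zero or pole in [|z| <= 2 * r1] has weight at least [ln (r2 / (2 * r1))] in the integrated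
   count up to [r2]. *)
have nnu : n <= nu.
  rewrite nuE ler_pdivlMr//.
  have la : locfin (fun z => `|ordR g z|).
    by apply: locfin_le (locfin_ord hg) => z; rewrite normr_eq0.
  have [S2 uS2 cS2] := locfin_cover r2 la.
  have [S3 [uS3 cS3 SS3]] : exists S3, [/\ uniq S3, covers S3 (fun z => `|ordR g z|) r2 & {subset S <= S3}].
    exists (undup (S ++ S2)); split; first exact: undup_uniq.
      by move=> z zr oz; rewrite mem_undup mem_cat (cS2 z zr oz) orbT.
    by move=> z zS; rewrite mem_undup mem_cat zS.
  rewrite (NN_seq uS3 cS3) /n mulr_suml.
  have sub : \sum_(s <- S) `|ordR g s| * wt r2 s <= \sum_(s <- S3) `|ordR g s| * wt r2 s.
    rewrite [leRHS](bigID (fun s => s \in S))/=.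
    have -> : \sum_(s <- S3 | s \in S) `|ordR g s| * wt r2 s = \sum_(s <- S) `|ordR g s| * wt r2 s.
      rewrite -big_filter; apply: perm_big; apply: uniq_perm => //; first exact: filter_uniq.
      by move=> x; rewrite mem_filter andb_idr//; exact: SS3.
    by rewrite lerDl sumr_ge0// => s _; rewrite mulr_ge0// wt_ge0//; lra.
  apply: le_trans sub; rewrite big_seq_cond [leRHS]big_seq_cond.
  apply: ler_sum => s; rewrite andbT => /hS[sr _]; rewrite ler_wpM2l//.
  have sr2 : modulus s < r2 by exact: le_lt_trans r12.
  have r20 : 0 < r2 by exact: le_lt_trans (modulus_ge0 s) sr2.
  rewrite /wt /lnmax sr2 ln_div ?posrE ?mulr_gt0// lerD2l lerN2.
  have := modulus_ge0 s; rewrite le_eqVlt => /predU1P[<-|s0].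
    by rewrite (@ln0 _ 0)// ln_ge0//; lra.
  by rewrite ler_ln ?posrE ?mulr_gt0.
have l2 : 0 <= ln 2 :> R by rewrite ln_ge0// ler1n.
have cg := mcont_lnm (ltW r0) gr; have cg1 := mcont_lnm (ltW r10) gr1.
(* With this constant, [lnm h - L] on [|z| = r1] is [lnm g] minus the sum of the centred terms,
   which [disc_mean_abs] bounds. *)
pose L := - \sum_(s <- S) ordR g s * lnmax r1 s.
have ch1 := disc_mcont_h hh h0 r10 rho1.
have chL : mcont r1 (fun z => `|lnm h z - L|).
  by apply: mcont_abs; apply: mcontD ch1 _; exact: mcont_cst.
have h_mean : mean r1 (fun z => `|lnm h z - L|) <= mean r1 (fun z => `|lnm g z|) + 2 * ln 2 * nu.
  have ca := disc_mcont_abs hS r10 gr1.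
  apply: (@le_trans _ _ (mean r1 (fun z => `|lnm g z| + \sum_(s <- S) `|ordR g s| * `|ln (modulus (z - s)) - lnmax r1 s|))).
    apply: (mean_le (ltW r10) chL (mcontD (mcont_abs cg1) ca)) => z zr.
    have E := disc_split hS gE rho1 gr1 zr.
    have -> : lnm h z - L = lnm g z - \sum_(s <- S) ordR g s * (ln (modulus (z - s)) - lnmax r1 s).
      by rewrite /L opprK; apply/eqP; rewrite eq_sym subr_eq addrAC -subr_eq E addrC.
    by apply: (le_trans (ler_normB _ _)); rewrite lerD2l disc_abs_sum.
  rewrite (meanD (mcont_abs cg1) ca) lerD2l.
  apply: (le_trans (disc_mean_abs hS r10 gr1)).
  by rewrite ler_wpM2l// mulr_ge0.
have ca := disc_mcont_abs hS r0 gr.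
set B := 2 * r / (r1 - r) * (mean r1 (fun z => `|lnm g z|) + 2 * ln 2 * nu).
apply: (@le_trans _ _ (mean r (fun z => (\sum_(s <- S) `|ordR g s| * `|ln (modulus (z - s)) - lnmax r s|) + B))).
  apply: (mean_le (ltW r0)) => [||z zr].
  - by apply: mcont_abs; apply: mcontD cg _; exact: mcont_cst.
  - by apply: mcontD ca _; exact: mcont_cst.
  rewrite (disc_jensen hS hh h0 gE r0 rho0 gr).
  have E := disc_split hS gE rho0 gr zr.
  have -> : lnm g z - (\sum_(s <- S) ordR g s * lnmax r s + lnm h 0) =
     \sum_(s <- S) ordR g s * (ln (modulus (z - s)) - lnmax r s) + (lnm h z - lnm h 0).
    by rewrite opprD addrA E addrA.
  apply: (le_trans (ler_normD _ _)); apply: lerD; first exact: disc_abs_sum.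
  have zr1 : modulus z < r1 by rewrite zr.
  have := ln_oscillation L zr1 rho1 hh h0; rewrite zr -ler_pdivlMr// => o.
  apply: (le_trans o); rewrite /B -[leLHS]mulrA; apply: ler_wpM2l.
    by rewrite divr_ge0 ?mulr_ge0 ?(ltW r0)// subr_ge0 ltW.
  by rewrite mulrC; exact: h_mean.
rewrite (meanD ca (@mcont_cst r B)) mean_cst lerD2r.
apply: (le_trans (disc_mean_abs hS r0 gr)).
by rewrite ler_wpM2l// mulr_ge0.
Qed.

End Jensen.

(** * The Jackson difference operator *)

Section OrderArithmetic.
Context {R : realType}.
Local Notation C := (R[i]^o).
Implicit Types (g h : R[i] -> R[i]) (z s c : R[i]) (m n : int).

Lemma order_ge_mono g z m n : n <= m -> order_ge g z m -> order_ge g z n.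
Proof.
move=> nm [h hh hE]; have [d dE] : exists d : nat, m = n + d%:Z.
  by exists (absz (m - n)%R); move: nm; clear; lia.
exists (fun w => (w - z) ^+ d * h w).
  have h1 : holomorphic_at (fun w => w - z) z.
    exact: (holomorphicD (holomorphic_id z) (holomorphic_cst (- z) z)).
  exact: (holomorphicM (holomorphicX d h1) hh).
have := hE; apply: (near_dnbhsS2C _ hE) => w wz E _.
have wz0 : w - z != 0 by rewrite subr_eq0.
by rewrite E dE expfzDr// -mulrA.
Qed.

Lemma order_geD g h z m : order_ge g z m -> order_ge h z m -> order_ge (fun w => g w + h w) z m.
Proof.
move=> [g1 hg1 gE] [h1 hh1 hE]; exists (fun w => g1 w + h1 w).
  exact: (holomorphicD hg1 hh1).
by apply: (near_dnbhsS2C _ gE hE) => w _ -> ->; rewrite mulrDr.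
Qed.

Lemma order_ge_cst c z : order_ge (fun=> c) z 0.
Proof.
exists (fun=> c); first exact: holomorphic_cst.
by apply/near_dnbhsC; exists 1 => // w _ _; rewrite expr0z mul1r.
Qed.

Lemma order_ge_holomorphic g h z (e : R) : 0 < e ->
  (forall w, w != z -> modulus (w - z) < e -> g w = h w) -> holomorphic_at h z -> order_ge g z 0.
Proof.
move=> e0 gh hh; exists h => //; apply/near_dnbhsC; exists e => // w wz we.
by rewrite expr0z mul1r gh.
Qed.

Lemma vanishes_order_ge g z m : vanishes_near g z -> order_ge g z m.
Proof.
move=> vz; exists (fun=> 0); first exact: holomorphic_cst.
by apply: (near_dnbhsS2C _ vz vz) => w _ -> _; rewrite mulr0.
Qed.

Lemma order_at_vanishing g z : vanishes_near g z -> order_at g z = 0.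
Proof.
move=> vz; rewrite /order_at; case: xgetP => [n _ hn|//].
by case: (order_not_vanishing hn vz).
Qed.

Lemma order_ge_pole g z : (exists n, order_ge g z n) -> order_ge g z (- (pole_mult g z)%:Z).
Proof.
move=> [n /order_ge_dichotomy[[m _ hm]|vz]]; last exact: vanishes_order_ge.
apply: order_ge_mono (has_order_ge hm); rewrite /pole_mult (order_atE hm).
lia.
Qed.

Lemma pole_mult_le g z (n : nat) : order_ge g z (- n%:Z) -> (pole_mult g z <= n)%N.
Proof.
move=> hn; have [[m _ hm]|vz] := order_ge_dichotomy hn; last first.
  by rewrite /pole_mult (order_at_vanishing vz).
have := has_order_le hm hn; rewrite /pole_mult (order_atE hm); lia.
Qed.

Lemma order_ge_scale g (q : R[i]) z m : q != 0 -> order_ge g (q * z) m ->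
  order_ge (fun w => g (q * w)) z m.
Proof.
move=> q0 [h hh /near_dnbhsC[e e0 he]].
have q00 : 0 < modulus q by rewrite modulus_gt0.
exists (fun w => q ^ m * h (q * w + 0)).
  have h1 : holomorphic_at (fun w => h (q * w + 0)) z.
    by apply: holomorphic_affine; rewrite addr0.
  exact: (holomorphicM (holomorphic_cst (q ^ m) z) h1).
apply/near_dnbhsC; exists (e / modulus q); first by rewrite divr_gt0.
move=> w wz we; rewrite addr0 he.
- by rewrite -mulrBr expfzMl mulrCA mulrA.
- by rewrite (inj_eq (mulfI q0)).
- by rewrite -mulrBr modulusM mulrC -ltr_pdivlMr.
Qed.

Lemma ordR_split g z : ordR g z = (zero_mult g z)%:R - (pole_mult g z)%:R :> R.
Proof.
rewrite /ordR /zero_mult /pole_mult; move: (order_at g z) => n.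
have -> : n = (absz (Num.max 0 n))%:Z - (absz (Num.max 0 (- n)))%:Z by lia.
set a := absz _; set b := absz _.
have -> : absz (Num.max 0 (a%:Z - b%:Z)) = a by rewrite /a /b; lia.
have -> : absz (Num.max 0 (- (a%:Z - b%:Z))) = b by rewrite /a /b; lia.
by rewrite rmorphB.
Qed.

Lemma abs_ordR g z : `|ordR g z| = (zero_mult g z)%:R + (pole_mult g z)%:R :> R.
Proof.
rewrite /ordR /zero_mult /pole_mult; move: (order_at g z) => n.
have [n0|n0] : 0 <= n \/ n < 0 by case: (leP 0 n) => ?; [left|right].
  have -> : absz (Num.max 0 (- n)) = 0%N by lia.
  have -> : absz (Num.max 0 n) = absz n by lia.
  by rewrite addr0 ger0_norm ?ler0z// -{1}(gez0_abs n0).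
have -> : absz (Num.max 0 n) = 0%N by lia.
have -> : absz (Num.max 0 (- n)) = absz n by lia.
by rewrite add0r ler0_norm ?lerz0 ?ltW// -rmorphN/= -(ltz0_abs n0).
Qed.

Lemma has_order_scaled g z m c : c != 0 -> has_order g z m -> has_order (fun w => g w * c) z m.
Proof.
move=> c0 hm; apply: (has_orderM_regular hm).
by split=> //; exact: holomorphic_cst.
Qed.

End OrderArithmetic.

Section Sphere.
Context {R : realType}.
Local Notation C := (R[i]^o).
Variable f : R[i] -> sphere R.
Hypothesis f_mero : meromorphic f.
Hypothesis f_nonconst : ~ exists c : sphere R, forall z : R[i], f z = c.

Local Notation F := (finite_part f).

Definition shifted c w := F w - c.

(** In the second alternative [f] has no zero near [z], since [sphere_inv] would send it to
    infinity; finiteness off [z] is the first clause of [meromorphic]. *)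
Lemma sphere_local z :
  (exists g e, [/\ holomorphic_at g z, 0 < e & forall w, modulus (w - z) < e -> f w = Some (g w)]) \/
  (exists g e, [/\ holomorphic_at g z, (0 : R) < e, (f z = None -> g z = 0),
     (forall c, f z = Some c -> c != 0 /\ g z = c^-1) &
     forall w, w != z -> modulus (w - z) < e -> [/\ f w = Some (F w), F w != 0 & g w = (F w)^-1]]).
Proof.
have [/near_dnbhsC[e1 e10 fin] [[g hg /nearC[e e0 he]]|[g hg /nearC[e e0 he]]]] := f_mero z.
  by left; exists g, e.
right; exists g, (Num.min e e1); split=> //.
- by rewrite lt_min e0.
- move=> fz; have := he z; rewrite subrr modulus0 => /(_ e0); rewrite fz /=.
  by case.
- move=> c fz; have := he z; rewrite subrr modulus0 => /(_ e0); rewrite fz /=.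
  by case: eqVneq => // c0 [<-].
move=> w wz; rewrite lt_min => /andP[we we1].
have := he w we; have := fin w wz we1; rewrite /finite_part.
case: (f w) => //= c _; case: eqVneq => // c0 [<-].
by [].
Qed.

Lemma sphere_order_ge z : exists n, order_ge F z n.
Proof.
case: (sphere_local z) => [[g [e [hg e0 he]]]|[g [e [hg e0 _ _ he]]]].
  exists 0; apply: (order_ge_holomorphic e0 _ hg) => w _ we.
  by rewrite /finite_part he.
have [[m [k [hk k0 kE]]]|/near_dnbhs_weakC/near_dnbhsC[d d0 hd]] := holomorphic_order hg; last first.
  exists 0; apply: vanishes_order_ge; apply/near_dnbhsC.
  exists (Num.min e d); first by rewrite lt_min e0.
  move=> w wz; rewrite lt_min => /andP[we wd].
  have [_ F0 gE] := he w wz we; have := hd w wz wd; rewrite gE => /eqP.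
  by rewrite invr_eq0 (negbTE F0).
exists (- m%:Z), (fun w => (k w)^-1); first exact: (holomorphicV k0 hk).
have he' : \forall w \near (z : C)^', F w != 0 /\ g w = (F w)^-1.
  by apply/near_dnbhsC; exists e => // w wz we; have [] := he w wz we.
apply: (near_dnbhsS2C _ he' kE) => w wz [F0 gE] gE'.
by rewrite -[F w]invrK -gE gE' invfM -[_ ^ m%:Z]/(_ ^+ m) exprnN.
Qed.

Lemma shifted_mero c : mero (shifted c).
Proof.
move=> z; have h := order_ge_pole (sphere_order_ge z).
exists (- (pole_mult F z)%:Z); apply: order_geD h _.
by apply: order_ge_mono (order_ge_cst (- c) z); lia.
Qed.

Lemma F_finite z c : f z = Some c -> exists2 g, holomorphic_at g z & exists2 e : R, 0 < e &
  forall w, modulus (w - z) < e -> F w = g w /\ f w = Some (g w).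
Proof.
move=> fz; case: (sphere_local z) => [[g [e [hg e0 he]]]|[g [e [hg e0 _ hz he]]]].
  exists g => //; exists e => // w we; rewrite he//; split=> //.
  by rewrite /finite_part he.
have [c0 gz] := hz c fz; have g0 : g z != 0 by rewrite gz invr_eq0.
exists (fun w => (g w)^-1); first exact: (holomorphicV g0 hg).
exists e => // w we; have [->|wz] := eqVneq w z.
  by rewrite /finite_part fz gz invrK.
by have [h1 h2 h3] := he w wz we; rewrite h3 invrK.
Qed.

(** The germ only determines [f] off [z]; at [z] the value follows by continuity of the holomorphic
    representative of [f] or of [1 / f]. *)
Lemma shifted_vanishing c z : vanishes_near (shifted c) z -> f z = Some c.
Proof.
move=> /near_dnbhsC[e0 e00 he0].
have FE w : w != z -> modulus (w - z) < e0 -> F w = c.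
  by move=> wz we; apply/eqP; rewrite -subr_eq0; apply/eqP; exact: he0.
case: (sphere_local z) => [[g [e [hg e_gt0 he]]]|[g [e [hg e_gt0 hN hS he]]]].
  have gz : g z = c.
    apply: (@near_dnbhs_eq _ g (fun=> c)) => //.
    - exact: holomorphic_continuous.
    - exact: holomorphic_continuous (holomorphic_cst c z).
    apply/near_dnbhsC; exists (Num.min e e0); first by rewrite lt_min e_gt0.
    move=> w wz; rewrite lt_min => /andP[we we0]; rewrite -(FE w wz we0).
    by rewrite /finite_part he.
  by rewrite he ?gz// subrr modulus0.
pose d := Num.min e e0 / 2.
have m0 : 0 < Num.min e e0 by rewrite lt_min e_gt0.
have d0 : 0 < d by rewrite divr_gt0.
have dm : d < Num.min e e0 by rewrite /d; lra.
have md : modulus (z + d%:C - z) = d by rewrite addrC addKr modulus_real ger0_norm// ltW.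
have wz : z + d%:C != z by rewrite -subr_eq0 -modulus_eq0 md gt_eqF.
have c0 : c != 0.
  move: dm; rewrite lt_min => /andP[de de0].
  have [_ h2 _] := he _ wz (ltac:(by rewrite md)).
  by move: h2; rewrite FE// md.
have gz : g z = c^-1.
  apply: (@near_dnbhs_eq _ g (fun=> c^-1)) => //.
  - exact: holomorphic_continuous.
  - exact: holomorphic_continuous (holomorphic_cst c^-1 z).
  apply/near_dnbhsC; exists (Num.min e e0) => // w wz'; rewrite lt_min => /andP[we we0].
  by have [_ _ ->] := he w wz' we; rewrite FE.
case fz : (f z) => [c1|]; last first.
  by have := hN fz; rewrite gz => /eqP; rewrite invr_eq0 (negbTE c0).
by have [_] := hS c1 fz; rewrite gz => /invr_inj ->.
Qed.

Lemma shifted_orders c : has_orders (shifted c).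
Proof.
have [//|v] := identity_principle (shifted_mero c).
exfalso; apply: f_nonconst; exists (Some c) => z; exact: shifted_vanishing.
Qed.

Lemma finite_part_orders : has_orders F.
Proof.
have -> : F = shifted 0 by apply/funext => w; rewrite /shifted subr0.
exact: shifted_orders.
Qed.

Lemma pole_mult_shifted c z : pole_mult (shifted c) z = pole_mult F z.
Proof.
apply/eqP; rewrite eqn_leq; apply/andP; split; apply: pole_mult_le.
  apply: order_geD; first exact: order_ge_pole (sphere_order_ge z).
  by apply: order_ge_mono (order_ge_cst (- c) z); lia.
have -> : F = (fun w => shifted c w + c) by apply/funext => w; rewrite /shifted subrK.
apply: order_geD; first exact: order_ge_pole (shifted_mero c z).
by apply: order_ge_mono (order_ge_cst c z); lia.
Qed.

Lemma pole_mult_finite z c : f z = Some c -> pole_mult F z = 0%N.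
Proof.
move=> /F_finite[g hg [e e0 he]]; apply/eqP; rewrite -leqn0; apply: pole_mult_le.
by apply: (order_ge_holomorphic e0 _ hg) => w _ we; have [] := he w we.
Qed.

(** Without a pole of [F], the product of [F] and the representative of [1 / f] would be 1 near [z],
    while the latter vanishes at [z]. *)
Lemma pole_mult_pole z : f z = None -> (0 < pole_mult F z)%N.
Proof.
move=> fz; have [m hm] := finite_part_orders z.
rewrite lt0n; apply/eqP => p0.
have := order_ge_pole (sphere_order_ge z); rewrite p0 oppr0 => -[k hk kE].
case: (sphere_local z) => [[g [e [_ e0 he]]]|[g [e [hg e0 hN _ he]]]].
  by have := he z; rewrite subrr modulus0 fz => /(_ e0).
have gz := hN fz.
have : g z * k z = 1.
  apply: (@near_dnbhs_eq _ (fun w => g w * k w) (fun=> 1)).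
  - exact: holomorphic_continuous (holomorphicM hg hk).
  - exact: holomorphic_continuous (holomorphic_cst 1 z).
  have he' : \forall w \near (z : C)^', F w != 0 /\ g w = (F w)^-1.
    by apply/near_dnbhsC; exists e => // w wz we; have [] := he w wz we.
  apply: (near_dnbhsS2C _ he' kE) => w wz [F0 gE]; rewrite expr0z mul1r => <-.
  by rewrite gE mulVf.
by rewrite gz mul0r => /eqP; rewrite eq_sym oner_eq0.
Qed.

(** Zeros of [shifted c] are genuine [c]-points, so for different [c] they are disjoint. *)
Lemma zero_mult_value z c : (0 < zero_mult (shifted c) z)%N -> f z = Some c.
Proof.
have [m hm] := shifted_orders c z; rewrite {1}/zero_mult (order_atE hm) => m0.
case fz : (f z) => [c1|]; last first.
  have := pole_mult_pole fz; rewrite -(pole_mult_shifted c z) /pole_mult (order_atE hm).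
  by move: m0; clear; lia.
have [g hg [e e0 he]] := F_finite fz; congr Some; apply/eqP; rewrite -subr_eq0.
have [n nE] : exists n : nat, m = 1 + n%:Z by exists (absz m).-1; move: m0; clear; lia.
have [k [hk k0 kE]] := hm.
have gz : g z = c1 by have := he z; rewrite subrr modulus0 fz => /(_ e0)[_ []].
have h1 : holomorphic_at (fun w => w - z) z.
  exact: (holomorphicD (holomorphic_id z) (holomorphic_cst (- z) z)).
have : g z - c = (z - z) ^+ n.+1 * k z.
  apply: (@near_dnbhs_eq _ (fun w => g w - c) (fun w => (w - z) ^+ n.+1 * k w)).
  - exact: holomorphic_continuous (holomorphicD hg (holomorphic_cst (- c) z)).
  - exact: holomorphic_continuous (holomorphicM (holomorphicX n.+1 h1) hk).
  have he' : \forall w \near (z : C)^', F w = g w.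
    by apply/near_dnbhsC; exists e => // w _ we; have [] := he w we.
  apply: (near_dnbhsS2C _ he' kE) => w wz E; rewrite /shifted E => ->.
  by congr (_ * _); rewrite nE.
by rewrite subrr expr0n/= mul0r gz => ->.
Qed.

Variable q : R[i].
Hypothesis q_neq0 : q != 0.
Hypothesis q_lt1 : modulus q < 1.

(* The numerator of [jackson q f]; the denominator can only lower the
   multiplicity of a zero at 0. *)
Definition qdiff w := F (q * w) - F w.

Lemma qdiff_mero : mero qdiff.
Proof.
move=> z; exists (- (pole_mult F z + pole_mult F (q * z)%R)%N%:Z).
have -> : qdiff = (fun w => F (q * w) + -1 * F w) by apply/funext => w; rewrite mulN1r.
apply: order_geD.
  apply: order_ge_scale => //; apply: order_ge_mono (order_ge_pole (sphere_order_ge _)); lia.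
have [h hh hE] := order_ge_pole (sphere_order_ge z).
apply: (@order_ge_mono _ _ _ (- (pole_mult F z)%:Z)); first by lia.
exists (fun w => -1 * h w); first exact: (holomorphicM (holomorphic_cst (-1) z) hh).
by apply: (near_dnbhsS2C _ hE hE) => w _ -> _; rewrite mulrCA.
Qed.

Lemma pole_mult_qdiff z : (pole_mult qdiff z <= pole_mult F z + pole_mult F (q * z)%R)%N.
Proof.
apply: pole_mult_le.
have -> : qdiff = (fun w => F (q * w) + -1 * F w) by apply/funext => w; rewrite mulN1r.
apply: order_geD.
  apply: order_ge_scale => //; apply: order_ge_mono (order_ge_pole (sphere_order_ge _)); lia.
have [h hh hE] := order_ge_pole (sphere_order_ge z).
apply: (@order_ge_mono _ _ _ (- (pole_mult F z)%:Z)); first by lia.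
exists (fun w => -1 * h w); first exact: (holomorphicM (holomorphic_cst (-1) z) hh).
by apply: (near_dnbhsS2C _ hE hE) => w _ -> _; rewrite mulrCA.
Qed.

(* Comparing leading coefficients at 0: [g (q w) = g w] forces [q ^ m = 1]. *)
Lemma qinvariant_order c m : vanishes_near qdiff 0 -> has_order (shifted c) 0 m -> m = 0.
Proof.
move=> /near_dnbhsC[e1 e10 he1] [h [hh h0 /near_dnbhsC[e2 e20 he2]]].
have q0 : 0 < modulus q by rewrite modulus_gt0.
have : q ^ m * h (q * 0 + 0) = h 0.
  apply: (@near_dnbhs_eq _ (fun w => q ^ m * h (q * w + 0)) h).
  - have hq : holomorphic_at (fun w => h (q * w + 0)) 0.
      by apply: holomorphic_affine; rewrite mulr0 addr0.
    exact: holomorphic_continuous (holomorphicM (holomorphic_cst (q ^ m) 0) hq).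
  - exact: holomorphic_continuous.
  apply/near_dnbhsC; exists (Num.min e1 e2); first by rewrite lt_min e10.
  move=> w w0; rewrite lt_min subr0 => /andP[we1 we2].
  have := he1 w w0; rewrite subr0 => /(_ we1)/eqP; rewrite subr_eq0 => /eqP FE.
  have := he2 w w0; rewrite subr0 => /(_ we2) E1.
  have := he2 (q * w); rewrite mulf_neq0// subr0 modulusM => /(_ isT) E2.
  have {}E2 := E2 (ltac:(by apply: le_lt_trans we2; rewrite ler_piMl ?modulus_ge0// ltW)).
  rewrite addr0; apply: (mulfI (expfz_neq0 m w0)); rewrite -E1.
  have -> : shifted c w = shifted c (q * w) by rewrite /shifted FE.
  by rewrite E2 expfzMl mulrA [w ^ m * _]mulrC.
rewrite mulr0 addr0 -{2}[h 0]mul1r => /(mulIf h0)/(congr1 (@modulus R)).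
rewrite modulus1; case: m {he2} => n.
  case: n => // n; rewrite -[q ^ _]/(q ^+ n.+1) modulusX => E; exfalso.
  by have := exprn_ilt1 n.+1 (ltW q0) q_lt1; rewrite E ltxx.
rewrite NegzE -exprnN modulusV modulusX => /(congr1 GRing.inv); rewrite invrK invr1 => E.
exfalso; by have := exprn_ilt1 n.+1 (ltW q0) q_lt1; rewrite E ltxx.
Qed.

(** If [qdiff] vanished identically, every [shifted c] would have order 0 at 0 by
    [qinvariant_order]. This fails for the limit [c = h 0] of [F] at 0, where [h] comes from the
    case [c = 0]. *)
Lemma qdiff_orders : has_orders qdiff.
Proof.
have [//|v] := identity_principle qdiff_mero; exfalso.
have [m0 h0] := shifted_orders 0 0.
have E0 := qinvariant_order (v 0) h0; rewrite E0 in h0.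
have [h [hh hn0 hE]] := h0.
have [m1 h1] := shifted_orders (h 0) 0.
have E1 := qinvariant_order (v 0) h1; rewrite E1 in h1.
have [k [hk k0 kE]] := h1.
have : k 0 = h 0 - h 0.
  apply: (@near_dnbhs_eq _ k (fun w => h w - h 0)).
  - exact: holomorphic_continuous.
  - exact: holomorphic_continuous (holomorphicD hh (holomorphic_cst (- h 0) 0)).
  apply: (near_dnbhsS2C _ hE kE) => w _; rewrite /shifted !expr0z !mul1r subr0 => <- <-.
  by [].
by rewrite subrr => /eqP; rewrite (negbTE k0).
Qed.

Lemma zero_mult_jackson z : (zero_mult (jackson q f) z <= zero_mult qdiff z)%N.
Proof.
have [m hm] := qdiff_orders z.
have q1 : q - 1 != 0.
  by rewrite subr_eq0; apply: contraTneq q_lt1 => ->; rewrite modulus1 ltxx.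
have JE : jackson q f = (fun w => qdiff w * (w ^ (-1 : int)) * (q - 1)^-1).
  apply/funext => w; rewrite /jackson /qdiff.
  have -> : q * w - w = w * (q - 1) by rewrite mulrBr mulr1 mulrC.
  by rewrite invfM mulrA.
have [n nm hn] : exists2 n : int, n <= m & has_order (jackson q f) z n.
  rewrite JE; have [z0|z0] := eqVneq z 0; last first.
    exists m => //; apply: has_order_scaled; first by rewrite invr_eq0.
    apply: (has_orderM_regular hm).
    have := regular_exprz (-1 : int) z0.
    by have -> : (fun x : R[i] => (x - 0) ^ (-1 : int)) = (fun x => x ^ (-1 : int)); [apply/funext => x; rewrite subr0|].
  exists (m - 1); first by lia.
  apply: has_order_scaled; first by rewrite invr_eq0.
  rewrite z0 in hm *; have [k [hk k0 kE]] := hm; exists k; split; [exact: hk|exact: k0|].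
  apply: (near_dnbhsS2C _ kE kE) => w w0 E _.
  by rewrite E subr0 mulrAC -expfzDr.
rewrite /zero_mult (order_atE hm) (order_atE hn); clear -nm; lia.
Qed.

(** Multiplicities satisfy [h <= (h - min h k') + k'], and [zero_mult_jackson] bounds [k']. The
    guards [f z = Some c] ensure that a sum over distinct [c] charges each zero of [qdiff] at most
    once. *)
Lemma ramification_bound c z :
  (zero_mult (shifted c) z)%:R <=
  (if `[< f z = Some c >] then (jackson_mult q f (Some c) z)%:R else 0) +
  (if `[< f z = Some c >] then (zero_mult qdiff z)%:R else 0) :> R.
Proof.
have [z0|] := posnP (zero_mult (shifted c) z).
  by rewrite z0 addr_ge0//; case: ifP.
move=> /zero_mult_value fz; rewrite !ifT; [|exact/asboolP..].
rewrite -natrD ler_nat /jackson_mult /jackson_mult_fin.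
have -> : (fun w => finite_part f w - c) = shifted c by [].
have := zero_mult_jackson z; move: (zero_mult (jackson q f) z) (zero_mult qdiff z) (zero_mult (shifted c) z).
by move=> a b d; lia.
Qed.

End Sphere.

(** * First main theorem estimates *)

Section Rotation.
Context {R : realType}.
Implicit Types (G : R -> R) (a b phi t : R).

Lemma rint_shift G a b phi : a <= b -> (forall t, {for t, continuous G}) ->
  rint a b (fun t => G (t + phi)) = rint (a + phi) (b + phi) G.
Proof.
(* Starting the primitive before [a + phi] makes it differentiable at that end point too; both sides
   are then increments of [P]. *)
move=> ab cG; pose c := a + phi - 1.
pose P x := rint c x G.
have dP x : c < x -> is_derive x 1 P (G x).
  move=> cx; have xu : x < x + 1 by rewrite ltrDl.
  have ii : (@lebesgue_measure R).-integrable `[c, x + 1] (EFin \o G).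
    by apply: rint_integrable => t _; exact: cG.
  have [h1 h2] := continuous_FTC1_closed xu ii cx (cG x).
  by split; [exact: h1|rewrite -derive1E; exact: h2].
have -> : rint (a + phi) (b + phi) G = P (b + phi) - P (a + phi).
  apply: rint_FTC => [|t _|t /andP[h _]]; [by rewrite lerD2r|exact: cG|].
  by apply: dP; apply: lt_le_trans h; rewrite /c ltrBlDr ltrDl.
apply: (@rint_FTC _ a b (fun t => P (t + phi))) => // [t _|t /andP[h _]].
  have c1 : {for t, continuous (fun x : R => x + phi)}.
    by apply: cvgD; [exact: cvg_id|exact: cvg_cst].
  exact: (continuous_comp c1 (cG (t + phi))).
have d1 : is_derive (t + phi) 1 P (G (t + phi)).
  apply: dP; rewrite /c; lra.
have d2 : is_derive t 1 (fun x : R => x + phi) 1.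
  have h1 := @is_deriveD _ _ _ id (cst phi) t 1 _ _ (is_derive_id _ _) (is_derive_cst _ _ _).
  by apply: (is_derive_eq h1); rewrite addr0.
have h3 := @is_derive1_comp R P (fun x : R => x + phi) t _ _ d1 d2.
by apply: (is_derive_eq h3); rewrite mulr1.
Qed.

Lemma rint_periodic G phi : 0 <= phi <= 2 * pi -> (forall t, {for t, continuous G}) ->
  (forall t, G (t + 2 * pi) = G t) ->
  rint 0 (2 * pi) (fun t => G (t + phi)) = rint 0 (2 * pi) G.
Proof.
move=> /andP[f0 f2] cG per; have p0 := @pi2_gt0 R.
have rc u v : rcont u v G by move=> t _; exact: cG.
rewrite rint_shift ?(ltW p0)// add0r.
rewrite (@rint_split _ phi (2 * pi + phi) (2 * pi))//; last by rewrite f2 lerDl.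
rewrite [X in _ + X](_ : _ = rint 0 phi G).
  by rewrite addrC [RHS](@rint_split _ 0 (2 * pi) phi)// f0.
rewrite -[X in rint X _ _]add0r [2 * pi + phi]addrC -rint_shift//.
by apply: eq_rint => t _; exact: per.
Qed.

Lemma unit_circ (u : R[i]) : modulus u = 1 -> exists2 phi, 0 <= phi <= 2 * pi & u = circ 1 phi.
Proof.
move=> u1; have x1 : -1 <= Re u <= 1 by rewrite -ler_norml -u1 Re_le_modulus.
have E : Re u ^+ 2 + Im u ^+ 2 = 1.
  move: u1; rewrite /modulus; case: (u) => x y /= /(congr1 (fun v => v ^+ 2)).
  by rewrite expr1n sqr_sqrtr ?addr_ge0 ?sqr_ge0.
have [a0 api] := conj (acos_ge0 x1) (acos_lepi x1).
have cE : cos (acos (Re u)) = Re u by rewrite acosK// in_itv.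
have sE : sin (acos (Re u)) = `|Im u|.
  by rewrite sin_acos// -E addrAC subrr add0r sqrtr_sqr.
have p0 := @pi_gt0 R.
have [y0|y0] := leP 0 (Im u).
  exists (acos (Re u)); first by rewrite a0 (le_trans api)//; lra.
  by rewrite /circ !mul1r cE sE ger0_norm//; case: (u).
exists (2 * pi - acos (Re u)); first by apply/andP; split; lra.
have -> : 2 * pi - acos (Re u) = - acos (Re u) + pi *+ 2 by rewrite addrC mulr_natl.
rewrite /circ !mul1r cosD2pi sinD2pi cosN sinN cE sE ltr0_norm// opprK.
by case: (u).
Qed.

Lemma mean_rotation r (u : R[i]) (H : R[i] -> R) : modulus u = 1 ->
  (forall t, {for t, continuous (fun t => H (circ r t))}) ->
  mean r (fun z => H (u * z)) = mean r H.
Proof.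
move=> /unit_circ[phi hphi ->] cH; congr (_ * _).
rewrite -(rint_periodic hphi cH) => [|t]; last first.
  by rewrite /circ mulr_natl cosD2pi sinD2pi.
apply: eq_rint => t _; congr H; rewrite /circ cosD sinD; simpc.
by congr (_ +i* _); ring.
Qed.

End Rotation.

Section Characteristic.
Context {R : realType}.
Local Notation C := (R[i]^o).
Variable f : R[i] -> sphere R.
Hypothesis f_mero : meromorphic f.
Hypothesis f_nonconst : ~ exists c : sphere R, forall z : R[i], f z = c.

Local Notation F := (finite_part f).

Definition lp (g : R[i] -> R[i]) z : R := log_plus (modulus (g z)).

Lemma lpE (g : R[i] -> R[i]) z : lp g z = 2^-1 * (lnm g z + `|lnm g z|).
Proof.
rewrite /lp /log_plus /lnm; move: (ln _) => x.
have [x0|x0] := leP 0 x; first by rewrite ger0_norm//; lra.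
by rewrite ltr0_norm// subrr mulr0.
Qed.

Lemma continuous_lp (g : R[i] -> R[i]) r (t : R) : 0 <= r -> good_circle g r ->
  {for t, continuous (fun x => lp g (circ r x))}.
Proof.
move=> r0 gr.
have c : rcont t t (fun x => lnm g (circ r x)).
  apply: (@rcont_ln_modulus _ g r) => // z /gr[h1 h2]; split=> //.
  exact: holomorphic_continuous.
have -> : (fun x => lp g (circ r x)) = (fun x => 2^-1 * (lnm g (circ r x) + `|lnm g (circ r x)|)).
  by apply/funext => x; exact: lpE.
by apply: (rcontZ (rcontD c (rcont_norm c))); rewrite lexx.
Qed.

Lemma mcont_lp (g : R[i] -> R[i]) r : 0 <= r -> good_circle g r -> mcont r (lp g).
Proof.
move=> r0 gr; have c := mcont_lnm r0 gr.
have -> : lp g = (fun z => 2^-1 * (lnm g z + `|lnm g z|)) by apply/funext => z; exact: lpE.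
exact: mcontZ (mcontD c (mcont_abs c)).
Qed.

Lemma lp_ge0 (g : R[i] -> R[i]) z : 0 <= lp g z.
Proof. by rewrite /lp /log_plus le_max lexx. Qed.

Lemma lnm_le_lp (g : R[i] -> R[i]) z : lnm g z <= lp g z.
Proof. by rewrite /lp /log_plus le_max lexx orbT. Qed.

(* [log+ |x + y| <= log+ |x| + log+ |y| + log 2] *)
Lemma log_plusD (x y : R) (w : R) : 0 <= x -> 0 <= y -> 0 <= w -> w <= x + y ->
  log_plus w <= log_plus x + log_plus y + ln 2.
Proof.
move=> x0 y0 w0 wxy.
have l2 : 0 <= ln 2 :> R by rewrite ln_ge0// ler1n.
have A (u v : R) : 0 <= u -> 0 <= v -> w <= u + v -> v <= u -> log_plus w <= log_plus u + log_plus v + ln 2.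
  move=> u0 v0 wuv vu.
  have lv : 0 <= log_plus v by rewrite /log_plus le_max lexx.
  suff : log_plus w <= log_plus u + ln 2 by lra.
  rewrite {1}/log_plus ge_max; apply/andP; split.
    by rewrite addr_ge0// /log_plus le_max lexx.
  move: w0; rewrite le_eqVlt => /predU1P[<-|w0].
    by rewrite ln0// addr_ge0// /log_plus le_max lexx.
  have u1 : 0 < u by lra.
  apply: (@le_trans _ _ (ln u + ln 2)); last by rewrite lerD2r /log_plus le_max lexx orbT.
  by rewrite -lnM ?posrE// ler_ln ?posrE ?mulr_gt0//; lra.
have [yx|xy] := leP y x; first exact: A.
have := A y x y0 x0; rewrite [y + x]addrC [log_plus y + _]addrC; apply => //.
exact: ltW.
Qed.

Lemma lp_add (g h k : R[i] -> R[i]) z : k z = g z + h z -> lp k z <= lp g z + lp h z + ln 2.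
Proof.
by move=> E; apply: log_plusD; rewrite ?modulus_ge0// E modulusD.
Qed.

Definition pm z : R := (pole_mult F z)%:R.
Definition zm (g : R[i] -> R[i]) z : R := (zero_mult g z)%:R.

Definition T r : R := mean r (lp F) + NN pm r.

Lemma locfin_pole (g : R[i] -> R[i]) : has_orders g -> locfin (fun z => (pole_mult g z)%:R : R).
Proof.
move=> /locfin_ord; apply: locfin_le => z; apply: contraNneq => E.
have := abs_ordR g z; rewrite E normr0 => /eqP; rewrite eq_sym paddr_eq0 ?ler0n//.
by case/andP.
Qed.

Lemma locfin_zero (g : R[i] -> R[i]) : has_orders g -> locfin (zm g).
Proof.
move=> /locfin_ord; apply: locfin_le => z; apply: contraNneq => E.
have := abs_ordR g z; rewrite E normr0 => /eqP; rewrite eq_sym paddr_eq0 ?ler0n//.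
by case/andP.
Qed.

Lemma locfin_pm : locfin pm.
Proof. exact: locfin_pole (finite_part_orders f_mero f_nonconst). Qed.

(** [pole_count] sums over the points where [f] is infinite, [NC pm] over the whole disc; they agree
    because [F] has no pole where [f] is finite. *)
Lemma characteristicE r : 0 < r -> characteristic f r = T r.
Proof.
move=> r0; have E : pole_count f = NC pm.
  apply/funext => x; rewrite /pole_count /NC; apply: fsbig_widen; first by move=> z [].
  move=> z [zx nz]; rewrite /= (_ : pole_mult _ z = 0%N)//.
  case fz : (f z) => [c|]; last by case: nz.
  exact: (pole_mult_finite f_mero fz).
by rewrite /characteristic E (integrated_countE r0 locfin_pm).
Qed.

Lemma NN_ord (g : R[i] -> R[i]) r : has_orders g ->
  NN (ordR g) r = NN (zm g) r - NN (fun z => (pole_mult g z)%:R) r.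
Proof.
move=> hg; have -> : ordR g = (fun z => zm g z + -1 * (pole_mult g z)%:R).
  by apply/funext => z; rewrite ordR_split mulN1r.
have lz := locfin_zero hg; have lq := locfin_pole hg.
rewrite NN_D// ?NN_Z ?mulN1r//.
by apply: locfin_le lq => z; apply: contraNneq => ->; rewrite mulr0.
Qed.

Lemma NN_abs_ord (g : R[i] -> R[i]) r : has_orders g ->
  NN (fun z => `|ordR g z|) r = NN (zm g) r + NN (fun z => (pole_mult g z)%:R) r.
Proof.
move=> hg; have -> : (fun z => `|ordR g z|) = (fun z => zm g z + (pole_mult g z)%:R).
  by apply/funext => z; rewrite abs_ordR.
by rewrite NN_D//; [exact: locfin_zero|exact: locfin_pole].
Qed.

Lemma mean_ge0 r (H : R[i] -> R) : 0 <= r -> mcont r H -> (forall z, 0 <= H z) -> 0 <= mean r H.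
Proof.
by move=> r0 cH h; rewrite -(@mean_cst R r 0); apply: mean_le => //; exact: mcont_cst.
Qed.

(** The first main theorem in four forms. Jensen's formula for [f - a] links its zeros, poles and
    mean logarithm, and the proximity functions of [f] and [f - a] differ by at most [b]. Here
    [lp - lnm] is [log+ |1 / (f - a)|], so its mean is the proximity function of [1 / (f - a)]. *)
Lemma value_estimates (a : R[i]) : exists2 K, 0 <= K & forall r, 1 <= r ->
  good_circle F r -> good_circle (shifted f a) r ->
  [/\ NN (zm (shifted f a)) r <= T r + K,
      mean r (fun z => `|lnm (shifted f a) z|) <= 2 * T r + K,
      T r - NN (zm (shifted f a)) r <= mean r (fun z => lp (shifted f a) z - lnm (shifted f a) z) + K &
      NN (fun z => `|ordR (shifted f a) z|) r <= 2 * T r + K].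
Proof.
have ho := shifted_orders f_mero f_nonconst a.
have [K0 hK0] := jensen ho.
have l2 : 0 <= ln 2 :> R by rewrite ln_ge0// ler1n.
pose b := log_plus (modulus a) + ln 2.
have b0 : 0 <= b by rewrite addr_ge0// /log_plus le_max lexx.
(* The bound on the mean of [|ln |f - a||] involves the proximity function of [f - a] twice, hence
   [2 * b]. *)
exists (2 * b + `|K0|); first by rewrite addr_ge0// mulr_ge0.
move=> r r1 gF ga; have r0 : 0 < r by lra.
have r0' := ltW r0.
have K1 := ler_norm K0; have K2 := ler_norm (- K0); rewrite normrN in K2.
have cF := mcont_lp r0' gF; have ca := mcont_lp r0' ga; have cu := mcont_lnm r0' ga.
have mF : 0 <= mean r (lp F) by apply: mean_ge0 => // z; exact: lp_ge0.
have hz : 0 <= NN (zm (shifted f a)) r by apply: NN_ge0 => //; exact: locfin_zero.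
have hp : 0 <= NN pm r by apply: NN_ge0 => //; exact: locfin_pm.
have pE : (fun z => (pole_mult (shifted f a) z)%:R : R) = pm.
  by apply/funext => z; rewrite /pm (pole_mult_shifted f_mero).
have J : mean r (lnm (shifted f a)) = NN (zm (shifted f a)) r - NN pm r + K0.
  by rewrite (hK0 r r0 ga) (NN_ord r ho) pE.
have up : mean r (lp (shifted f a)) <= mean r (lp F) + b.
  rewrite -(@mean_cst R r b) -(meanD cF (@mcont_cst R r b)).
  apply: (mean_le r0' ca (mcontD cF (@mcont_cst R r b))) => z _.
  have := @lp_add F (fun=> - a) (shifted f a) z erefl.
  have -> : lp (fun=> - a) z = log_plus (modulus a) by rewrite /lp modulusN.
  by rewrite /b addrA.
have dn : mean r (lp F) <= mean r (lp (shifted f a)) + b.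
  rewrite -(@mean_cst R r b) -(meanD ca (@mcont_cst R r b)).
  apply: (mean_le r0' cF (mcontD ca (@mcont_cst R r b))) => z _.
  have := @lp_add (shifted f a) (fun=> a) F z; rewrite /shifted subrK => /(_ erefl).
  by rewrite /b addrA.
have ule : mean r (lnm (shifted f a)) <= mean r (lp (shifted f a)).
  by apply: (mean_le r0' cu ca) => z _; exact: lnm_le_lp.
have absE : mean r (fun z => `|lnm (shifted f a) z|) =
    2 * mean r (lp (shifted f a)) - mean r (lnm (shifted f a)).
  rewrite -(meanZ _ ca) -mulN1r -(meanZ _ cu) -(meanD (mcontZ ca) (mcontZ cu)).
  by apply: eq_mean => // z _; rewrite lpE; lra.
have subE : mean r (fun z => lp (shifted f a) z - lnm (shifted f a) z) =
    mean r (lp (shifted f a)) - mean r (lnm (shifted f a)).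
  rewrite -[X in _ - X]mul1r -mulNr -(meanZ _ cu) -(meanD ca (mcontZ cu)).
  by apply: eq_mean => // z _; rewrite mulN1r.
have fmt : NN (zm (shifted f a)) r <= T r + b + `|K0| by rewrite /T; lra.
split.
- lra.
- by rewrite absE J /T; lra.
- by rewrite subE J /T; lra.
rewrite (NN_abs_ord r ho) pE.
by rewrite /T in fmt *; lra.
Qed.

Lemma NN_origin (m : R[i] -> R) (r : R) : 1 <= r -> locfin m -> (forall z, 0 <= m z) -> 1 <= m 0 -> ln r <= NN m r.
Proof.
move=> r1 lm m0 m01; pose d (z : R[i]) : R := if z == 0 then 1 else 0.
have r0 : 0 < r by lra.
have -> : ln r = NN d r.
  rewrite (@NN_seq _ d r [:: 0])//.
    by rewrite big_seq1 /d eqxx mul1r /wt /lnmax modulus0 r0 (@ln0 _ 0)// subr0.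
  by move=> z _; rewrite /d inE; case: ifP => //; rewrite eqxx.
apply: NN_le => //.
  move=> x; apply: (@sub_finite_set _ _ [set 0]); last exact: finite_set1.
  by move=> z [_]; rewrite /d; case: (eqVneq z 0) => [->|_] //; rewrite eqxx.
by move=> z; rewrite /d; case: eqVneq => [->|].
Qed.

(** The point 0 alone suffices: it is a [c0]-point with [c0 = f 0], or a pole, and contributes at
    least [ln r] to the corresponding counting function. This makes [T] unbounded along the chosen
    radii. *)
Lemma T_growth : exists c0 K, forall r, 1 <= r -> good_circle F r -> good_circle (shifted f c0) r ->
  ln r <= T r + K.
Proof.
case f0 : (f 0) => [c|].
  have [K K0 hK] := value_estimates c; exists c, K => r r1 gF gc.
  have [h1 _ _ _] := hK r r1 gF gc; apply: le_trans h1; apply: NN_origin => //.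
    exact: locfin_zero (shifted_orders f_mero f_nonconst c).
  rewrite /zm ler1n lt0n; apply/eqP => z0.
  have [m hm] := shifted_orders f_mero f_nonconst c 0.
  have := order_ge_pole (shifted_mero f_mero c 0).
  rewrite (pole_mult_shifted f_mero) (pole_mult_finite f_mero f0) oppr0 => /(has_order_le hm) m0.
  have m00 : m = 0.
    by move: z0; rewrite /zero_mult (order_atE hm); move: m0; clear; lia.
  rewrite m00 in hm; have [h [hh hn0 hE]] := hm.
  have [g hg [e e0 he]] := F_finite f_mero f0.
  have : g 0 - c = h 0.
    apply: (@near_dnbhs_eq _ (fun w => g w - c) h).
    - exact: holomorphic_continuous (holomorphicD hg (holomorphic_cst (- c) 0)).
    - exact: holomorphic_continuous.
    have he' : \forall w \near (0 : C)^', F w = g w.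
      by apply/near_dnbhsC; exists e => // w _ we; have [] := he w we.
    by apply: (near_dnbhsS2C _ he' hE) => w _; rewrite /shifted expr0z mul1r => -> ->.
  have [_] := he 0 (ltac:(by rewrite subrr modulus0)); rewrite f0 => -[<-].
  by rewrite subrr => /eqP; rewrite eq_sym (negbTE hn0).
exists 0, 0 => r r1 gF _; rewrite addr0 /T.
have h1 : 0 <= mean r (lp F).
  by apply: mean_ge0; [lra|apply: mcont_lp => //; lra|move=> z; exact: lp_ge0].
have : ln r <= NN pm r; last by lra.
apply: NN_origin => //; first exact: locfin_pm.
by rewrite /pm ler1n; exact: (pole_mult_pole f_mero f_nonconst f0).
Qed.

Variable q : R[i].
Hypothesis q_neq0 : q != 0.
Hypothesis q_lt1 : modulus q < 1.

(** The substitution [s = q * z] turns the weight [ln (r / |z|)] into [ln (|q| * r / |s|)]. Only the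
    origin differs: its weight [ln r] exceeds [ln (|q| * r)] by [- ln |q|]. *)
Lemma NN_scale (m : R[i] -> R) (r : R) : 0 < r -> locfin m -> (forall z, 0 <= m z) ->
  NN (fun z => m (q * z)) r <= NN m (modulus q * r) + m 0 * - ln (modulus q).
Proof.
move=> r0 lm m0; have q0 : 0 < modulus q by rewrite modulus_gt0.
have [S uS cS] := locfin_cover (modulus q * r) lm.
have uS' : uniq (map (fun s => s / q) S).
  by rewrite map_inj_uniq//; apply: mulIf; rewrite invr_eq0.
rewrite (@NN_seq _ (fun z => m (q * z)) r _ uS'); last first.
  move=> z zr mz; apply/mapP; exists (q * z); last by rewrite mulrC mulKf.
  by apply: cS => //; rewrite modulusM ltr_pM2l.
rewrite (NN_seq uS cS) big_map.
have E s : m (q * (s / q)) * wt r (s / q) = m s * wt (modulus q * r) s +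
    m s * (if s == 0 then - ln (modulus q) else 0).
  have -> : q * (s / q) = s by rewrite mulrC divfK.
  rewrite -mulrDr; congr (_ * _); rewrite /wt /lnmax; have [->|s0] := eqVneq s 0.
    rewrite mul0r modulus0 r0 mulr_gt0// (@ln0 _ 0)// !subr0 lnM ?posrE//; lra.
  have ms : 0 < modulus s by rewrite modulus_gt0.
  rewrite modulusM modulusV ltr_pdivrMr// [r * _]mulrC addr0.
  case: ifP => _; last by rewrite !subrr.
  by rewrite [ln (_ / _)]ln_div ?posrE// [ln (modulus q * r)]lnM ?posrE//; lra.
rewrite (eq_bigr _ (fun s _ => E s)) big_split/= lerD2l.
have lq : 0 <= - ln (modulus q) by rewrite oppr_ge0 ln_le0// ltW.
have [S0|S0] := boolP (0 \in S).
  rewrite (bigD1_seq 0)//= eqxx big1 ?addr0// => s /negbTE ->.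
  by rewrite mulr0.
rewrite big1_seq ?mulr_ge0// => s /= sS; rewrite ifF ?mulr0//.
by apply: contraNF S0 => /eqP <-.
Qed.

(** Jensen's formula for [qdiff]: its poles come from those of [F] at [z] and [q * z], and
    [ln |qdiff|] is at most the sum of the two [log+] plus [ln 2]. Multiplication by [q] maps the
    circle of radius [r] to a rotated circle of radius [|q| * r], and the mean is invariant under
    rotation. *)
Lemma ramification_count : exists K, forall r, 1 <= r -> 1 <= modulus q * r ->
  good_circle F r -> good_circle F (modulus q * r) -> good_circle (qdiff f q) r ->
  NN (zm (qdiff f q)) r <= T r + T (modulus q * r) + K.
Proof.
have ho := qdiff_orders f_mero f_nonconst q_neq0 q_lt1.
have [K0 hK0] := jensen ho.
exists (ln 2 + pm 0 * - ln (modulus q) - K0) => r r1 qr1 gF gq gD.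
have r0 : 0 < r by lra.
have q0 : 0 < modulus q by rewrite modulus_gt0.
have qr0 : 0 < modulus q * r by rewrite mulr_gt0.
have J := hK0 r r0 gD; rewrite NN_ord// in J.
have cF := mcont_lp (ltW r0) gF; have cD := mcont_lnm (ltW r0) gD.
have poles : NN (fun z => (pole_mult (qdiff f q) z)%:R) r <=
    NN pm r + (NN pm (modulus q * r) + pm 0 * - ln (modulus q)).
  have lpm := locfin_pm.
  have lq : locfin (fun z => pm (q * z)).
    move=> x; have := lpm (modulus q * x).
    move=> /(finite_image (fun s => s / q)); apply: sub_finite_set => z [zx mz].
    exists (q * z); last by rewrite mulrC mulKf.
    by split=> //; rewrite modulusM ler_pM2l.
  apply: (@le_trans _ _ (NN (fun z => pm z + pm (q * z)) r)).
    apply: (NN_le r1 (locfin_pole ho) (locfinD lpm lq)) => z.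
    by rewrite /pm -natrD ler_nat (pole_mult_qdiff f_mero q_neq0).
  rewrite (NN_D r lpm lq) lerD2l; apply: (NN_scale r0 lpm) => z.
  exact: ler0n.
have q_unit : modulus (q / (modulus q)%:C) = 1.
  by rewrite modulusM modulusV modulus_real ger0_norm ?(ltW q0)// divff// gt_eqF.
have cont (t : R) : {for t, continuous (fun x => lp F (circ (modulus q * r) x))}.
  exact: continuous_lp (ltW qr0) gq.
have [phi hphi uE] := unit_circ q_unit.
have qE t : q * circ r t = (q / (modulus q)%:C) * circ (modulus q * r) t.
  rewrite [circ (_ * r) t]circE [circ r t]circE rmorphM.
  have : (modulus q)%:C != 0 :> R[i] by rewrite -modulus_eq0 modulus_real normr_eq0 gt_eqF.
  by move=> qn0; field.
have shift t : (q / (modulus q)%:C) * circ (modulus q * r) t = circ (modulus q * r) (t + phi).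
  by rewrite uE /circ cosD sinD; simpc; congr (_ +i* _); ring.
have rot : mean r (fun z => lp F (q * z)) = mean (modulus q * r) (lp F) /\ mcont r (fun z => lp F (q * z)).
  split.
    rewrite -(mean_rotation q_unit cont); congr (_ * _).
    by apply: eq_rint => t _; rewrite qE.
  move=> t _.
  have -> : (fun t => lp F (q * circ r t)) = (fun t => lp F (circ (modulus q * r) (t + phi))).
    by apply/funext => x; rewrite qE shift.
  have c1 : {for t, continuous (fun x : R => x + phi)}.
    by apply: cvgD; [exact: cvg_id|exact: cvg_cst].
  exact: (continuous_comp c1 (cont (t + phi))).
have [rotE rotC] := rot.
have up : mean r (lnm (qdiff f q)) <= mean (modulus q * r) (lp F) + mean r (lp F) + ln 2.
  rewrite -rotE -(meanD rotC cF) -(@mean_cst R r (ln 2)) -(meanD (mcontD rotC cF) (@mcont_cst R r _)).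
  apply: (mean_le (ltW r0) cD (mcontD (mcontD rotC cF) (@mcont_cst R r _))) => z _.
  apply: (le_trans (lnm_le_lp _ _)).
  have := @lp_add (fun w => F (q * w)) (fun w => - F w) (qdiff f q) z erefl.
  by have -> : lp (fun w => - F w) z = lp F z by rewrite /lp modulusN.
by rewrite /T; lra.
Qed.

End Characteristic.

(** * Slow radii and deficient values *)

Section Record.
Context {R : realType}.
Variable t : nat -> R.

Lemma argmax_seq n : exists2 m, (m <= n)%N & forall i, (i <= n)%N -> t i <= t m.
Proof.
elim: n => [|n [m mn hm]].
  by exists 0%N => // i; rewrite leqn0 => /eqP ->.
have [le|lt] := leP (t n.+1) (t m).
  exists m => [|i]; first exact: leqW.
  by rewrite leq_eqVlt => /predU1P[->//|]; rewrite ltnS; exact: hm.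
exists n.+1 => // i; rewrite leq_eqVlt => /predU1P[->//|]; rewrite ltnS => /hm h.
exact: le_trans h (ltW lt).
Qed.

Hypothesis t_unbounded : forall B, exists n, B < t n.
Hypothesis t_subexp : forall e, 0 < e -> exists N, forall n, (N <= n)%N -> t n <= expR (e * n%:R).

(* Otherwise each running maximum would be doubled within [k] steps, and [t] would grow exponentially. *)
Lemma slow_record (k N : nat) (B : R) : exists n,
  [/\ (N < n)%N, B <= t n, t n.-1 <= t n & forall i, (i <= k)%N -> t (n + i)%N <= 2 * t n].
Proof.
apply: contrapT => no.
(* Less than the rate [ln 2 / k] of a sequence that doubles within every [k] steps: [j] doublings
   take at most [k * j] steps, over which [e] allows growth by at most [j * ln 2 / 2] in the
   exponent. *)
pose e : R := ln 2 / (2 * k.+1%:R).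
have l2 : 0 < ln 2 :> R by rewrite ln_gt0// ltr1n.
have e0 : 0 < e by rewrite divr_gt0// mulr_gt0.
have [N1 hN1] := t_subexp e0.
pose N2 := maxn N N1.
(* The condition [1 <= t n] makes a doubled value a strictly larger one, and starts the induction on
   powers of 2. *)
pose rec n := [/\ (N2 < n)%N, B <= t n, 1 <= t n & forall i, (i <= n)%N -> t i <= t n].
have step n : rec n -> exists n', [/\ rec n', (n' <= n + k)%N & 2 * t n < t n'].
  move=> [Nn Bn n1 hn].
  have [i ik hi] : exists2 i, (i <= k)%N & 2 * t n < t (n + i)%N.
    apply: contrapT => ni; apply: no; exists n; split => //.
    - by apply: leq_ltn_trans Nn; rewrite leq_maxl.
    - by apply: hn; exact: leq_pred.
    - by move=> i ik; rewrite leNgt; apply/negP => lt; apply: ni; exists i.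
  have [m mn hm] := argmax_seq (n + k).
  have tm : 2 * t n < t m by apply: lt_le_trans hi (hm _ _); rewrite leq_add2l.
  have nm : (n < m)%N by rewrite ltnNge; apply/negP => /hn; lra.
  exists m; split => //; split; [exact: ltn_trans nm|lra|lra|].
  by move=> j jm; apply: hm; exact: leq_trans mn.
have [n0 hn0] : exists n0, rec n0.
  have [M Mn hM] := argmax_seq N2.
  have [n hn] := t_unbounded (Num.max (Num.max B 1) (t M)).
  have [m mn hm] := argmax_seq n.
  have tm : Num.max (Num.max B 1) (t M) < t m by apply: lt_le_trans hn (hm _ _).
  move: tm; rewrite !gt_max => /andP[/andP[Bm m1] Mm].
  exists m; split; [|exact: ltW|exact: ltW|].
    by rewrite ltnNge; apply/negP => /hM; rewrite leNgt Mm.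
  by move=> j jm; apply: hm; exact: leq_trans mn.
have iterate j : exists n, [/\ rec n, (n <= n0 + k * j)%N & 2 ^+ j <= t n].
  elim: j => [|j [n [hn nj tn]]].
    by exists n0; split => //; [rewrite muln0 addn0|case: hn0; rewrite expr0].
  have [m [hm mn tm]] := step n hn; exists m; split => //.
    by rewrite mulnS; lia.
  by rewrite exprS; lra.
have bound j : j%:R * ln 2 <= 2 * (e * n0%:R) :> R.
  have [n [[Nn _ n1 _] nj tn]] := iterate j.
  have h1 : t n <= expR (e * n%:R) by apply: hN1; apply: leq_trans (ltnW Nn); rewrite leq_maxr.
  have h2 : j%:R * ln 2 <= e * n%:R.
    rewrite mulr_natl -lnXn//; rewrite -[leRHS]expRK ler_ln ?posrE ?exprn_gt0 ?expR_gt0//.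
    exact: le_trans h1.
  have h3 : e * n%:R <= e * (n0%:R + k%:R * j%:R).
    by rewrite ler_wpM2l ?(ltW e0)// -natrM -natrD ler_nat.
  have h4 : 2 * (e * (k%:R * j%:R)) <= j%:R * ln 2.
    have -> : 2 * (e * (k%:R * j%:R)) = j%:R * ln 2 * (k%:R / k.+1%:R).
      by rewrite /e; field; rewrite (_ : 1 + k%:R = k.+1%:R) ?pnatr_eq0// -natr1 addrC.
    rewrite ler_piMr// ?mulr_ge0 ?(ltW l2)//.
    by rewrite ler_pdivrMr// mul1r ler_nat.
  by move: h2 h3 h4; rewrite mulrDr; lra.
have e1 : 0 <= 2 * (e * n0%:R) by rewrite !mulr_ge0// ltW.
have := bound (Num.bound (2 * (e * n0%:R) / ln 2)); rewrite leNgt => /negP; apply.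
rewrite -ltr_pdivrMr//; apply: archi_boundP; rewrite divr_ge0// ltW//.
Qed.

End Record.

Lemma sum_at_most_one {R : realType} (U : eqType) (a : seq U) (P : U -> bool) (x : R) :
  uniq a -> (forall c d, P c -> P d -> c = d) -> 0 <= x ->
  \sum_(c <- a) (if P c then x else 0) <= x.
Proof.
move=> ua uP x0; elim: a ua => [|c a IH] /=; first by rewrite big_nil.
move=> /andP[ca ua]; rewrite big_cons; case: ifPn => [Pc|_]; last by rewrite add0r IH.
rewrite big1_seq ?addr0// => d /= da; case: ifP => // Pd.
by move: ca; rewrite (uP c d Pc Pd) da.
Qed.

(** For negative parts, [x^- <= mu^- + |x - mu|]; the left side is [x^-], and [w] is any bound for
    [mu^-]. *)
Lemma negative_part_le {R : realType} (x mu w : R) : 0 <= w -> - mu <= w ->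
  2^-1 * (x + `|x|) - x <= w + `|x - mu|.
Proof.
move=> w0 wmu.
have h1 := ler_norm (x - mu); have h2 := ler_norm (- (x - mu)); rewrite normrN in h2.
have [x0|x0] := leP 0 x; [rewrite (ger0_norm x0)|rewrite (ltr0_norm x0)]; lra.
Qed.

(* The larger of [x] and [y] is at least [m / 2]. *)
Lemma ln_half_le {R : realType} (x y m a b e : R) : 0 < x -> 0 < y -> 0 < m -> m <= x + y ->
  e <= - a -> e <= - b -> ln (m / 2) <= (`|ln x - a| + `|ln y - b|) - e.
Proof.
move=> x0 y0 m0 mxy ea eb.
have h1 := ler_norm (ln x - a); have h2 := ler_norm (ln y - b).
have h3 := normr_ge0 (ln x - a); have h4 := normr_ge0 (ln y - b).
have [le|/ltW le] := leP x y.
  have : ln (m / 2) <= ln y by rewrite ler_ln ?posrE ?divr_gt0//; lra.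
  lra.
have : ln (m / 2) <= ln x by rewrite ler_ln ?posrE ?divr_gt0//; lra.
lra.
Qed.

Section Deficient.
Context {R : realType}.
Local Notation C := (R[i]^o).
Variable f : R[i] -> sphere R.
Hypothesis f_mero : meromorphic f.
Hypothesis f_nonconst : ~ exists c : sphere R, forall z : R[i], f z = c.
Variable q : R[i].
Hypothesis q_neq0 : q != 0.
Hypothesis q_lt1 : modulus q < 1.

Local Notation F := (finite_part f).

Definition jm (c : R[i]) z : R := if `[< f z = Some c >] then (jackson_mult q f (Some c) z)%:R else 0.

Lemma locfin_jm c : locfin (jm c).
Proof.
apply: locfin_le (locfin_zero (shifted_orders f_mero f_nonconst c)) => z.
rewrite /jm /zm; case: ifP => _; last by rewrite eqxx.
rewrite !pnatr_eq0 /jackson_mult /jackson_mult_fin.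
have -> : (fun w => finite_part f w - c) = shifted f c by [].
by apply: contraNneq => ->; rewrite min0n.
Qed.

Lemma jackson_NcountE c r : 0 < r -> jackson_Ncount q f (Some c) r = NN (jm c) r.
Proof.
move=> r0.
have E : jackson_count q f (Some c) = NC (jm c).
  apply/funext => x; rewrite /jackson_count /NC.
  transitivity (\sum_(z \in [set z : R[i] | modulus z < x /\ f z = Some c]) jm c z).
    by apply: eq_fsbigr => z; rewrite inE/= => -[_ fz]; rewrite /jm ifT//; apply/asboolP.
  apply: fsbig_widen; first by move=> z [].
  move=> z [zx nz] /=; rewrite /jm ifF//; apply/negP => /asboolP fz; exact: nz.
by rewrite /jackson_Ncount E -(integrated_countE r0 (locfin_jm c)).
Qed.

Lemma sum_zeros_le (a : seq R[i]) r : uniq a -> 1 <= r ->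
  \sum_(c <- a) NN (zm (shifted f c)) r <= \sum_(c <- a) NN (jm c) r + NN (zm (qdiff f q)) r.
Proof.
move=> ua r1.
have [l1 <-] := @NN_sum R _ a (fun c => zm (shifted f c)) r
  (fun c _ => locfin_zero (shifted_orders f_mero f_nonconst c)).
have [l2 <-] := @NN_sum R _ a jm r (fun c _ => locfin_jm c).
have l3 := locfin_zero (qdiff_orders f_mero f_nonconst q_neq0 q_lt1).
rewrite -(NN_D r l2 l3); apply: (NN_le r1 l1 (locfinD l2 l3)) => z.
have h : \sum_(c <- a) zm (shifted f c) z <=
    \sum_(c <- a) (jm c z + if `[< f z = Some c >] then zm (qdiff f q) z else 0).
  apply: ler_sum => c _; exact: ramification_bound.
apply: (le_trans h); rewrite big_split/= lerD2l.
apply: (@sum_at_most_one R _ a (fun c => `[< f z = Some c >]) _ ua) => [c d /asboolP|].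
  by move=> -> /asboolP[].
exact: ler0n.
Qed.

(** [oscillation] with [r1 = K * r] and [r2 = K * (K * r)]. By slowness all means and counts there
    are at most [W = 4 * T f r + K0]. The error terms are at most [2 * (W / l)] and [6 * (W / l)]
    with [l = ln (K / 2)], so [l >= 32 / eta] turns [8 * 4 * T f r / l] into at most
    [eta * T f r]. *)
Lemma shifted_oscillation (a : R[i]) (eta K : R) : 0 < eta -> 2 < K -> 1 <= ln (K / 2) ->
  32 / eta <= ln (K / 2) -> exists2 D, 0 <= D & forall r, 1 <= r ->
  (forall s, s \in [:: r; K * r; K * (K * r)] -> good_circle F s /\ good_circle (shifted f a) s) ->
  0 <= T f r -> T f (K * r) <= 2 * T f r -> T f (K * (K * r)) <= 2 * T f r ->
  mean r (fun z => `|lnm (shifted f a) z - mean r (lnm (shifted f a))|) <= eta * T f r + D.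
Proof.
move=> eta0 K2 l1 l32; have [K0 K00 hK0] := value_estimates f_mero f_nonconst a.
exists (eta * K0) => [|r r1 good T0 T1 T2]; first by rewrite mulr_ge0// ltW.
have [gF0 ga0] := good r (mem_head _ _).
have [gF1 ga1] := good (K * r) (ltac:(by rewrite !inE eqxx orbT)).
have [gF2 ga2] := good (K * (K * r)) (ltac:(by rewrite !inE eqxx !orbT)).
have r0 : 0 < r by lra.
have Kr : r < K * r by rewrite ltr_pMl//; lra.
have Kr1 : 1 <= K * r by lra.
have KKr : K * r < K * (K * r) by rewrite ltr_pMl; lra.
have r12 : 2 * (K * r) < K * (K * r) by rewrite ltr_pM2r//; lra.
have KKr1 : 1 <= K * (K * r) by lra.
have osc := oscillation (shifted_orders f_mero f_nonconst a) r0 Kr Kr1 r12 ga0 ga1 erefl.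
apply: (le_trans osc).
have [_ m1 _ _] := hK0 _ Kr1 gF1 ga1.
have [_ _ _ n2] := hK0 _ KKr1 gF2 ga2.
have -> : K * (K * r) / (2 * (K * r)) = K / 2 by field; apply/andP; split; rewrite gt_eqF//; lra.
have -> : 2 * r / (K * r - r) = 2 / (K - 1).
  by field; apply/andP; split; rewrite gt_eqF//; lra.
set l := ln (K / 2) in l1 l32 *.
(* [ln (1 + x) <= x] at [x = K / 2 - 1]; it bounds the factor [1 / (K - 1)] by [1 / l], so that both
   errors have the same form. *)
have lK : l <= K - 1.
  have h := @le_ln1Dx R (K / 2 - 1) (ltac:(lra)).
  by rewrite [1 + _]addrC subrK -/l in h; lra.
have l0 : 0 < l by lra.
set N := NN _ _ in n2 *; set M := mean _ _ in m1 *.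
pose W := 4 * T f r + K0.
have W0 : 0 <= W by rewrite /W; lra.
have NW : N <= W by rewrite /W; lra.
have MW : M <= W by rewrite /W; lra.
have ln2_le1 : ln 2 <= 1 :> R.
  have h := @le_ln1Dx R 1 (ltac:(lra)).
  by have -> : (2 : R) = 1 + 1 by lra.
have ln2_ge0 : 0 <= ln 2 :> R by rewrite ln_ge0// ler1n.
have nuW : 2 * ln 2 * (N / l) <= 2 * (W / l).
  rewrite -!mulrA ler_wpM2l//; apply: (@le_trans _ _ (ln 2 * (W / l))).
    by rewrite ler_wpM2l// ler_pM2r ?invr_gt0.
  by rewrite ler_piMl// divr_ge0// ltW.
have Wl : W / l <= W by rewrite ler_pdivrMr// ler_peMr.
have K1 : 0 < K - 1 by lra.
have step : 2 / (K - 1) * (M + 2 * ln 2 * (N / l)) <= 6 * (W / l).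
  apply: (@le_trans _ _ (2 / (K - 1) * (3 * W))).
    by rewrite ler_wpM2l ?divr_ge0 ?(ltW K1)//; lra.
  have -> : 2 / (K - 1) * (3 * W) = 6 * (W / (K - 1)) by field; rewrite gt_eqF.
  by rewrite ler_wpM2l// ler_wpM2l// lef_pV2 ?posrE.
have fin : 8 * (W / l) <= eta * T f r + eta * K0.
  have h : W / l <= W * (eta / 32).
    by rewrite ler_wpM2l// -[X in _ <= X]invf_div lef_pV2 ?posrE// divr_gt0.
  have h2 : eta * K0 >= 0 by rewrite mulr_ge0// ltW.
  have -> : eta * T f r = 8 * (4 * T f r * (eta / 32)) by field.
  have : W * (eta / 32) = 4 * T f r * (eta / 32) + eta * K0 / 32 by rewrite /W; field.
  lra.
lra.
Qed.

(** A proximity function at least [X > Y] forces the mean of the logarithm down to at most [Y - X],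
    for [c] and for [d]. At each point the larger of [|f - c|] and [|f - d|] is at least
    [|c - d| / 2], so [ln (|c - d| / 2)] is at most the sum of the two deviations minus [X - Y].
    Averaging gives [2 * Y - (X - Y)]. *)
Lemma two_values (c d : R[i]) (r X Y : R) : c != d -> 0 <= r ->
  good_circle (shifted f c) r -> good_circle (shifted f d) r ->
  mean r (fun z => `|lnm (shifted f c) z - mean r (lnm (shifted f c))|) <= Y ->
  mean r (fun z => `|lnm (shifted f d) z - mean r (lnm (shifted f d))|) <= Y ->
  X <= mean r (fun z => lp (shifted f c) z - lnm (shifted f c) z) ->
  X <= mean r (fun z => lp (shifted f d) z - lnm (shifted f d) z) ->
  X <= Y \/ X <= 3 * Y - ln (modulus (c - d) / 2).
Proof.
move=> cd r0 gc gd oc od xc xd.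
have single (a : R[i]) : good_circle (shifted f a) r ->
    mean r (fun z => `|lnm (shifted f a) z - mean r (lnm (shifted f a))|) <= Y ->
    X <= mean r (fun z => lp (shifted f a) z - lnm (shifted f a) z) ->
    X - Y <= Num.max 0 (- mean r (lnm (shifted f a))).
  move=> ga oa xa; set mu := mean r (lnm _) in oa *.
  have cu := mcont_lnm r0 ga; have cl := mcont_lp r0 ga.
  have ca : mcont r (fun z => `|lnm (shifted f a) z - mu|).
    exact: mcont_abs (mcontD cu (@mcont_cst R r (- mu))).
  suff : mean r (fun z => lp (shifted f a) z - lnm (shifted f a) z) <= Num.max 0 (- mu) +
    mean r (fun z => `|lnm (shifted f a) z - mu|).
    by move=> h; rewrite lerBlDr; apply: le_trans xa (le_trans h _); rewrite lerD2l.
  rewrite -{1}(@mean_cst R r (Num.max 0 (- mu))) -(meanD (@mcont_cst R r _) ca).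
  apply: mean_le => //.
  - have -> : (fun z => lp (shifted f a) z - lnm (shifted f a) z) =
      (fun z => lp (shifted f a) z + -1 * lnm (shifted f a) z) by apply/funext => z; rewrite mulN1r.
    exact: mcontD cl (mcontZ cu).
  - exact: mcontD (@mcont_cst R r _) ca.
  move=> z _; rewrite lpE; move: (lnm _ z) => x.
  by apply: negative_part_le; rewrite le_max lexx ?orbT.
have hc := single c gc oc xc; have hd := single d gd od xd.
have [le|lt] := leP X Y; [by left|right].
have negc : X - Y <= - mean r (lnm (shifted f c)).
  by move: hc; rewrite le_max; case/orP => //; rewrite subr_le0 leNgt lt.
have negd : X - Y <= - mean r (lnm (shifted f d)).
  by move: hd; rewrite le_max; case/orP => //; rewrite subr_le0 leNgt lt.
set mc := mean r (lnm (shifted f c)) in oc negc *; set md := mean r (lnm (shifted f d)) in od negd *.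
have cc : mcont r (fun z => `|lnm (shifted f c) z - mc|).
  exact: mcont_abs (mcontD (mcont_lnm r0 gc) (@mcont_cst R r (- mc))).
have cdd : mcont r (fun z => `|lnm (shifted f d) z - md|).
  exact: mcont_abs (mcontD (mcont_lnm r0 gd) (@mcont_cst R r (- md))).
have : mean r (fun=> ln (modulus (c - d) / 2)) <=
    mean r (fun z => (`|lnm (shifted f c) z - mc| + `|lnm (shifted f d) z - md|) - (X - Y)).
  apply: (mean_le r0 (@mcont_cst R r _) (mcontD (mcontD cc cdd) (@mcont_cst R r _))) => z zr.
  have [_ nc] := gc z zr; have [_ nd] := gd z zr.
  apply: ln_half_le negc negd; [by rewrite modulus_gt0..|by rewrite modulus_gt0 subr_eq0|].
  have -> : c - d = shifted f d z - shifted f c z by rewrite /shifted; ring.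
  by rewrite [leRHS]addrC modulusB.
rewrite mean_cst (meanD (mcontD cc cdd) (@mcont_cst R r _)) (meanD cc cdd) mean_cst.
move: oc od; move: (mean r _) (mean r _) (ln _); clear=> x y l; lra.
Qed.

End Deficient.

Lemma countable_irregular {R : realType} (g : R[i] -> R[i]) : has_orders g ->
  countable [set r : R | ~ good_circle g r].
Proof.
move=> hg; pose A := \bigcup_n [set z : R[i] | modulus z <= n%:R /\ ~ regular_at g z].
have cA : countable A.
  by apply: bigcup_countable => // n _; apply: finite_set_countable; exact: finite_irregular.
apply: (@sub_countable _ _ _ (modulus @` A)); last exact: sub_countable (card_image_le _ _) cA.
apply: subset_card_le => r /= ng; apply: contrapT => nA; apply: ng => z zr.
apply: contrapT => ngz; apply: nA; exists z => //; exists (Num.bound r) => //=.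
split=> //; rewrite zr ltW//; apply: archi_boundP.
by rewrite -zr modulus_ge0.
Qed.

(** Only countably many [rho] are bad for some [n] and some function of the list, whereas the
    interval from 1 to 2 has positive measure. *)
Lemma good_radius {R : realType} (s : seq (R[i] -> R[i])) (Q : R) : Q != 0 ->
  (forall g, List.In g s -> has_orders g) ->
  exists2 rho, 1 <= rho <= 2 & forall n g, List.In g s -> good_circle g (rho * Q ^+ n).
Proof.
move=> Q0 hs; apply: contrapT => no.
pose B g n := [set rho : R | ~ good_circle g (rho * Q ^+ n)].
have cB g n : has_orders g -> countable (B g n).
  move=> hg; have c := countable_irregular hg.
  apply: sub_countable (sub_countable (card_image_le (fun x => x / Q ^+ n) _) c).
  apply: subset_card_le => rho /= nr; exists (rho * Q ^+ n) => //.
  by rewrite mulfK// expf_neq0.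
have cs : countable (\bigcup_n [set rho : R | exists2 g, List.In g s & B g n rho]).
  apply: bigcup_countable => // n _; elim: s hs {no} => [|g s IH] hs.
    by rewrite (_ : [set _ | _] = set0)//; apply/seteqP; split=> // x [].
  apply: (@sub_countable _ _ _ (B g n `|` [set rho : R | exists2 g, List.In g s & B g n rho])).
    apply: subset_card_le => x [h [->|hh] hx]; [by left|by right; exists h].
  rewrite -bigcup2E; apply: bigcup_countable => // -[_|[_|k _]] /=; last exact: countable0.
    by apply: cB; apply: hs; left.
  by apply: IH => h hh; apply: hs; right.
have c12 : countable `[(1 : R), 2].
  apply: (sub_countable _ cs); apply: subset_card_le => rho /=; rewrite in_itv/= => h.
  apply: contrapT => nB; apply: no; exists rho => // n g gs.
  by apply: contrapT => ng; apply: nB; exists n => //; exists g.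
have := countable_lebesgue_measure0 c12; rewrite lebesgue_measure_itv/= lte_fin ltr1n/=.
by move/eqP; rewrite -EFinB eqe subr_eq0 gt_eqF// ltr1n.
Qed.

Lemma le_sum_mem {R : realType} (U : eqType) (a : seq U) (x : U -> R) c :
  (forall d, 0 <= x d) -> c \in a -> x c <= \sum_(d <- a) x d.
Proof.
move=> x0 ca; rewrite (perm_big _ (perm_to_rem ca)) big_cons lerDl.
by apply: sumr_ge0.
Qed.

Lemma one_large {R : realType} (U : eqType) (a : seq U) (x : U -> R) (s : R) :
  (size a)%:R * s < \sum_(c <- a) x c -> exists2 c, c \in a & s < x c.
Proof.
move=> h; apply: contrapT => no; move: h; rewrite ltNge => /negP; apply.
have -> : (size a)%:R * s = \sum_(c <- a) s.
  by rewrite big_const_seq count_predT iter_addr addr0 mulr_natl.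
rewrite !big_seq; apply: ler_sum => c ca.
by rewrite leNgt; apply/negP => lt; apply: no; exists c.
Qed.

(** A single term above [s] adds at most [m]. In the application [m] is the characteristic, the cost
    of the one exceptional value. *)
Lemma two_large {R : realType} (U : eqType) (a : seq U) (x : U -> R) (s m : R) :
  uniq a -> 0 <= s -> 0 <= m -> (forall c, x c <= m) ->
  (size a)%:R * s + m < \sum_(c <- a) x c ->
  exists c d, [/\ c \in a, d \in a, c != d, s < x c & s < x d].
Proof.
move=> ua s0 m0 xm; elim: a ua => [_|c a IH] /=.
  by rewrite big_nil mul0r add0r ltNge m0.
case/andP=> ca ua; rewrite big_cons -natr1 mulrDl mul1r => h.
have [sc|cs] := ltP s (x c).
  have [|d da sd] := @one_large R U a x s; first by have := xm c; lra.
  exists c, d; split=> //; rewrite ?mem_head ?in_cons ?da ?orbT//.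
  by apply: contraNneq ca => ->.
have [|d [e [da ea de sd se]]] := IH ua; first by lra.
by exists d, e; rewrite !in_cons da ea !orbT.
Qed.

Lemma limsup_lt {R : realType} (g : R -> R) (e : R) :
  (limf_esup (fun r => (g r)%:E) (pinfty_nbhs R) < e%:E)%E ->
  exists M, forall r, M < r -> g r <= e.
Proof.
move=> /ereal_inf_lt[_ [V [M [_ hM]] <-] /ltW /ereal_supP h].
by exists M => r Mr; have := h (g r)%:E; rewrite lee_fin; apply; exists r => //; exact: hM.
Qed.

Section FewDeficient.
Context {R : realType}.
Variable f : R[i] -> sphere R.
Hypothesis f_mero : meromorphic f.
Hypothesis f_nonconst : ~ exists c : sphere R, forall z : R[i], f z = c.
Variable q : R[i].
Hypothesis q_neq0 : q != 0.
Hypothesis q_lt1 : modulus q < 1.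
Hypothesis f_order0 : growth_order f = 0%E.

Local Notation F := (finite_part f).
Local Notation Q := (modulus q)^-1.

Lemma good_radii (s : seq (R[i] -> R[i])) : (forall g, List.In g s -> has_orders g) ->
  exists rn : nat -> R, [/\ forall n, 1 <= rn n, forall n k, rn (n + k)%N = Q ^+ k * rn n,
    forall n, ln (rn n) <= 1 + n%:R * ln Q, forall n, n%:R * ln Q <= ln (rn n) &
    forall n g, List.In g s -> good_circle g (rn n)].
Proof.
move=> hs; have q0 : 0 < modulus q by rewrite modulus_gt0.
have Q0 : 0 < Q by rewrite invr_gt0.
have Q1 : 1 <= Q by rewrite ltW// invf_gt1.
have [rho /andP[rho1 rho2] good] := good_radius (lt0r_neq0 Q0) hs.
have rho0 : 0 < rho by lra.
have lnE n : ln (rho * Q ^+ n) = ln rho + n%:R * ln Q.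
  by rewrite lnM ?posrE ?exprn_gt0// lnXn// mulr_natl.
exists (fun n => rho * Q ^+ n); split => // [n|n k|n|n].
- by rewrite -[1]mulr1 ler_pM// exprn_ege1.
- by rewrite exprD; ring.
- rewrite lnE lerD2r; have := @le_ln1Dx R (rho - 1); rewrite [1 + _]addrC subrK; lra.
- by rewrite lnE lerDr ln_ge0.
Qed.

(** Order zero gives [ln T <= e' * ln r] eventually, and [ln (rn n) <= n * (1 + ln Q)] for [n >= 1];
    hence [e' = e / (1 + ln Q)]. *)
Lemma T_subexp (rn : nat -> R) : (forall n, ln (rn n) <= 1 + n%:R * ln Q) ->
  (forall n, n%:R * ln Q <= ln (rn n)) -> (forall n, 1 <= rn n) ->
  forall e, 0 < e -> exists N, forall n, (N <= n)%N -> T f (rn n) <= expR (e * n%:R).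
Proof.
move=> rn_le rn_ge rn1 e e0; have q0 : 0 < modulus q by rewrite modulus_gt0.
have lQ : 0 < ln Q by rewrite ln_gt0// invf_gt1.
have e'0 : 0 < e / (1 + ln Q) by rewrite divr_gt0//; lra.
have [M hM] : exists M, forall r, M < r ->
    ln (characteristic f r) / ln r <= e / (1 + ln Q).
  by apply: limsup_lt; move: f_order0; rewrite /growth_order => ->; rewrite lte_fin.
exists (Num.bound (`|ln (Num.max 1 M)| / ln Q)).+1 => n Nn.
(* For [T <= 0] the logarithm takes its default value 0 and the order says nothing, but the bound is
   trivial. *)
have [Tn|Tn] := ltP 0 (T f (rn n)); last exact: (le_trans Tn (expR_ge0 _)).
have n1 : 1 <= n%:R :> R by rewrite ler1n; exact: leq_trans Nn.
have big : ln (Num.max 1 M) < ln (rn n).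
  apply: lt_le_trans (rn_ge n); apply: le_lt_trans (ler_norm _) _.
  rewrite -ltr_pdivrMr//; apply: (@lt_le_trans _ _ (Num.bound (`|ln (Num.max 1 M)| / ln Q))%:R).
    by apply: archi_boundP; rewrite divr_ge0// ltW.
  by rewrite ler_nat ltnW.
have m0 : 0 < Num.max 1 M by rewrite lt_max ltr01.
have r0 : 0 < rn n by have := rn1 n; lra.
move: big; rewrite ltr_ln ?posrE// gt_max => /andP[r1 rM].
have := hM _ rM; rewrite (characteristicE f_mero f_nonconst r0) ler_pdivrMr ?ln_gt0// => h.
rewrite -[leLHS]lnK ?posrE// ler_expR; apply: (le_trans h).
apply: (@le_trans _ _ (e / (1 + ln Q) * (1 + n%:R * ln Q))); first by rewrite ler_wpM2l// ltW.
have -> : e * n%:R = e / (1 + ln Q) * (n%:R * (1 + ln Q)) by field; rewrite gt_eqF//; lra.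
by rewrite ler_wpM2l ?(ltW e'0)//; lra.
Qed.

Lemma few_deficient (eps r0 : R) (a : seq R[i]) : 0 < eps -> uniq a -> 8 <= (size a)%:R * eps ->
  exists2 c, c \in a & exists2 r, r0 < r &
    1 - eps < jackson_Ncount q f (Some c) r / characteristic f r.
Proof.
have absurd (e t C L l : R) : 0 < e -> 0 < t -> 0 <= C -> 0 <= L -> 4 * C + L < e / 4 * t -> - l <= L ->
    (e / 2 * t - C <= e / 12 * t + C \/ e / 2 * t - C <= 3 * (e / 12 * t + C) - l) -> False.
  by move=> e0 t0 C0 L0 CL lL; have := mulr_gt0 e0 t0; move=> et [] h; lra.
move=> eps0 ua size_a; apply: contrapT => no.
have q0 : 0 < modulus q by rewrite modulus_gt0.
have lQ : 0 < ln Q by rewrite ln_gt0// invf_gt1.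
(* [two_values] is used with [X = eps / 2 * T - C] and [Y = eta * T + C]. Then [3 * Y] contains
   [eps / 4 * T], so both of its conclusions contradict [4 * C + L < eps / 4 * T], as recorded in
   [absurd]. *)
pose eta := eps / 12; have eta0 : 0 < eta by rewrite /eta; lra.
have e32 : 0 <= 32 / eta by rewrite divr_ge0// ltW.
(* Both conditions of [shifted_oscillation] on [ln (K / 2)] are met by [K = Q ^+ k]; being a power
   of [Q], it sends the radii [rn n] to radii of the same sequence. *)
have [k hk] : exists k, ln 2 + 1 + 32 / eta <= k%:R * ln Q.
  exists (Num.bound ((ln 2 + 1 + 32 / eta) / ln Q)); rewrite -ler_pdivrMr// ltW//.
  by apply: archi_boundP; rewrite divr_ge0 ?(ltW lQ)// !addr_ge0// ln_ge0// ler1n.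
pose K := Q ^+ k.
have Q0 : 0 < Q by rewrite invr_gt0.
have K0 : 0 < K by rewrite exprn_gt0.
have lK : 1 + 32 / eta <= ln (K / 2).
  by rewrite ln_div ?posrE// lnXn// -mulr_natl; lra.
have K2 : 2 < K.
  have : 0 < ln (K / 2) by lra.
  by rewrite -[X in X < _]ln1 ltr_ln ?posrE ?divr_gt0//; lra.
have /choice[kv hkv] : forall c : R[i], exists K, 0 <= K /\ forall r, 1 <= r ->
    good_circle F r -> good_circle (shifted f c) r ->
    T f r - NN (zm (shifted f c)) r <= mean r (fun z => lp (shifted f c) z - lnm (shifted f c) z) + K.
  move=> c; have [K1 K10 hK1] := value_estimates f_mero f_nonconst c.
  by exists K1; split=> // r r1 gF gc; have [_ _ h _] := hK1 r r1 gF gc.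
have /choice[dv hdv] : forall c : R[i], exists D, 0 <= D /\ forall r, 1 <= r ->
  (forall s, s \in [:: r; K * r; K * (K * r)] -> good_circle F s /\ good_circle (shifted f c) s) ->
  0 <= T f r -> T f (K * r) <= 2 * T f r -> T f (K * (K * r)) <= 2 * T f r ->
  mean r (fun z => `|lnm (shifted f c) z - mean r (lnm (shifted f c))|) <= eta * T f r + D.
  move=> c; have [||D D0 hD] := @shifted_oscillation _ f f_mero f_nonconst c eta K eta0 K2; [lra..|].
  by exists D.
have [c0 [K1 hK1]] := T_growth f_mero f_nonconst.
have [Kr hKr] := ramification_count f_mero f_nonconst q_neq0 q_lt1.
pose C := \sum_(c <- a) (kv c + dv c).
have hC c : c \in a -> kv c <= C /\ dv c <= C.
  move=> ca; have [k0 _] := hkv c; have [d0 _] := hdv c.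
  have h : kv c + dv c <= C.
    by apply: (@le_sum_mem R _ a (fun c => kv c + dv c)) => // d; apply: addr_ge0; [case: (hkv d)|case: (hdv d)].
  by split; lra.
have C0 : 0 <= C.
  by apply: sumr_ge0 => d _; apply: addr_ge0; [case: (hkv d)|case: (hdv d)].
(* Bounds [- ln (|c - d| / 2)] for all pairs at once; the diagonal terms are [ln 0 = 0]. *)
pose L := \sum_(c <- a) \sum_(d <- a) `|ln (modulus (c - d) / 2)|.
have hL c d : c \in a -> d \in a -> - ln (modulus (c - d) / 2) <= L.
  move=> ca da; apply: le_trans (ler_norm _) _; rewrite normrN.
  have h1 := @le_sum_mem R _ a (fun d => `|ln (modulus (c - d) / 2)|) d (fun _ => normr_ge0 _) da.
  apply: (le_trans h1).
  apply: (@le_sum_mem R _ a (fun c => \sum_(d <- a) `|ln (modulus (c - d) / 2)|)) => // e.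
  by apply: sumr_ge0.
have L0 : 0 <= L by apply: sumr_ge0 => c _; apply: sumr_ge0.
pose gs := [:: F, qdiff f q, shifted f c0 & map (shifted f) a].
have [rn [rn1 rnD rn_le rn_ge good]] : exists rn : nat -> R, [/\ forall n, 1 <= rn n,
    forall n k, rn (n + k)%N = Q ^+ k * rn n,
    forall n, ln (rn n) <= 1 + n%:R * ln Q, forall n, n%:R * ln Q <= ln (rn n) &
    forall n g, List.In g gs -> good_circle g (rn n)].
  apply: good_radii => g /= [<-|[<-|[<-|]]].
  - exact: finite_part_orders f_mero f_nonconst.
  - exact (qdiff_orders f_mero f_nonconst q_neq0 q_lt1).
  - exact: shifted_orders f_mero f_nonconst c0.
  by move=> /List.in_map_iff[c [<- _]]; exact: shifted_orders f_mero f_nonconst c.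
have goodF n : good_circle F (rn n) by apply: good; left.
have goodD n : good_circle (qdiff f q) (rn n) by apply: good; right; left.
have good0 n : good_circle (shifted f c0) (rn n) by apply: good; right; right; left.
have good_a n c : c \in a -> good_circle (shifted f c) (rn n).
  move=> ca; apply: good; right; right; right; apply/List.in_map_iff; exists c; split=> //.
  by move: ca; clear; elim: a => //= b a IH; rewrite inE => /predU1P[->|/IH]; [left|right].
have rn_large B : exists N, forall n, (N <= n)%N -> B < ln (rn n).
  exists (Num.bound (`|B| / ln Q)).+1 => n Nn.
  apply: lt_le_trans (rn_ge n); apply: le_lt_trans (ler_norm _) _.
  rewrite -ltr_pdivrMr//; apply: (@lt_le_trans _ _ (Num.bound (`|B| / ln Q))%:R).
    by apply: archi_boundP; rewrite divr_ge0// ltW.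
  by rewrite ler_nat ltnW.
pose t n := T f (rn n).
have t_unbounded B : exists n, B < t n.
  have [N hN] := rn_large (B + K1); exists N.
  have h1 := hN N (leqnn _); have h2 := hK1 _ (rn1 N) (goodF N) (good0 N).
  by rewrite /t; lra.
have [N1 hN1] := rn_large (ln (Num.max 1 r0)).
(* The first summand makes [4 * C + L] smaller than [eps / 4 * t n]; the others give [Kr < t n] and
   [0 < t n]. *)
pose B := (4 * C + L) * (4 / eps) + `|Kr| + 1.
(* [k + k] steps reach [K * (K * rn n)]. The comparison with [n.-1] serves [ramification_count],
   since [|q| * rn n = rn n.-1]. *)
have [n [Nn Bn tn1 tnk]] := slow_record t_unbounded (T_subexp rn_le rn_ge rn1) (k + k) N1 B.
have CL0 : 0 <= (4 * C + L) * (4 / eps).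
  by rewrite mulr_ge0 ?divr_ge0 ?(ltW eps0)//; lra.
have Kr0 := ler_norm Kr; have Kr1 := normr_ge0 Kr.
have tpos : 0 < t n by rewrite /B in Bn; lra.
have r_gt0 : 0 < rn n by have := rn1 n; lra.
have r0n : r0 < rn n.
  have := hN1 n (ltnW Nn); rewrite ltr_ln ?posrE// ?gt_max; first by case/andP.
  by rewrite lt_max ltr01.
have qr : modulus q * rn n = rn n.-1.
  have -> : rn n = rn (n.-1 + 1)%N by rewrite addn1 prednK//; exact: leq_trans Nn.
  by rewrite rnD expr1 mulrA divff ?mul1r// gt_eqF.
have Kr_n : K * rn n = rn (n + k)%N by rewrite rnD.
have KKr_n : K * (K * rn n) = rn (n + (k + k))%N by rewrite rnD exprD mulrA.
have ram : NN (zm (qdiff f q)) (rn n) <= 2 * t n + Kr.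
  have := hKr (rn n) (rn1 n); rewrite qr => /(_ (rn1 _) (goodF _) (goodF _) (goodD _)).
  by move: tn1; rewrite /t; lra.
have jam : \sum_(c <- a) NN (jm f q c) (rn n) <= (size a)%:R * ((1 - eps) * t n).
  have -> : (size a)%:R * ((1 - eps) * t n) = \sum_(c <- a) ((1 - eps) * t n).
    by rewrite big_const_seq count_predT iter_addr addr0 mulr_natl.
  rewrite !big_seq; apply: ler_sum => c ca.
  rewrite leNgt; apply/negP => lt; apply: no; exists c => //; exists (rn n) => //.
  by rewrite (jackson_NcountE f_mero f_nonconst q _ r_gt0) (characteristicE f_mero f_nonconst r_gt0) ltr_pdivlMr.
have sums := sum_zeros_le f_mero f_nonconst q_neq0 q_lt1 ua (rn1 n).
pose x c := t n - NN (zm (shifted f c)) (rn n).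
have xE : \sum_(c <- a) x c = (size a)%:R * t n - \sum_(c <- a) NN (zm (shifted f c)) (rn n).
  by rewrite /x big_split/= sumrN big_const_seq count_predT iter_addr addr0 mulr_natl.
have xle c : x c <= t n.
  rewrite /x gerBl; apply: NN_ge0 => //; exact: locfin_zero (shifted_orders f_mero f_nonconst c).
have [||c [d [ca da cd xc xd]]] := @two_large R _ a x (eps / 2 * t n) (t n) ua _ (ltW tpos) xle.
- by rewrite mulr_ge0 ?(ltW tpos)//; lra.
(* Origin of the 8: with [p] values, the sum of the [x c] is at least
   [p * eps * t n - 2 * t n - Kr], which exceeds [p * eps * t n - 3 * t n]. It must exceed
   [p * (eps / 2) * t n + t n], and [p * eps / 2 >= 4] ensures this. *)
- rewrite xE; have := ler_wpM2r (ltW tpos) size_a; have tKr : Kr < t n by rewrite /B in Bn; lra.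
  move: sums jam ram tKr; move: (\sum_(c <- a) NN _ _) (\sum_(c <- a) NN _ _) (NN _ _) (t n) (size a)%:R.
  by clear=> s1 s2 s3 tn p; lra.
have osc e : e \in a -> mean (rn n) (fun z => `|lnm (shifted f e) z - mean (rn n) (lnm (shifted f e))|)
    <= eta * t n + C.
  move=> ea; have [_ h] := hdv e; have [_ de] := hC e ea.
  have := h (rn n) (rn1 n); rewrite KKr_n Kr_n => /(_ _ (ltW tpos)) h'.
  apply: le_trans (h' _ _ _) _; last by rewrite lerD2l.
  - by move=> s; rewrite !inE => /or3P[] /eqP->; split=> //; exact: good_a.
  - by apply: tnk; rewrite leq_addr.
  - exact: tnk.
have prox e : e \in a -> eps / 2 * t n < x e -> eps / 2 * t n - C <=
    mean (rn n) (fun z => lp (shifted f e) z - lnm (shifted f e) z).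
  move=> ea xe; have [_ h] := hkv e; have [ke _] := hC e ea.
  have := h (rn n) (rn1 n) (goodF n) (good_a n e ea).
  by move: xe; rewrite /x /t; lra.
have CLt : 4 * C + L < eps / 4 * t n.
  have h : (4 * C + L) * (4 / eps) < t n by rewrite /B in Bn; lra.
  by rewrite -ltr_pdivrMl ?divr_gt0// invf_div mulrC.
exact: absurd eps0 tpos C0 L0 CLt (hL c d ca da) (two_values cd (ltW r_gt0) (good_a n c ca) (good_a n d da)
  (osc c ca) (osc d da) (prox c ca xc) (prox d da xd)).
Qed.

End FewDeficient.

Section Countable.
Context {R : realType}.
Variable f : R[i] -> sphere R.
Hypothesis f_mero : meromorphic f.
Hypothesis f_nonconst : ~ exists c : sphere R, forall z : R[i], f z = c.
Variable q : R[i].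
Hypothesis q_neq0 : q != 0.
Hypothesis q_lt1 : modulus q < 1.
Hypothesis f_order0 : growth_order f = 0%E.

Definition uniformly_deficient (n m : nat) := [set c : R[i] | forall r, m%:R < r ->
  jackson_Ncount q f (Some c) r / characteristic f r <= 1 - n.+1%:R^-1].

(** With [eps = 1 / (n + 1)], already [8 * (n + 1)] distinct values would contradict
    [few_deficient]. *)
Lemma finite_uniformly_deficient n m : finite_set (uniformly_deficient n m).
Proof.
apply: contrapT => /(@infinite_set_fset _ _ (8 * n.+1)%N)[B sB sizeB].
have [||c cB [r mr]] := @few_deficient R f f_mero f_nonconst q q_neq0 q_lt1 f_order0
  n.+1%:R^-1 m%:R (finmap.enum_fset B) _ (finmap.fset_uniq B).
- by rewrite invr_gt0.
- by rewrite ler_pdivlMr// -natrM ler_nat.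
by rewrite ltNge (sB c cB r mr).
Qed.

Lemma deficient_uniformly c : jackson_deficient q f (Some c) -> exists n m, uniformly_deficient n m c.
Proof.
rewrite /jackson_deficient /jackson_ramification => h.
(* A strictly positive index leaves a gap between the upper limit and 1. The limit lives in the
   extended reals, so minus infinity is a case of its own. *)
have [e e1 he] : exists2 e : R, e < 1 & (limf_esup (fun r => (jackson_Ncount q f (Some c) r / characteristic f r)%:E)
    (pinfty_nbhs R) < e%:E)%E.
  move: h; case: limf_esup => [s| |] //=.
    by rewrite -EFinB lte_fin => s1; exists ((s + 1) / 2); rewrite ?lte_fin; lra.
  by move=> _; exists 0; rewrite // ltNyr.
have [M hM] := limsup_lt he.
exists (Num.bound (1 - e)^-1), (Num.bound `|M|) => r Mr.
apply: (@le_trans _ _ e).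
  apply: hM; apply: lt_trans Mr; apply: le_lt_trans (ler_norm _) _; exact: archi_boundP.
have e0 : 0 < 1 - e by lra.
rewrite lerBrDr -lerBrDl invf_ple ?posrE// ltW//; apply: (@lt_trans _ _ (Num.bound (1 - e)^-1)%:R); last by rewrite ltr_nat.
by apply: archi_boundP; rewrite invr_ge0 ltW.
Qed.

End Countable.

Theorem theorem2p4 (R : realType) (q : R[i]) (f : R[i] -> sphere R)
  (q_gt0 : 0 < `|q|) (q_lt1 : `|q| < 1)
  (f_mero : meromorphic f)
  (f_nonconst : ~ exists c : sphere R, forall z : R[i], f z = c)
  (f_order0 : growth_order f = 0%E) :
  countable [set a : sphere R | jackson_deficient q f a].
Proof.
have q0 : q != 0 by rewrite -normr_gt0.
have q1 : modulus q < 1 by move: q_lt1; rewrite normE ltcR.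
pose A := \bigcup_n \bigcup_m uniformly_deficient f q n m.
apply: (@sub_countable _ _ _ ([set None] `|` Some @` A)).
  apply: subset_card_le => -[c|]; [|by left].
  move=> /deficient_uniformly[n [m h]]; right; exists c => //.
  by exists n => //; exists m.
rewrite -bigcup2E; apply: bigcup_countable => // -[_|[_|k _]] /=; [exact: finite_set_countable| |exact: countable0].
apply: sub_countable (card_image_le _ _) _.
apply: bigcup_countable => // n _; apply: bigcup_countable => // m _.
exact/finite_set_countable/finite_uniformly_deficient.
Qed.
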